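(* Let $K\subset\mathbb{N}$ be arbitrary, let $I\subset\mathbb{R}$ be a bounded and symmetric interval, and let $$L=\bigcup_{n\in K}\Big(\big(-\log(n+1),-\log n\big]\cup\big[\log n,\log(n+1)\big)\Big)\subset\mathbb{R}.$$ Then the following conditions are equivalent: (a) $\mathcal{Z}_{K,I}$ is bounded below on $L^2(I)$; (b) $\chi_I\mathcal{F}^{-1}\chi_L\mathcal{F}$ is bounded below on $L^2(I)$; (c) there exists $\delta\in(0,1)$ such that $$\liminf_{x\to\infty}\frac{\pi_K(x)-\pi_K(\delta x)}{x}>0.$$
   Context: $\mathbb{N}=\{1,2,3,\dots\}$. A bounded symmetric interval is $I=(-T,T)$ with $0<T<\infty$. For $K\subset\mathbb{N}$, $\pi_K(x)=\#\{n\in K: n\le x\}$ and $\zeta_K(s)=\sum_{n\in K}n^{-s}$, absolutely convergent for $\operatorname{Re}s>1$. The operator $\mathcal{Z}_{K,I}:L^2(I)\to L^2(I)$ is defined by $$\mathcal{Z}_{K,I}g(t)=\lim_{\delta\to0^+}\frac{\chi_I(t)}{\pi}\int_I g(\tau)\operatorname{Re}\zeta_K(1+\delta+\mathrm{i}(t-\tau))\,\mathrm{d}\tau,$$ with the limit taken in $L^2(I)$ (this is a bounded operator on $L^2(I)$). $L^2(I)$ is identified with the subspace of $L^2(\mathbb{R})$ of functions supported in $I$; $\chi_E$ denotes the characteristic function of a set $E$, and also the operator of multiplication by it. $\mathcal{F}$ is the unitary Fourier transform on $L^2(\mathbb{R})$, $\mathcal{F}g(t)=\frac{1}{\sqrt{2\pi}}\int_{\mathbb{R}}g(\xi)\mathrm{e}^{-\mathrm{i}\xi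 t}\,\mathrm{d}\xi$. The operator $\chi_I\mathcal{F}^{-1}\chi_L\mathcal{F}$ is considered as an operator from $L^2(I)$ to $L^2(I)$. An operator $T$ is bounded below on $L^2(I)$ if there is $c>0$ with $\|Tg\|\ge c\|g\|$ for all $g\in L^2(I)$. *)

(* Defs.v *)
(* R[i] is the field of complex numbers over R : realType. *)
From HB Require Import structures.
From mathcomp Require Import all_boot all_order all_algebra finmap.
From mathcomp Require Import all_classical all_reals all_analysis.
From mathcomp Require Import complex.

Set Implicit Arguments.
Unset Strict Implicit.
Unset Printing Implicit Defensive.

Import Order.TTheory GRing.Theory Num.Theory numFieldNormedType.Exports.

Local Open Scope classical_set_scope.
Local Open Scope ring_scope.
Local Open Scope complex_scope.

Section complex_analysis.
Context {R : realType}.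
Implicit Types (z s : R[i]) (K : set nat).

Definition cexp z : R[i] :=
  (expR (complex.Re z))%:C * (cos (complex.Im z) +i* sin (complex.Im z)).

(* n ^ s, meaningful for n > 0 only *)
Definition natpow (n : nat) s : R[i] := cexp (s * (ln n%:R)%:C).

(* The cast selects the norm topology on R[i]. *)
Definition zeta K s : R[i] :=
  limn (fun N => \sum_(0 <= n < N | n \in K) natpow n (- s)
                 : (R[i] : numFieldType)).

Definition cintegral (D : set R) (f : R -> R[i]) : R[i] :=
  (\int[lebesgue_measure]_(x in D) complex.Re (f x)) +i*
  (\int[lebesgue_measure]_(x in D) complex.Im (f x)).

End complex_analysis.

Section L2_spaces.
Context {R : realType}.
Implicit Types (E : set R) (f g h : R -> R[i]).
Local Notation mu := (@lebesgue_measure R).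

Definition L2norm f : \bar R :=
  Lnorm mu 2%:E (fun x => (ComplexField.Normc.normc (f x))%:E).

(* Representatives of the elements of L^2(E), extended by 0 to the whole line;
   two of them are identified when they agree almost everywhere. *)
Definition L2 E : set (R -> R[i]) := [set f |
  [/\ measurable_fun setT (fun x => complex.Re (f x)),
      measurable_fun setT (fun x => complex.Im (f x)),
      (L2norm f < +oo)%E
    & forall x, ~ E x -> f x = 0]].

Definition is_L2lim E (T : Type) (F : set_system T) (u : T -> R -> R[i]) h :=
  L2 E h /\ L2norm (fun x => u t x - h x) @[t --> F] --> 0%E.

(* A representative of the limit, which is unique up to a.e. equality; the
   value 0 is used only when there is no limit. *)
Definition L2lim E (T : Type) (F : set_system T) (u : T -> R -> R[i]) :
    R -> R[i] :=
  xget (fun=> 0) [set h | is_L2lim E F u h].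

(* Operators act on representatives. *)
Definition bounded_below E (A : (R -> R[i]) -> (R -> R[i])) :=
  exists2 c : R, 0 < c &
    forall g, L2 E g -> (c%:E * L2norm g <= L2norm (A g))%E.

Definition chi E f : R -> R[i] := fun x => (\1_E x)%:C * f x.

(* For g in L^2(R) the integral defining the Fourier transform is the limit in
   L^2(R) of its truncations to ]-N, N[. *)
Definition fourier g : R -> R[i] :=
  L2lim setT \oo (fun (N : nat) t =>
    (Num.sqrt (2 * pi))^-1%:C *
    cintegral `]- N%:R, N%:R[ (fun xi => g xi * cexp (0 -i* (xi * t)))).

(* The inverse of the (bijective) operator fourier on L^2(R). *)
Definition inv_fourier h : R -> R[i] :=
  xget (fun=> 0) [set g | L2 setT g /\ fourier g = h %[ae mu]].

End L2_spaces.

Section theorem_data.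
Context {R : realType}.
Implicit Types (K : set nat) (I : set R).

Definition Zop K I (g : R -> R[i]) : R -> R[i] :=
  L2lim I 0^'+ (fun (delta : R) t =>
    (\1_I t / pi)%:C *
    cintegral I (fun tau =>
      g tau * (complex.Re (zeta K ((1 + delta) +i* (t - tau))))%:C)).

Definition Lset K : set R :=
  \bigcup_(n in K) (`]- ln n.+1%:R, - ln n%:R] `|` `[ln n%:R, ln n.+1%:R[).

Definition counting_fun K (x : R) : R :=
  (#|` fset_set (K `&` [set n | n%:R <= x]) |)%:R.

End theorem_data.

(* Main.v *)
Require Import Defs.
From HB Require Import structures.
From mathcomp Require Import all_boot all_order all_algebra finmap.
From mathcomp Require Import all_classical all_reals all_analysis.
From mathcomp Require Import complex.
From mathcomp Require Import measurable_realfun.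
From mathcomp Require Import ring lra zify.

Set Implicit Arguments.
Unset Strict Implicit.
Unset Printing Implicit Defensive.

Import Order.TTheory GRing.Theory Num.Theory numFieldNormedType.Exports.

Local Open Scope classical_set_scope.
Local Open Scope ring_scope.

(** Both operators are reduced to quadratic forms on real functions a supported
    in I, expressed through energy a = (ct a)^2 + (st a)^2, the squared modulus
    of the Fourier transform of a. An operator A with square norm of A g at most
    B <A g, g> is bounded below exactly when its form is (bounded_below_form).
    For (b) the form is the integral of the energy over L, and symmetry of L
    leaves its positive half, the union of the blocks [ln n, ln (n+1)) with n in
    K (Fourier_form). For (a) the kernel Re zeta_K (1 + i (t - tau)) expands into
    cos ((t - tau) ln n) / n, so the form is the sum over n in K of
    energy a (ln n) / n (Zeta_form); convergence as delta -> 0+ and the operator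
    bound both come from the Bessel inequality Zform_bound, which compares the
    value at ln n with integrals of the energies of a and x a over the n-th
    block.

    Sufficiency of (c) is a sampling inequality (sampling_theorem). The half-line
    is cut into intervals of a fixed length m. In each of them (c) supplies a
    number of integers of K exponential in m, from which one selects d nodes with
    logarithms separated by a constant multiple of 1/d, d proportional to m,
    keeping the smallest values of the energy (select_nodes). The transform of a
    function supported in (-T, T) has derivatives of order d of size T^d, so
    Lagrange interpolation at the nodes (interpolation_bound) has an error with
    factor (T m)^d / d!, which is exponentially small in m. Summing over the
    intervals, Plancherel's identity on the half-line (plancherel) absorbs the
    error, and the square norm of a is bounded by the sampled energy. Sampling at
    the points ln n gives (a), and sampling at the minima of the energy over the
    blocks gives (b).

    For necessity both forms are dominated by Wform, the integral over the blocks
    of the energies of a and x a. On the functions cos (s x) and sin (s x) on I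
    this form sees only the part of the spectrum near s and -s (energy_modulate),
    up to a small tail; a lower bound therefore forces a fixed proportion of the
    integers around e^s to lie in K (form_below_dense), which is (c). *)

(** * Square-integrable real functions *)

Section real_integrability.
Context {R : realType}.
Local Notation mu := (@lebesgue_measure R).
Implicit Types (f g : R -> R).

Lemma integrableZr_fun k f : mu.-integrable setT (EFin \o f) ->
  mu.-integrable setT (EFin \o (fun x => k * f x)).
Proof.
move=> /(integrableZl measurableT k).
by apply: eq_integrable => [|x _]; [exact: measurableT|rewrite /= EFinM].
Qed.

Lemma integrableD_fun f g : mu.-integrable setT (EFin \o f) ->
  mu.-integrable setT (EFin \o g) ->
  mu.-integrable setT (EFin \o (fun x => f x + g x)).
Proof.
move=> fi gi; have := integrableD measurableT fi gi.
by apply: eq_integrable => [|x _]; [exact: measurableT|rewrite /= EFinD].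
Qed.

Lemma eq_integrable_fun f g : f =1 g -> mu.-integrable setT (EFin \o f) ->
  mu.-integrable setT (EFin \o g).
Proof. by move=> /funext ->. Qed.

End real_integrability.

Section square_integrable.
Context {R : realType}.
Local Notation mu := (@lebesgue_measure R).
Implicit Types (a b f g h : R -> R).

Definition sqint a : Prop :=
  measurable_fun setT a /\ mu.-integrable setT (fun x => (a x ^+ 2)%:E).

Definition dot a b : R := \int[mu]_x (a x * b x).

Definition sqn a : R := dot a a.

Lemma sqint_meas a : sqint a -> measurable_fun setT a.
Proof. by case. Qed.

Lemma le_sqint a f : measurable_fun setT a ->
  mu.-integrable setT (fun x => (f x)%:E) -> (forall x, a x ^+ 2 <= f x) ->
  sqint a.
Proof.
move=> ma fi af; split => //.
apply: (le_integrable measurableT _ _ fi) => /=.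
  exact/measurable_EFinP/measurable_funX.
move=> x _; rewrite lee_fin ger0_norm ?sqr_ge0// (le_trans (af x))//.
exact: ler_norm.
Qed.

Lemma sqint_mul a b : sqint a -> sqint b ->
  mu.-integrable setT (fun x => (a x * b x)%:E).
Proof.
move=> [ma ia] [mb ib].
have iab := integrableD measurableT ia ib.
apply: (le_integrable measurableT _ _ iab).
  exact/measurable_EFinP/measurable_funM.
move=> x _ /=; rewrite lee_fin [leRHS]ger0_norm ?addr_ge0 ?sqr_ge0//.
by rewrite ler_norml; apply/andP; split; nra.
Qed.

Lemma sqint0 : sqint (fun=> 0).
Proof.
split => //; rewrite expr0n/=; exact: integrable0.
Qed.

Lemma sqintD a b : sqint a -> sqint b -> sqint (a \+ b).
Proof.
move=> ha hb; have [[ma ia] [mb ib]] := (ha, hb).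
pose F := (fun x => (2 * a x ^+ 2 + 2 * b x ^+ 2)).
apply: (@le_sqint _ F).
- exact: measurable_funD.
- under eq_fun do rewrite EFinD !EFinM.
  by apply: integrableD => //; exact: integrableZl.
- by move=> x /=; rewrite /F; have := sqr_ge0 (a x - b x); nra.
Qed.

Lemma sqintZ k a : sqint a -> sqint (k \*o a).
Proof.
move=> [ma ia]; split; first exact: measurable_funM.
under eq_fun do rewrite /= exprMn EFinM.
exact: integrableZl.
Qed.

Lemma sqintN a : sqint a -> sqint (\- a).
Proof.
move=> /(sqintZ (-1)) h; rewrite (_ : \- a = -1 \*o a)//.
by apply/funext => x /=; rewrite mulN1r.
Qed.

Lemma sqintB a b : sqint a -> sqint b -> sqint (a \- b).
Proof. by move=> ha hb; exact: (sqintD ha (sqintN hb)). Qed.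

Lemma sqint_sum (I : Type) (s : seq I) (P : pred I) (F : I -> R -> R) :
  (forall i, sqint (F i)) -> sqint (fun x => \sum_(i <- s | P i) F i x).
Proof.
move=> hF; elim: s => [|i s ih].
  by under eq_fun do rewrite big_nil; exact: sqint0.
case Pi : (P i); under eq_fun do rewrite big_cons Pi; last exact: ih.
exact: (sqintD (hF i) ih).
Qed.

Lemma sqint_indicM (E : set R) a : measurable E -> sqint a ->
  sqint (fun x => \1_E x * a x).
Proof.
move=> mE [ma ia]; apply: (le_sqint _ ia).
  by apply: measurable_funM => //; exact: measurable_indic.
move=> x; rewrite exprMn ler_piMl ?sqr_ge0//.
Qed.

Lemma dotC a b : dot a b = dot b a.
Proof. by apply: eq_Rintegral => x _; rewrite mulrC. Qed.

Lemma dotDl a b c : sqint a -> sqint b -> sqint c ->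
  dot (a \+ b) c = dot a c + dot b c.
Proof.
move=> ha hb hc; rewrite /dot -RintegralD//; try exact: sqint_mul.
by apply: eq_Rintegral => x _ /=; rewrite mulrDl.
Qed.

Lemma dotZl k a b : sqint a -> sqint b -> dot (k \*o a) b = k * dot a b.
Proof.
move=> ha hb; rewrite /dot -RintegralZl//; try exact: sqint_mul.
by apply: eq_Rintegral => x _ /=; rewrite mulrA.
Qed.

Lemma dotNl a b : sqint a -> sqint b -> dot (\- a) b = - dot a b.
Proof.
move=> ha hb; rewrite -mulN1r -dotZl//; apply: eq_Rintegral => x _ /=.
by rewrite mulN1r.
Qed.

Lemma dotBl a b c : sqint a -> sqint b -> sqint c ->
  dot (a \- b) c = dot a c - dot b c.
Proof.
move=> ha hb hc; rewrite -dotNl// -dotDl//; exact: sqintN.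
Qed.

Lemma dot0l b : dot (fun=> 0) b = 0.
Proof.
rewrite /dot (@eq_Rintegral _ _ _ mu setT (fun=> 0))=> [|x _]; last by rewrite mul0r.
by rewrite Rintegral_cst// mul0r.
Qed.

Lemma dot_suml (I : Type) (s : seq I) (P : pred I) (F : I -> R -> R) b :
  (forall i, sqint (F i)) -> sqint b ->
  dot (fun x => \sum_(i <- s | P i) F i x) b = \sum_(i <- s | P i) dot (F i) b.
Proof.
move=> hF hb; elim: s => [|i s ih].
  rewrite big_nil -[RHS](dot0l b); congr dot.
  by apply/funext => x; rewrite big_nil.
rewrite big_cons -ih; case: ifP => Pi; last first.
  by congr dot; apply/funext => x; rewrite big_cons Pi.
rewrite -dotDl//; last exact: sqint_sum.
by congr dot; apply/funext => x; rewrite big_cons Pi.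
Qed.

Lemma sqn_ge0 a : 0 <= sqn a.
Proof. by apply: Rintegral_ge0 => x _; rewrite -expr2 sqr_ge0. Qed.

Lemma sqnD a b : sqint a -> sqint b ->
  sqn (a \+ b) = sqn a + 2 * dot a b + sqn b.
Proof.
move=> ha hb; have hab := sqintD ha hb.
rewrite /sqn dotDl// (dotC a) (dotC b) !dotDl// (dotC b a); ring.
Qed.

Lemma sqnB a b : sqint a -> sqint b ->
  sqn (a \- b) = sqn a - 2 * dot a b + sqn b.
Proof.
move=> ha hb; have hab := sqintB ha hb.
rewrite /sqn dotBl// (dotC a) (dotC b) !dotBl// (dotC b a); ring.
Qed.

Lemma sqnZ k a : sqint a -> sqn (k \*o a) = k ^+ 2 * sqn a.
Proof.
move=> ha; have hka := sqintZ k ha.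
by rewrite /sqn dotZl// dotC dotZl// mulrA.
Qed.

Lemma sqnE a : sqint a -> (sqn a)%:E = (\int[mu]_x (a x ^+ 2)%:E)%E.
Proof.
move=> [ma ia]; rewrite /sqn /dot /Rintegral fineK.
  by apply: eq_integral => x _; rewrite expr2.
apply: integrable_fin_num => //.
Qed.

Lemma sqint_sqn a : measurable_fun setT a ->
  (\int[mu]_x (a x ^+ 2)%:E < +oo)%E -> sqint a.
Proof.
move=> ma fi; split => //; apply/integrableP; split.
  exact/measurable_EFinP/measurable_funX.
by under eq_integral do rewrite gee0_abs ?lee_fin ?sqr_ge0//.
Qed.

Lemma dot_le a b : sqint a -> sqint b -> 2 * dot a b <= sqn a + sqn b.
Proof. by move=> ha hb; have := sqn_ge0 (a \- b); rewrite sqnB//; lra. Qed.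

Lemma dot_sqr_le a b : sqint a -> sqint b -> dot a b ^+ 2 <= sqn a * sqn b.
Proof.
move=> ha hb.
have H t : 0 <= sqn a + 2 * t * dot a b + t ^+ 2 * sqn b.
  have := sqn_ge0 (a \+ t \*o b); rewrite sqnD//; last exact: sqintZ.
  by rewrite sqnZ// dotC dotZl// (dotC b) mulrA.
have [b0|b0] := ltP 0 (sqn b).
  have := H (- dot a b / sqn b).
  rewrite (_ : _ + _ = (sqn a * sqn b - dot a b ^+ 2) / sqn b); last first.
    by field; rewrite gt_eqF.
  by rewrite pmulr_lge0 ?invr_gt0// subr_ge0.
have b00 : sqn b = 0 by apply/le_anti; rewrite b0 sqn_ge0.
have [->|d0] := eqVneq (dot a b) 0; first by rewrite b00 mulr0 expr0n.
have := H (- (sqn a + 1) / (2 * dot a b)); rewrite b00 mulr0 addr0.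
rewrite (_ : _ + _ = - 1); last by field.
by rewrite ler0N1.
Qed.

End square_integrable.

(** * Completeness *)

Section completeness.
Context {R : realType}.
Local Notation mu := (@lebesgue_measure R).
Implicit Types (f g : R -> R).

Lemma limn_einf_le_cst (u : nat -> \bar R) c : (forall n, (u n <= c)%E) ->
  (limn_einf u <= c)%E.
Proof.
move=> uc; rewrite limn_einf_lim; apply: lime_le; first exact: is_cvg_einfs.
near=> n; apply: le_trans (uc n); apply: ereal_inf_lbound.
by exists n => /=.
Unshelve. all: by end_near. Qed.

Lemma fatou_cst (D : set R) (h : nat -> R -> R) g (c : R) :
  measurable D -> (forall k, measurable_fun D (h k)) ->
  (forall k x, D x -> 0 <= h k x) ->
  (forall k, (\int[mu]_(x in D) (h k x)%:E <= c%:E)%E) ->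
  (forall x, D x -> h k x @[k --> \oo] --> g x) ->
  (\int[mu]_(x in D) (g x)%:E <= c%:E)%E.
Proof.
move=> mD mh h0 hc hg.
have E : (\int[mu]_(x in D) (g x)%:E =
          \int[mu]_(x in D) limn_einf (fun k => (h k x)%:E))%E.
  apply: eq_integral => x /[!inE] Dx; apply/esym.
  have /cvg_limn_einf_sup[->//] : (h k x)%:E @[k --> \oo] --> (g x)%:E.
  by apply: cvg_EFin; [exact: nearW|exact: hg].
rewrite E; apply: le_trans (fatou mu mD _ _) _.
- by move=> n; apply/measurable_EFinP; exact: mh.
- by move=> n x Dx; rewrite lee_fin h0.
exact: limn_einf_le_cst.
Qed.

Lemma fatou_sqr (D : set R) (h : nat -> R -> R) g (c : R) :
  measurable D -> (forall k, measurable_fun D (h k)) ->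
  (forall k, (\int[mu]_(x in D) (h k x ^+ 2)%:E <= c%:E)%E) ->
  (forall x, D x -> h k x @[k --> \oo] --> g x) ->
  (\int[mu]_(x in D) (g x ^+ 2)%:E <= c%:E)%E.
Proof.
move=> mD mh hc hg.
apply: (@fatou_cst D (fun k x => h k x ^+ 2)) => //.
- by move=> k; apply: measurable_funX.
- by move=> k x _; exact: sqr_ge0.
- by move=> x Dx; apply: cvgM; exact: hg.
Qed.

Lemma Rdominated_cvg (f_ : nat -> R -> R) (f g : R -> R) :
  (forall n, measurable_fun setT (f_ n)) ->
  (forall x, f_ n x @[n --> \oo] --> f x) ->
  mu.-integrable setT (EFin \o g) -> (forall n x, `|f_ n x| <= g x) ->
  \int[mu]_x f_ n x @[n --> \oo] --> \int[mu]_x f x.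
Proof.
move=> mf_ cf ig fg.
have mf : measurable_fun setT f.
  by apply: (measurable_fun_cvg mf_) => x _; exact: cf.
have [||||iF _] := @dominated_convergence _ (measurableTypeR R) R mu setT
  measurableT (fun n x => (f_ n x)%:E) (EFin \o f) (EFin \o g) _ _ _ ig.
- by move=> n; apply/measurable_EFinP; exact: mf_.
- by apply/measurable_EFinP.
- by apply: aeW => x _; apply: cvg_EFin; [exact: nearW|exact: cf].
- by apply: aeW => x n _; rewrite lee_fin fg.
by rewrite -(fineK (integrable_fin_num measurableT iF)) => /fine_cvg; exact.
Qed.

(** Along a subsequence with sqn (f_(n_k+1) - f_(n_k)) <= 4^-k the function
    sum_k 2^k (f_(n_k+1) - f_(n_k))^2 is integrable, hence finite almost
    everywhere; as t <= 2^-k + 2^k t^2, the subsequence converges there. *)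
Lemma sqn_complete (f : nat -> R -> R) : (forall n, sqint (f n)) ->
  (forall e, 0 < e -> exists N, forall n m, (N <= n)%N -> (N <= m)%N ->
    sqn (f n \- f m) <= e) ->
  exists g, [/\ sqint g, (forall x, (forall n, f n x = 0) -> g x = 0) &
    forall e, 0 < e -> exists N, forall n, (N <= n)%N -> sqn (f n \- g) <= e].
Proof.
move=> hf fC.
have /choice[phi phiP] : forall k : nat, exists N, forall n m, (N <= n)%N ->
    (N <= m)%N -> sqn (f n \- f m) <= (4^-1) ^+ k.
  by move=> k; apply: fC; rewrite exprn_gt0.
pose nk k := (k + \sum_(j < k.+1) phi j)%N.
have nk_phi k l : (k <= l)%N -> (phi k <= nk l)%N.
  move=> kl; rewrite /nk (bigD1 (Ordinal (kl : (k < l.+1)%N)))//=.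
  by rewrite addnCA leq_addr.
have nk_id k : (k <= nk k)%N by rewrite leq_addr.
pose d k := f (nk k.+1) \- f (nk k).
have hd k : sqint (d k) by exact: sqintB.
have dk k : sqn (d k) <= (4^-1) ^+ k.
  by apply: phiP; apply: nk_phi.
pose s k x := 2 ^+ k * d k x ^+ 2.
have s0 k x : 0 <= s k x by rewrite mulr_ge0// ?sqr_ge0// exprn_ge0.
have ms k : measurable_fun setT (s k).
  by apply: measurable_funM => //; apply: measurable_funX; exact: sqint_meas.
pose S x := (\sum_(0 <= k <oo) (s k x)%:E)%E.
have S0 x : (0 <= S x)%E by apply: nneseries_ge0 => k _ _; rewrite lee_fin.
have mS : measurable_fun setT S.
  apply: ge0_emeasurable_sum => // k.
    by move=> x _ _; rewrite lee_fin.
  by move=> _; exact/measurable_EFinP.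
have iS : mu.-integrable setT S.
  apply/integrableP; split => //.
  under eq_integral do rewrite gee0_abs//.
  rewrite /S integral_nneseries//; last 2 first.
    by move=> k; apply/measurable_EFinP; exact: ms.
    by move=> k x _; rewrite lee_fin.
  apply: (@le_lt_trans _ _ (\sum_(0 <= k <oo) (geometric 1 (2^-1) k)%:E)%E).
    apply: lee_nneseries => [k _ _|k _].
      by apply: integral_ge0 => x _; rewrite lee_fin.
    rewrite /s /=; under eq_integral do rewrite EFinM.
    rewrite ge0_integralZl//; last 2 first.
    - by apply/measurable_EFinP/measurable_funX; exact: sqint_meas.
    - by move=> x _; rewrite lee_fin sqr_ge0.
    rewrite -sqnE// -EFinM lee_fin mul1r.
    apply: (le_trans (ler_wpM2l _ (dk k))); first by rewrite exprn_ge0.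
    by rewrite -exprMn (_ : 2 * 4^-1 = 2^-1)//; field.
  have gc : cvgn (series (geometric (1:R) 2^-1)).
    by apply: is_cvg_geometric_series; rewrite gtr0_norm// invf_lt1// ltr1n.
  have /cvg_ex[l gl] := gc.
  have -> : (\sum_(0 <= k <oo) (geometric 1 (2^-1) k)%:E)%E = l%:E :> \bar R.
    apply/cvg_lim => //.
    under eq_fun do rewrite sumEFin.
    by apply: cvg_EFin; [exact: nearW|exact: gl].
  exact: ltry.
have [Z [mZ Z0 ZS]] := integrable_ae measurableT iS.
have Zcvg x : ~ Z x -> cvgn (fun k => f (nk k) x).
  move=> nZx.
  have Sx : S x \is a fin_num.
    by move: nZx; apply: contra_notP => h; apply: ZS => /= /(_ I).
  suff cs : cvgn (series (d ^~ x)).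
    have -> : (fun k => f (nk k) x) = (fun k => f (nk 0%N) x + series (d ^~ x) k).
      apply/funext => k; rewrite seriesEnat/=.
      by rewrite (telescope_sumr (fun k => f (nk k) x))//; ring.
    by apply: is_cvgD => //; exact: is_cvg_cst.
  apply: normed_cvg.
  apply: (@series_le_cvg _ _ (fun k => (geometric 1 2^-1) k + s k x)).
  - by move=> k; exact: normr_ge0.
  - by move=> k; rewrite addr_ge0//= mul1r exprn_ge0// invr_ge0.
  - move=> k; rewrite /s /= mul1r.
    rewrite -[d k x ^+ 2]real_normK ?num_real// exprVn.
    have p0 : 0 < 2 ^+ k :> R by rewrite exprn_gt0.
    have t0 := normr_ge0 (d k x).
    rewrite -(ler_pM2l p0) mulrDr mulfV ?gt_eqF//.
    have := sqr_ge0 (2 ^+ k * `|d k x| - 1).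
    have := mulr_ge0 (ltW p0) t0; nra.
  - have -> : series (fun k => geometric 1 2^-1 k + s k x) =
        series (geometric 1 2^-1) \+ series (s ^~ x).
      by apply/funext => k /=; rewrite !seriesEnat/= big_split.
    apply: is_cvgD.
      by apply: is_cvg_geometric_series; rewrite gtr0_norm// invf_lt1// ltr1n.
    apply: (@nondecreasing_is_cvgn R).
      by apply/nondecreasing_seqP => k; rewrite !seriesEnat/= big_nat_recr//= lerDl.
    exists (fine (S x)) => _ [k _ <-]; rewrite seriesEnat/= -lee_fin fineK//.
    rewrite -sumEFin; apply: nneseries_lim_ge => j _.
    by rewrite lee_fin.
pose h k x := f (nk k) x * \1_(~` Z) x.
pose g x := limn (h ^~ x).
have mCZ : measurable (~` Z) by exact: measurableC.
have hg x : h k x @[k --> \oo] --> g x.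
  have [Zx|nZx] := pselect (Z x).
    have h0 k : h k x = 0 by rewrite /h indicE memNset ?mulr0//; exact/contrapT.
    rewrite /g (_ : h^~ x = fun=> 0); last by apply/funext.
    by rewrite lim_cst//; exact: cvg_cst.
  suff : cvgn (h^~ x) by [].
  rewrite (_ : h^~ x = fun k => f (nk k) x); first exact: Zcvg.
  by apply/funext => k; rewrite /h indicE mem_set// mulr1.
have mh k : measurable_fun setT (h k).
  by apply: measurable_funM; [exact: sqint_meas|exact: measurable_indic].
have mg : measurable_fun setT g.
  by apply: (measurable_fun_cvg mh) => x _; exact: hg.
have main e : 0 < e -> exists N, forall n, (N <= n)%N ->
    (\int[mu]_x ((f n \- g) x ^+ 2)%:E <= e%:E)%E.
  move=> e0; have [N NP] := fC _ e0; exists N => n Nn.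
  have mfn := sqint_meas (hf n).
  rewrite (ge0_negligible_integral mZ)//; last 2 first.
    by apply/measurable_EFinP/measurable_funX/measurable_funB.
    by move=> x _; rewrite lee_fin sqr_ge0.
  apply: (@fatou_sqr _ (fun k => f n \- h (k + N)%N)).
  - exact: measurableD.
  - by move=> k; apply: measurable_funTS; exact: measurable_funB.
  - move=> k.
    have -> : (\int[mu]_(x in setT `\` Z) ((f n \- h (k + N)%N) x ^+ 2)%:E =
        \int[mu]_(x in setT `\` Z) ((f n \- f (nk (k + N)%N)) x ^+ 2)%:E)%E.
      apply: eq_integral => x /[!inE] -[_ nZx]; congr (_ ^+ 2)%:E => /=.
      by rewrite /h indicE mem_set// mulr1.
    apply: (@le_trans _ _ (sqn (f n \- f (nk (k + N)%N)))%:E).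
      rewrite sqnE; last exact: sqintB.
      apply: ge0_subset_integral => //; first exact: measurableD.
        apply/measurable_EFinP/measurable_funX; apply: sqint_meas.
        exact: sqintB.
      by move=> x _; rewrite lee_fin sqr_ge0.
    rewrite lee_fin; apply: NP => //.
    by rewrite (leq_trans _ (nk_id _))// leq_addl.
  - move=> x _; apply: cvgB; first exact: cvg_cst.
    by rewrite (cvg_shiftn N (h ^~ x)); exact: hg.
have hg2 : sqint g.
  have [N NP] := main 1 ltr01.
  have hB : sqint (f N \- g).
    apply: sqint_sqn; first by apply: measurable_funB => //; exact: sqint_meas.
    exact: le_lt_trans (NP N (leqnn _)) (ltry _).
  rewrite (_ : g = f N \- (f N \- g)); first exact: sqintB.
  by apply/funext => x /=; rewrite opprB addrCA subrr addr0.
exists g; split => //.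
  move=> x fx0; rewrite /g (_ : h^~ x = fun=> 0) ?lim_cst//.
  by apply/funext => k; rewrite /h fx0 mul0r.
move=> e e0; have [N NP] := main _ e0; exists N => n Nn.
rewrite -lee_fin sqnE; first exact: NP.
exact: sqintB.
Qed.

End completeness.

(** * Cosine and sine transforms of functions on a bounded interval *)

Section transforms.
Context {R : realType}.
Local Notation mu := (@lebesgue_measure R).
Implicit Types (a b f g phi psi : R -> R) (T l : R).

Definition supp T a : Prop := forall x, ~ (`]- T, T[%classic x) -> a x = 0.

Lemma suppD T a b : supp T a -> supp T b -> supp T (a \+ b).
Proof. by move=> ha hb x xT /=; rewrite ha// hb// addr0. Qed.

Lemma suppZ T k a : supp T a -> supp T (k \*o a).
Proof. by move=> ha x xT /=; rewrite ha// mulr0. Qed.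

Lemma suppB T a b : supp T a -> supp T b -> supp T (a \- b).
Proof. by move=> ha hb x xT /=; rewrite ha// hb// subr0. Qed.

Lemma supp_mull T a b : supp T b -> supp T (fun x => a x * b x).
Proof. by move=> hb x xT /=; rewrite hb// mulr0. Qed.

Lemma supp_indic T a : supp T a -> forall x, \1_(`]- T, T[%classic) x * a x = a x.
Proof.
move=> ha x; rewrite indicE; have [xT|xT] := boolP (x \in _).
  by rewrite mul1r.
by rewrite ha ?mulr0//; move: xT; rewrite notin_setE.
Qed.

Lemma supp_integrable T a : sqint a -> supp T a ->
  mu.-integrable setT (EFin \o a).
Proof.
move=> [ma ia] sa.
have i1 := @integrable_indic_itv R (- T) T false true.
have i2 := integrableD measurableT i1 ia.
apply: (le_integrable measurableT _ _ i2).
  exact/measurable_EFinP.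
move=> x _ /=; rewrite -(supp_indic sa x) lee_fin [leRHS]ger0_norm; last first.
  by rewrite addr_ge0 ?sqr_ge0.
rewrite !indicE; case: (_ \in _) => /=.
  rewrite !mul1r ler_norml; apply/andP; split.
    by have := sqr_ge0 (a x + 1); have := sqr_ge0 (a x); nra.
  by have := sqr_ge0 (a x - 1); have := sqr_ge0 (a x); nra.
by rewrite !mul0r normr0 add0r expr0n.
Qed.

Lemma bounded_sqint T a (M : R) : measurable_fun setT a -> supp T a ->
  (forall x, `|a x| <= M) -> sqint a.
Proof.
move=> ma sa aM.
have M0 : 0 <= M by rewrite (le_trans _ (aM 0)).
apply: (@le_sqint _ _ (fun x => M ^+ 2 * \1_(`]- T, T[%classic) x)) => //.
  under eq_fun do rewrite EFinM.
  apply: integrableZl => //; exact: integrable_indic_itv.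
move=> x; rewrite -(supp_indic sa x) !indicE; case: (_ \in _) => /=.
  by rewrite mul1r mulr1 -(real_normK (num_real (a x))) ler_sqr ?nnegrE.
by rewrite mul0r mulr0 expr0n.
Qed.

Lemma sqint_mulid T a : sqint a -> supp T a -> sqint (fun x => x * a x).
Proof.
move=> [ma ia] sa.
have iT := integrableZl measurableT (T ^+ 2) ia.
apply: (@le_sqint _ _ (fun x => T ^+ 2 * a x ^+ 2)).
- exact: measurable_funM.
- by under eq_fun do rewrite EFinM.
move=> x; rewrite exprMn; have [xT|xT] := pselect (`]- T, T[%classic x).
  rewrite ler_wpM2r ?sqr_ge0//; move: xT; rewrite /= in_itv/= => /andP[? ?].
  by nra.
by rewrite sa// expr0n/= !mulr0.
Qed.

Lemma sqn_mulid_le T a : sqint a -> supp T a ->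
  sqn (fun x => x * a x) <= T ^+ 2 * sqn a.
Proof.
move=> ha sa; have hxa := sqint_mulid ha sa.
rewrite /sqn -dotZl// /dot.
apply: le_Rintegral => //; [exact: sqint_mul|apply: sqint_mul => //; exact: sqintZ|].
move=> x _ /=; have [xT|xT] := pselect (`]- T, T[%classic x); last first.
  by rewrite sa// !mulr0.
move: xT; rewrite /= in_itv/= => /andP[? ?].
have -> : x * a x * (x * a x) = x ^+ 2 * (a x ^+ 2) by ring.
have -> : T ^+ 2 * a x * a x = T ^+ 2 * (a x ^+ 2) by ring.
rewrite ler_wpM2r ?sqr_ge0//; nra.
Qed.

Definition c0 : R := (Num.sqrt (2 * pi))^-1.

Lemma c0_gt0 : 0 < c0.
Proof. by rewrite invr_gt0 sqrtr_gt0 mulr_gt0// pi_gt0. Qed.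

Lemma c0_sqr : c0 ^+ 2 = (2 * pi)^-1.
Proof.
by rewrite /c0 exprVn sqr_sqrtr// mulr_ge0// ltW// pi_gt0.
Qed.

Definition trigt phi a l : R := c0 * \int[mu]_x (a x * phi (x * l)).

Definition ct a := trigt cos a.
Definition st a := trigt sin a.

Definition trig_like phi := continuous phi /\ (forall x, `|phi x| <= 1).

Lemma trig_cos : trig_like cos.
Proof. by split; [exact: continuous_cos|exact: cos_max]. Qed.

Lemma trig_sin : trig_like sin.
Proof. by split; [exact: continuous_sin|exact: sin_max]. Qed.

Lemma trig_Nsin : trig_like (fun x => - sin x).
Proof.
by split; [move=> x; apply: cvgN; exact: continuous_sin|move=> x; rewrite normrN sin_max].
Qed.

Lemma trig_meas phi l : trig_like phi ->
  measurable_fun setT (fun x : R => phi (x * l)).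
Proof.
move=> [cphi _]; apply: continuous_measurable_fun => x.
apply: (@cvg_comp _ _ _ (fun x : R => x * l) phi); last exact: cphi.
by apply: cvgM; [exact: cvg_id|exact: cvg_cst].
Qed.

Lemma trig_integrable phi a l : trig_like phi ->
  mu.-integrable setT (EFin \o a) ->
  mu.-integrable setT (EFin \o (fun x => a x * phi (x * l))).
Proof.
move=> tphi ia; have ma := measurable_int mu ia.
apply: (le_integrable measurableT _ _ ia).
  apply/measurable_EFinP; apply: measurable_funM; last exact: trig_meas.
  exact/measurable_EFinP.
by move=> x _ /=; rewrite lee_fin normrM ler_piMr//; exact: tphi.2.
Qed.

Lemma trigtD phi a b l : trig_like phi ->
  mu.-integrable setT (EFin \o a) -> mu.-integrable setT (EFin \o b) ->
  trigt phi (a \+ b) l = trigt phi a l + trigt phi b l.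
Proof.
move=> tphi ia ib; rewrite /trigt -mulrDr -RintegralD//; try exact: trig_integrable.
by congr (_ * _); apply: eq_Rintegral => x _ /=; rewrite mulrDl.
Qed.

Lemma trigtB phi a b l : trig_like phi ->
  mu.-integrable setT (EFin \o a) -> mu.-integrable setT (EFin \o b) ->
  trigt phi (a \- b) l = trigt phi a l - trigt phi b l.
Proof.
move=> tphi ia ib; rewrite /trigt -mulrBr -RintegralB//; try exact: trig_integrable.
by congr (_ * _); apply: eq_Rintegral => x _ /=; rewrite mulrBl.
Qed.

Lemma trigt_bound phi a l : trig_like phi -> mu.-integrable setT (EFin \o a) ->
  `|trigt phi a l| <= c0 * \int[mu]_x `|a x|.
Proof.
move=> tphi ia; rewrite /trigt normrM (gtr0_norm c0_gt0) ler_pM2l ?c0_gt0//.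
have ip := trig_integrable l tphi ia.
apply: le_trans (le_normr_Rintegral measurableT ip) _.
apply: le_Rintegral => //.
- by have := integrable_abse ip.
- by have := integrable_abse ia.
by move=> x _; rewrite normrM ler_piMr//; exact: tphi.2.
Qed.

(** Differentiation under the integral sign, dominated by |x a(x)|. *)
Lemma trigt_is_derive phi psi a l : trig_like phi -> trig_like psi ->
  (forall x : R, is_derive x (1:R) phi (psi x)) ->
  mu.-integrable setT (EFin \o a) ->
  mu.-integrable setT (EFin \o (fun x => x * a x)) ->
  is_derive l (1:R) (trigt phi a) (trigt psi (fun x => x * a x) l).
Proof.
move=> tphi tpsi dphi ia ixa.
pose f l x := a x * phi (x * l).
have df x l' : is_derive l' (1:R) (f ^~ x) (x * a x * psi (x * l')).
  have d1 : is_derive l' (1:R) (fun l => x * l) x.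
    by apply: is_derive_eq; rewrite scaler1 ?mulr1.
  have d2 := is_derive1_comp (dphi (x * l')) d1.
  have -> : x * a x * psi (x * l') = a x *: (psi (x * l') * x).
    by rewrite /GRing.scale/=; ring.
  exact: is_deriveZ.
have pE l' x : partial1of2 f l' x = x * a x * psi (x * l').
  by rewrite partial1of2E; have [_ ->] := df x l'.
have Il : `]l - 1, l + 1[%classic l by rewrite /= in_itv/=; apply/andP; split; lra.
have intf x : `]l - 1, l + 1[%classic x -> mu.-integrable setT (EFin \o f x).
  by move=> _; exact: trig_integrable.
have derf x y : `]l - 1, l + 1[%classic x -> setT y -> derivable (f ^~ y) x 1.
  by move=> _ _; have [] := df y x.
have iG := integrable_abse ixa.
have Gub x y : `]l - 1, l + 1[%classic x -> setT y ->
    `|partial1of2 f x y| <= `|y * a y|.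
  by move=> _ _; rewrite pE normrM ler_piMr//; exact: tpsi.2.
have H1 := @derivable_under_integral R _ _ mu f setT measurableT l _ _ Il intf
   derf (fun x => `|x * a x|) (fun x => normr_ge0 _) iG Gub.
have H2 := @differentiation_under_integral R _ _ mu f setT measurableT l _ _ Il intf
   derf (fun x => `|x * a x|) (fun x => normr_ge0 _) iG Gub.
have D : is_derive l (1:R) (fun l => \int[mu]_x f l x)
    (\int[mu]_x (x * a x * psi (x * l))).
  split => //; rewrite -derive1E H2.
  by apply: eq_Rintegral => x _; exact: pE.
have := is_deriveZ c0 D; exact.
Qed.

Lemma ct_is_derive T a l : sqint a -> supp T a ->
  is_derive l (1:R) (ct a) (- st (fun x => x * a x) l).
Proof.
move=> ha sa; have hxa := sqint_mulid ha sa.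
have sxa : supp T (fun x => x * a x) by exact: supp_mull.
have := @trigt_is_derive cos (fun x => - sin x) a l trig_cos trig_Nsin
  (@is_derive_cos R) (supp_integrable ha sa) (supp_integrable hxa sxa).
congr is_derive.
rewrite /st /trigt -mulrN; congr (_ * _).
rewrite -mulN1r -RintegralZl//; last first.
  by apply: trig_integrable; [exact: trig_sin|exact: supp_integrable hxa sxa].
by apply: eq_Rintegral => x _; rewrite mulrN mulN1r.
Qed.

Lemma st_is_derive T a l : sqint a -> supp T a ->
  is_derive l (1:R) (st a) (ct (fun x => x * a x) l).
Proof.
move=> ha sa; have hxa := sqint_mulid ha sa.
have sxa : supp T (fun x => x * a x) by exact: supp_mull.
exact: (@trigt_is_derive sin cos a l trig_sin trig_cos
  (@is_derive_sin R) (supp_integrable ha sa) (supp_integrable hxa sxa)).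
Qed.

Lemma is_derive_continuous (f df : R -> R) : (forall x : R, is_derive x (1:R) f (df x)) ->
  continuous f.
Proof.
move=> d x; apply: differentiable_continuous; apply/derivable1_diffP.
by have [] := d x.
Qed.

Lemma ct_continuous T a : sqint a -> supp T a -> continuous (ct a).
Proof.
by move=> ha sa; apply: is_derive_continuous => x; exact: ct_is_derive ha sa.
Qed.

Lemma st_continuous T a : sqint a -> supp T a -> continuous (st a).
Proof.
by move=> ha sa; apply: is_derive_continuous => x; exact: st_is_derive ha sa.
Qed.

Lemma ctN a l : ct a (- l) = ct a l.
Proof.
rewrite /ct /trigt; congr (_ * _); apply: eq_Rintegral => x _.
by rewrite mulrN cosN.
Qed.

Lemma stN a l : mu.-integrable setT (EFin \o a) -> st a (- l) = - st a l.
Proof.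
move=> ia; rewrite /st /trigt -mulrN; congr (_ * _).
rewrite -mulN1r -RintegralZl//; last by apply: trig_integrable => //; exact: trig_sin.
by apply: eq_Rintegral => x _; rewrite mulrN sinN mulrN mulN1r.
Qed.

(** The squared modulus of the Fourier transform ct a - i st a of a real function. *)
Definition energy a l : R := ct a l ^+ 2 + st a l ^+ 2.

Lemma energy_ge0 a l : 0 <= energy a l.
Proof. by rewrite addr_ge0 ?sqr_ge0. Qed.

Lemma energy_continuous T a : sqint a -> supp T a -> continuous (energy a).
Proof.
move=> ha sa x; apply: cvgD; apply: cvgM.
- exact: (ct_continuous ha sa).
- exact: (ct_continuous ha sa).
- exact: (st_continuous ha sa).
- exact: (st_continuous ha sa).
Qed.

End transforms.

Section fubini_bounded.
Context {R : realType}.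
Local Notation mu := (@lebesgue_measure R).
Local Notation mR := (measurableTypeR R).
Implicit Types (p q : R -> R) (M : R).

Definition meas2 (k : R -> R -> R) : Prop :=
  measurable_fun (setT : set (mR * mR)%type) (fun z => k z.1 z.2).

Lemma meas2_section k x : meas2 k -> measurable_fun setT (k x).
Proof.
move=> mk; apply: (measurableT_comp mk (g := fun y : mR => ((x, y) : mR * mR))).
exact: measurable_fun_pair.
Qed.

Lemma integrable_bddM p (h : R -> R) M : mu.-integrable setT (EFin \o p) ->
  measurable_fun setT h -> (forall x, `|h x| <= M) ->
  mu.-integrable setT (EFin \o (fun x => p x * h x)).
Proof.
move=> ip mh hM; have M0 : 0 <= M by rewrite (le_trans _ (hM 0)).
have mp := measurable_int mu ip.
have iMp := integrableZl measurableT M ip.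
apply: (le_integrable measurableT _ _ iMp).
  by apply/measurable_EFinP; apply: measurable_funM => //; exact/measurable_EFinP.
move=> x _ /=; rewrite lee_fin !normrM mulrC (ger0_norm M0).
by rewrite ler_wpM2r.
Qed.

(** Since the kernel is bounded, integrability of p and q suffices for the
    exchange. *)
Lemma fubini_bdd p q (k : R -> R -> R) M :
  mu.-integrable setT (EFin \o p) -> mu.-integrable setT (EFin \o q) ->
  meas2 k -> (forall x y, `|k x y| <= M) ->
  \int[mu]_x (p x * \int[mu]_y (q y * k x y)) =
    \int[mu]_y (q y * \int[mu]_x (p x * k x y)) /\
  mu.-integrable setT (EFin \o (fun x => p x * \int[mu]_y (q y * k x y))).
Proof.
move=> ip iq mk kM.
have mk' : meas2 (fun y x => k x y).
  by apply: (measurableT_comp mk (g := fun z : mR * mR => (z.2, z.1)));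
     apply: measurable_fun_pair; [exact: measurable_snd|exact: measurable_fst].
have M0 : 0 <= M by rewrite (le_trans _ (kM 0 0)).
have mp : measurable_fun setT p by apply/measurable_EFinP; exact: measurable_int ip.
have mq : measurable_fun setT q by apply/measurable_EFinP; exact: measurable_int iq.
pose f (z : mR * mR) := (p z.1 * q z.2 * k z.1 z.2)%:E.
have mf : measurable_fun setT f.
  apply/measurable_EFinP; apply: measurable_funM => //.
  by apply: measurable_funM; [exact: measurableT_comp measurable_fst|
    exact: measurableT_comp measurable_snd].
have i1 x : mu.-integrable setT (EFin \o (fun y => q y * k x y)).
  apply: (integrable_bddM (M := M) iq); [exact: meas2_section|by []].
have i2 y : mu.-integrable setT (EFin \o (fun x => p x * k x y)).
  apply: (integrable_bddM (M := M) ip); [exact: (meas2_section y mk')|by []].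
have fi : (mu \x mu)%E.-integrable setT f.
  apply/(integrable12ltyP _ _ mf).
  have iQ := integrableZl measurableT (M * fine (\int[mu]_y `|(q y)%:E|)%E) (integrable_abse ip).
  apply: (le_lt_trans _ (integrable_lty measurableT iQ)).
  have mabsf : measurable_fun setT (abse \o f) by exact: measurableT_comp.
  apply: ge0_le_integral => //.
  - by move=> x _; exact: integral_ge0.
  - apply: (@measurable_fun_fubini_tonelli_F _ _ _ _ _ _ (abse \o f)) => // z; exact: abse_ge0.
  - by move: iQ => /measurable_int.
  move=> x _; rewrite /f /=.
  have fQ : (\int[mu]_y `|(q y)%:E|)%E \is a fin_num.
    by apply: integrable_fin_num => //; exact: integrable_abse.
  rewrite muleC EFinM fineK// muleA -EFinM -ge0_integralZl//; last 2 first.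
  - exact: (measurable_int mu (integrable_abse iq)).
  - by rewrite lee_fin mulr_ge0.
  apply: ge0_le_integral => //.
  - apply/measurable_EFinP; apply: measurableT_comp => //.
    apply: measurable_funM; last exact: meas2_section.
    exact: measurable_funM.
  - apply: emeasurable_funM => //.
    exact: (measurable_int mu (integrable_abse iq)).
  move=> y _; rewrite -EFinM lee_fin !normrM.
  rewrite -mulrA (mulrC `|q y|) mulrA ler_wpM2r// ler_wpM2l//.
have E1 x : (p x * fine (\int[mu]_y (q y * k x y)%:E))%:E =
    (\int[mu]_y f (x, y))%E.
  rewrite EFinM (fineK (integrable_fin_num measurableT (i1 x))).
  rewrite -(integralZl measurableT (i1 x)).
  by apply: eq_integral => y _; rewrite /f /= -EFinM mulrA.
have E2 y : (q y * fine (\int[mu]_x (p x * k x y)%:E))%:E =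
    (\int[mu]_x f (x, y))%E.
  rewrite EFinM (fineK (integrable_fin_num measurableT (i2 y))).
  rewrite -(integralZl measurableT (i2 y)).
  by apply: eq_integral => x _; rewrite /f /= -EFinM mulrA (mulrC (q y)).
split; last first.
  apply: (eq_integrable measurableT (fubini_F mu f)).
    by move=> x _; rewrite /fubini_F -E1.
  exact: integrable_fubini_F fi.
rewrite /Rintegral; apply: (congr1 fine).
transitivity (\int[mu]_x \int[mu]_y f (x, y))%E.
  by apply: eq_integral => x _; exact: E1.
rewrite (Fubini fi); apply: eq_integral => y _; exact/esym/E2.
Qed.

End fubini_bounded.

(** * The Poisson kernel *)

Section poisson.
Context {R : realType}.
Local Notation mu := (@lebesgue_measure R).
Implicit Types (e u s t x : R).

Lemma continuous_EFin_measurable (D : set R) (f : R -> R) : continuous f ->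
  measurable_fun D (EFin \o f).
Proof.
move=> cf; apply/measurable_EFinP; apply: measurable_funTS.
exact: continuous_measurable_fun.
Qed.

Definition halfline : set R := `[0, +oo[%classic.

Lemma measurable_halfline : measurable (halfline : set (measurableTypeR R)).
Proof. exact: measurable_itv. Qed.

Lemma expNM_is_derive e x :
  is_derive x (1:R) (fun x => expR (- (e * x))) (- e * expR (- (e * x))).
Proof.
have d1 : is_derive x (1:R) (fun x => - (e * x)) (- e).
  by apply: is_derive_eq; rewrite scaler1.
have := @is_derive1_comp _ expR (fun x => - (e * x)) x _ _ (is_derive_expR _) d1.
by rewrite mulrC.
Qed.

Lemma sinM_is_derive u x : is_derive x (1:R) (fun x => sin (x * u)) (u * cos (x * u)).
Proof.
have d1 : is_derive x (1:R) (fun x => x * u) u.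
  by apply: is_derive_eq; rewrite ?scaler0 ?scaler1 ?add0r ?addr0 ?mulr1.
have := @is_derive1_comp _ sin (fun x => x * u) x _ _ (is_derive_sin _) d1.
by rewrite mulrC.
Qed.

Lemma cosM_is_derive u x :
  is_derive x (1:R) (fun x => cos (x * u)) (- (u * sin (x * u))).
Proof.
have d1 : is_derive x (1:R) (fun x => x * u) u.
  by apply: is_derive_eq; rewrite ?scaler0 ?scaler1 ?add0r ?addr0 ?mulr1.
have := @is_derive1_comp _ cos (fun x => x * u) x _ _ (is_derive_cos _) d1.
by rewrite mulNr mulrC.
Qed.

Lemma expNM_cvg e : 0 < e -> expR (- (e * x)) @[x --> +oo] --> (0:R).
Proof.
move=> e0; have h : e * x @[x --> +oo] --> +oo.
  by apply: gt0_cvgMry => //; exact: cvg_id.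
exact: (@cvg_comp _ _ _ (fun x : R => e * x) (fun x => expR (- x)) _ _ _ h (@cvgr_expR R)).
Qed.

Lemma expNM_continuous e : continuous (fun x : R => expR (- (e * x))).
Proof. exact: is_derive_continuous (expNM_is_derive e). Qed.

Lemma exp_int e : 0 < e ->
  (\int[mu]_(x in halfline) (expR (- (e * x)))%:E)%E = (e^-1)%:E.
Proof.
move=> e0.
have d x : is_derive x (1:R) (fun x => - e^-1 * expR (- (e * x)))
    (expR (- (e * x))).
  have := is_deriveZ (- e^-1) (expNM_is_derive e x).
  by congr is_derive; rewrite /GRing.scale/= mulrA mulrNN mulVf ?gt_eqF// mul1r.
have l0 : - e^-1 * expR (- (e * x)) @[x --> +oo] --> (0:R).
  rewrite -(mulr0 (- e^-1)); apply: cvgM; [exact: cvg_cst|exact: expNM_cvg].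
have c : continuous (fun x : R => - e^-1 * expR (- (e * x))).
  exact: is_derive_continuous d.
rewrite (ge0_continuous_FTC2y _ _ l0).
- by rewrite mulr0 oppr0 expR0 mulr1 EFinN oppeK add0e.
- by move=> x _; exact: expR_ge0.
- by apply: continuous_subspaceT; exact: expNM_continuous.
- by move=> x _; have [] := d x.
- by apply: cvg_at_right_filter; exact: c.
- by move=> x _; rewrite derive1E; have [_ ->] := d x.
Qed.

Lemma exp_integrable e : 0 < e ->
  mu.-integrable halfline (EFin \o (fun x => expR (- (e * x)))).
Proof.
move=> e0; apply/integrableP; split.
  by apply: continuous_EFin_measurable; exact: expNM_continuous.
under eq_integral do rewrite /= ger0_norm ?expR_ge0//.
by rewrite exp_int// ltry.
Qed.

Definition poisson e u : R := e / (e ^+ 2 + u ^+ 2).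

Lemma poisson_den_gt0 e u : 0 < e -> 0 < e ^+ 2 + u ^+ 2.
Proof. by move=> e0; rewrite ltr_pwDl ?sqr_ge0// exprn_gt0. Qed.

(** The improper fundamental theorem of calculus needs a nonnegative integrand,
    hence the detour through 1 + cos. *)
Lemma exp_cos_int e u : 0 < e ->
  \int[mu]_(x in halfline) (expR (- (e * x)) * cos (x * u)) = poisson e u.
Proof.
move=> e0; have D0 := poisson_den_gt0 u e0.
pose F x := (e ^+ 2 + u ^+ 2)^-1 *
  (expR (- (e * x)) * (u * sin (x * u) - e * cos (x * u))) - e^-1 * expR (- (e * x)).
pose f x := expR (- (e * x)) * (1 + cos (x * u)).
have d x : is_derive x (1:R) F (f x).
  have d1 := is_deriveB (is_deriveZ u (sinM_is_derive u x))
                        (is_deriveZ e (cosM_is_derive u x)).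
  have d2 := is_deriveZ (e ^+ 2 + u ^+ 2)^-1 (is_deriveM (expNM_is_derive e x) d1).
  have d3 := is_deriveB d2 (is_deriveZ (e^-1) (expNM_is_derive e x)).
  move: d3; congr is_derive; rewrite /f /GRing.scale/=.
  set G := (X in _ + X * (- e * _)); have -> : G = u * sin (x * u) - e * cos (x * u) by [].
  by field; rewrite ?gt_eqF.
have eP := expNM_cvg e0.
have Fb x : `|F x| <= ((e ^+ 2 + u ^+ 2)^-1 * (`|u| + e) + e^-1) * expR (- (e * x)).
  have E0 := expR_ge0 (- (e * x)).
  rewrite /F (le_trans (ler_normB _ _))// mulrDl; apply: lerD; last first.
    by rewrite ger0_norm// mulr_ge0// invr_ge0 ltW.
  rewrite !normrM (gtr0_norm (_ : 0 < (e ^+ 2 + u ^+ 2)^-1)) ?invr_gt0//.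
  rewrite -mulrA ler_pM2l ?invr_gt0// (ger0_norm E0) mulrC ler_wpM2r//.
  rewrite (le_trans (ler_normB _ _))// !normrM (gtr0_norm e0); apply: lerD.
    by rewrite ler_piMr// sin_max.
  by rewrite ler_piMr ?cos_max// ltW.
have F0 : F x @[x --> +oo] --> (0:R).
  apply/norm_cvg0P; apply: (@squeeze_cvgr _ _ _ _ (fun=> 0)
    (fun x => ((e ^+ 2 + u ^+ 2)^-1 * (`|u| + e) + e^-1) * expR (- (e * x)))).
  - by near=> x; rewrite normr_ge0/=.
  - exact: cvg_cst.
  - rewrite -[X in _ --> X](mulr0 ((e ^+ 2 + u ^+ 2)^-1 * (`|u| + e) + e^-1)).
    by apply: cvgM => //; exact: cvg_cst.
have cF : continuous F by exact: is_derive_continuous d.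
have ccos : continuous (fun x => cos (x * u)).
  exact: is_derive_continuous (cosM_is_derive u).
have cf : continuous f.
  move=> x; apply: cvgM; first exact: expNM_continuous.
  by apply: cvgD; [exact: cvg_cst|exact: ccos].
have If : \int[mu]_(x in halfline) f x = e^-1 + poisson e u.
  rewrite (Rintegral_ge0_continuous_FTC2y _ _ F0).
  - rewrite sub0r /F !mulr0 !mul0r sin0 cos0 oppr0 expR0 /poisson.
    by field; rewrite ?gt_eqF.
  - move=> x _; rewrite /f mulr_ge0 ?expR_ge0//.
  - exact: continuous_subspaceT.
  - by move=> x _; have [] := d x.
  - by apply: cvg_at_right_filter; exact: cF.
  - by move=> x _; rewrite derive1E; have [_ ->] := d x.
have i1 := exp_integrable e0.
have i2 : mu.-integrable halfline
    (EFin \o (fun x => expR (- (e * x)) * cos (x * u))).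
  apply: (le_integrable measurable_halfline _ _ i1).
    apply: continuous_EFin_measurable => x.
    by apply: cvgM; [exact: expNM_continuous|exact: ccos].
  by move=> x _ /=; rewrite lee_fin normrM ler_piMr// cos_max.
move: If; rewrite /f.
under eq_Rintegral do rewrite mulrDr mulr1.
rewrite (RintegralD measurable_halfline i1 i2).
by rewrite {1}/Rintegral exp_int//= => /addrI.
Unshelve. all: by end_near. Qed.

Lemma poisson_ge0 e u : 0 < e -> 0 <= poisson e u.
Proof. by move=> e0; rewrite divr_ge0// ltW// poisson_den_gt0. Qed.

Lemma poisson_le e u : 0 < e -> poisson e u <= e^-1.
Proof.
move=> e0; rewrite /poisson ler_pdivrMr ?poisson_den_gt0//.
by rewrite mulrDr expr2 mulrA mulVf ?gt_eqF// mul1r lerDl mulr_ge0 ?sqr_ge0// invr_ge0 ltW.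
Qed.

Lemma poisson_atan e s t : 0 < e ->
  is_derive t (1:R) (fun t => atan ((t - s) / e)) (poisson e (s - t)).
Proof.
move=> e0.
have d1 : is_derive t (1:R) (fun t => (t - s) / e) e^-1.
  by apply: is_derive_eq; rewrite subr0 scaler0 add0r /GRing.scale/= mulr1.
have := @is_derive1_comp _ atan (fun t => (t - s) / e) t _ _ (is_derive1_atan _) d1.
congr is_derive; rewrite /poisson; field; rewrite ?gt_eqF//.
by rewrite poisson_den_gt0.
Qed.

Lemma poisson_continuous e s : 0 < e -> continuous (fun t => poisson e (s - t)).
Proof.
move=> e0 t; apply: cvgM; first exact: cvg_cst.
apply: cvgV; first by rewrite gt_eqF// poisson_den_gt0.
apply: cvgD; first exact: cvg_cst.
by apply: cvgM; (apply: cvgB; [exact: cvg_cst|exact: cvg_id]).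
Qed.

Lemma poisson_itv e s a b : 0 < e -> a < b ->
  \int[mu]_(t in `[a, b]) poisson e (s - t) =
  atan ((b - s) / e) - atan ((a - s) / e).
Proof.
move=> e0 ab.
have d t := poisson_atan s t e0.
have c : continuous (fun t => atan ((t - s) / e)) by exact: is_derive_continuous d.
rewrite /Rintegral (continuous_FTC2 ab (F := fun t => atan ((t - s) / e)))//.
- by apply: continuous_subspaceT; exact: poisson_continuous.
- split.
  + by move=> x _; have [] := d x.
  + by apply: cvg_at_right_filter; exact: c.
  + by apply: cvg_at_left_filter; exact: c.
- by move=> x _; rewrite derive1E; have [_ ->] := d x.
Qed.

End poisson.

Section weighted_energy.
Context {R : realType}.
Local Notation mu := (@lebesgue_measure R).
Local Notation mR := (measurableTypeR R).
Implicit Types (a b phi : R -> R) (e s t x T : R).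

Definition abel_weight e x : R := \1_halfline x * expR (- (e * x)).

Lemma abel_weightE e x : abel_weight e x = ((fun x => expR (- (e * x))) \_ halfline) x.
Proof.
by rewrite /abel_weight indicE patchE; case: ifP; rewrite ?mul1r ?mul0r.
Qed.

Lemma abel_weight_integrable e : 0 < e ->
  mu.-integrable setT (EFin \o abel_weight e).
Proof.
move=> e0; have := exp_integrable e0.
rewrite (integrable_mkcond _ measurable_halfline).
by apply: eq_integrable => // x _; rewrite /= abel_weightE restrict_EFin.
Qed.

Lemma meas2_trig phi : trig_like phi -> meas2 (fun x y : R => phi (x * y)).
Proof.
move=> [cphi _]; apply: (@measurableT_comp _ _ _ _ _ _ phi).
  exact: continuous_measurable_fun.
by apply: measurable_funM; [exact: measurable_fst|exact: measurable_snd].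
Qed.

Lemma trigt_sqr_abel phi a e : trig_like phi -> 0 < e ->
  continuous (trigt phi a) -> mu.-integrable setT (EFin \o a) ->
  let K s t := \int[mu]_x (abel_weight e x * phi (s * x) * phi (t * x)) in
  [/\ \int[mu]_x (abel_weight e x * trigt phi a x ^+ 2) =
      c0 ^+ 2 * \int[mu]_s (a s * \int[mu]_t (a t * K s t)),
      mu.-integrable setT (EFin \o (fun s => a s * \int[mu]_t (a t * K s t))) &
      forall s, mu.-integrable setT (EFin \o (fun t => a t * K s t))].
Proof.
move=> tphi e0 cphi ia K.
have iw := abel_weight_integrable e0.
have mphi := meas2_trig tphi.
have b1 x y : `|phi (x * y)| <= 1 by exact: tphi.2.
have tb x := trigt_bound x tphi ia.
have iw1 : mu.-integrable setT (EFin \o (fun x => abel_weight e x * trigt phi a x)).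
  by apply: (integrable_bddM iw _ tb); exact: continuous_measurable_fun.
have iw2 s : mu.-integrable setT (EFin \o (fun x => abel_weight e x * phi (s * x))).
  by apply: (integrable_bddM iw _ (fun x => tphi.2 (s * x))); exact: (meas2_section s mphi).
have mphi' : meas2 (fun x y : R => phi (y * x)).
  apply: (@measurableT_comp _ _ _ _ _ _ phi).
    exact: continuous_measurable_fun tphi.1.
  by apply: measurable_funM; [exact: measurable_snd|exact: measurable_fst].
have b2 x y : `|phi (y * x)| <= 1 := tphi.2 _.
have [F1 F1j] := fubini_bdd iw1 ia mphi b1.
have [_ F1i] := fubini_bdd ia iw1 mphi b1.
have [F2 F2j] : (forall s, _) /\ (forall s, _) :=
  conj (fun s => (fubini_bdd (iw2 s) ia mphi' b2).1)
       (fun s => (fubini_bdd (iw2 s) ia mphi' b2).2).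
have E s : \int[mu]_x (abel_weight e x * trigt phi a x * phi (s * x)) =
    c0 * \int[mu]_t (a t * K s t).
  rewrite /K -F2 -(RintegralZl c0 measurableT (F2j s)).
  by apply: eq_Rintegral => x _; rewrite /trigt; set J := Rintegral _ _ _; ring.
have isK : mu.-integrable setT (EFin \o (fun s => a s * \int[mu]_t (a t * K s t))).
  have := integrableZl measurableT (c0^-1) F1i.
  apply: eq_integrable => [|s _]; first exact: measurableT.
  rewrite /= -EFinM; apply: (congr1 EFin).
  by rewrite E mulrCA (mulKf (lt0r_neq0 c0_gt0)).
split; [|exact: isK|].
- transitivity (c0 * \int[mu]_x (abel_weight e x * trigt phi a x * \int[mu]_y (a y * phi (x * y)))).
    rewrite -(RintegralZl c0 measurableT F1j).
    apply: eq_Rintegral => x _.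
    rewrite expr2 {2}/trigt mulrA mulrCA.
    suff -> : \int[mu]_x0 (a x0 * phi (x0 * x)) = \int[mu]_y (a y * phi (x * y)) by [].
    by apply: eq_Rintegral => y _; rewrite (mulrC y).
  rewrite F1 expr2 -mulrA; apply: (congr1 ( *%R c0)).
  rewrite -(RintegralZl c0 measurableT isK).
  apply: eq_Rintegral => s _.
  rewrite mulrCA -E; apply: (congr1 ( *%R (a s))); apply: eq_Rintegral => x _.
  by rewrite (mulrC s).
- by move=> s; exact: (fubini_bdd ia (iw2 s) mphi b1).2.
Qed.

(** Expanding the squares and exchanging the integrals produces
    cos (s x) cos (t x) + sin (s x) sin (t x) = cos ((s - t) x), whose damped
    integral is the Poisson kernel. *)
Lemma weighted_energy T a e : 0 < e -> sqint a -> supp T a ->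
  \int[mu]_x (abel_weight e x * energy a x) =
    c0 ^+ 2 * \int[mu]_s (a s * \int[mu]_t (a t * poisson e (s - t))) /\
  mu.-integrable setT (EFin \o (fun s => a s * \int[mu]_t (a t * poisson e (s - t)))).
Proof.
move=> e0 ha sa; have ia := supp_integrable ha sa.
have iw := abel_weight_integrable e0.
have cc := ct_continuous ha sa; have cs := st_continuous ha sa.
have [Ec ic jc] := trigt_sqr_abel trig_cos e0 cc ia.
have [Es i_s js] := trigt_sqr_abel trig_sin e0 cs ia.
have P s t : \int[mu]_x (abel_weight e x * cos (s * x) * cos (t * x)) +
    \int[mu]_x (abel_weight e x * sin (s * x) * sin (t * x)) = poisson e (s - t).
  have i1 phi : trig_like phi -> mu.-integrable setT
      (EFin \o (fun x => abel_weight e x * phi (s * x) * phi (t * x))).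
    move=> tphi; apply: (integrable_bddM (M := 1)).
    - apply: (integrable_bddM (M := 1)) => //; first exact: (meas2_section s (meas2_trig tphi)).
      by move=> x; exact: tphi.2.
    - exact: (meas2_section t (meas2_trig tphi)).
    - by move=> x; exact: tphi.2.
  rewrite -(RintegralD measurableT (i1 _ trig_cos) (i1 _ trig_sin)).
  rewrite -exp_cos_int// [RHS]Rintegral_mkcond; apply: eq_Rintegral => x _.
  transitivity (abel_weight e x * cos (x * (s - t))).
    by rewrite mulrBr cosB !(mulrC x); ring.
  by rewrite /abel_weight indicE patchE; case: ifP => _; rewrite ?mul1r ?mul0r.
have Ein s : a s * \int[mu]_t (a t * poisson e (s - t)) =
    a s * \int[mu]_t (a t * \int[mu]_x (abel_weight e x * cos (s * x) * cos (t * x))) +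
    a s * \int[mu]_t (a t * \int[mu]_x (abel_weight e x * sin (s * x) * sin (t * x))).
  rewrite -mulrDr -(RintegralD measurableT (jc s) (js s)).
  apply: (congr1 ( *%R (a s))).
  by apply: eq_Rintegral => t _; rewrite -mulrDr P.
split; last first.
  have := integrableD measurableT ic i_s.
  by apply: eq_integrable => // s _; rewrite /= -EFinD Ein.
have ibd phi : trig_like phi -> continuous (trigt phi a) ->
    mu.-integrable setT (EFin \o (fun x => abel_weight e x * trigt phi a x ^+ 2)).
  move=> tphi cphi.
  apply: (integrable_bddM (M := (c0 * \int[mu]_x `|a x|) ^+ 2)) => //.
    by apply: continuous_measurable_fun => x; apply: cvgM; exact: cphi.
  move=> x; have := trigt_bound x tphi ia; rewrite normrX => h.
  by rewrite ler_sqr ?nnegrE// (le_trans _ h).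
transitivity (\int[mu]_x (abel_weight e x * ct a x ^+ 2) +
   \int[mu]_x (abel_weight e x * st a x ^+ 2)).
  rewrite -(RintegralD measurableT (ibd _ trig_cos cc) (ibd _ trig_sin cs)).
  by apply: eq_Rintegral => x _; rewrite -mulrDr.
rewrite Ec Es -mulrDr -(RintegralD measurableT ic i_s).
apply: (congr1 ( *%R (c0 ^+ 2))).
by apply: eq_Rintegral => s _; rewrite Ein.
Qed.

End weighted_energy.

(** * Plancherel's identity on the half-line *)

Section plancherel_bounds.
Context {R : realType}.
Local Notation mu := (@lebesgue_measure R).
Local Notation mR := (measurableTypeR R).
Implicit Types (a b : R -> R) (e s t x T : R).

Lemma poisson_continuous0 e : 0 < e -> continuous (poisson e).
Proof.
move=> e0 t; apply: cvgM; first exact: cvg_cst.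
apply: cvgV; first by rewrite gt_eqF// poisson_den_gt0.
by apply: cvgD; [exact: cvg_cst|apply: cvgM; exact: cvg_id].
Qed.

Lemma meas2_poisson e : 0 < e -> meas2 (fun s t : R => poisson e (s - t)).
Proof.
move=> e0; apply: (@measurableT_comp _ _ _ _ _ _ (poisson e)).
  by apply: continuous_measurable_fun; exact: poisson_continuous0.
by apply: measurable_funB; [exact: measurable_fst|exact: measurable_snd].
Qed.

Lemma poisson_norm_le e s t : 0 < e -> `|poisson e (s - t)| <= e^-1.
Proof. by move=> e0; rewrite ger0_norm ?poisson_ge0// poisson_le. Qed.

Definition chi_itv T : R -> R := \1_(`]- T, T[%classic).

Lemma chi_itv_integrable T : mu.-integrable setT (EFin \o chi_itv T).
Proof. exact: integrable_indic_itv. Qed.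

Definition poisson_mass e T s := \int[mu]_t (chi_itv T t * poisson e (s - t)).

Lemma poisson_massE e T s : 0 < e -> 0 < T ->
  poisson_mass e T s = atan ((T - s) / e) - atan ((- T - s) / e).
Proof.
move=> e0 T0; have TT : - T < T by lra.
have cp := @poisson_continuous R e s e0.
rewrite -(poisson_itv s e0 TT) /poisson_mass.
transitivity (\int[mu]_(t in `]-T, T[) poisson e (s - t)).
  rewrite [RHS]Rintegral_mkcond; apply: eq_Rintegral => t _.
  by rewrite /chi_itv indicE patchE; case: ifP => _; rewrite ?mul1r ?mul0r.
apply: (congr1 fine); apply/esym.
apply: (@integral_itv_bndoo R (- T) T (fun t => (poisson e (s - t))%:E) true false).
exact: (@continuous_EFin_measurable R `]-T, T[%classic _ cp).
Qed.

Lemma poisson_mass_le e T s : 0 < e -> 0 < T -> poisson_mass e T s <= pi.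
Proof.
move=> e0 T0; rewrite poisson_massE//.
have := atan_ltpi2 ((T - s) / e); have := atan_gtNpi2 ((- T - s) / e); lra.
Qed.

Lemma chi_itv_cases T t : chi_itv T t = 0 \/ chi_itv T t = 1.
Proof. by rewrite /chi_itv indicE; case: (_ \in _); [right|left]. Qed.

(** By a(s) a(t) <= (a(s)^2 + a(t)^2) / 2 and the total mass pi of the kernel. *)
Lemma poisson_form_le T a e : 0 < e -> 0 < T -> sqint a -> supp T a ->
  \int[mu]_s (a s * \int[mu]_t (a t * poisson e (s - t))) <= pi * sqn a.
Proof.
move=> e0 T0 ha sa; have ia := supp_integrable ha sa.
have [_ iP] := weighted_energy e0 ha sa.
have ia2 : mu.-integrable setT (EFin \o (fun x => a x ^+ 2)) := ha.2.
have i1 := chi_itv_integrable T.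
have mk := meas2_poisson e0.
have bk s t := poisson_norm_le s t e0.
have [E1 j1] := fubini_bdd ia2 i1 mk bk.
have [E2 j2] := fubini_bdd i1 ia2 mk bk.
have is1 s : mu.-integrable setT (EFin \o (fun t => chi_itv T t * poisson e (s - t))).
  exact: (integrable_bddM i1 (meas2_section s mk) (bk s)).
have is2 s : mu.-integrable setT (EFin \o (fun t => a t ^+ 2 * poisson e (s - t))).
  exact: (integrable_bddM ia2 (meas2_section s mk) (bk s)).
have is3 s : mu.-integrable setT (EFin \o (fun t => a t * poisson e (s - t))).
  exact: (integrable_bddM ia (meas2_section s mk) (bk s)).
pose A := \int[mu]_s (a s ^+ 2 * \int[mu]_t (chi_itv T t * poisson e (s - t))).
have A_le : A <= pi * sqn a.
  rewrite /A mulrC /sqn /dot -(RintegralZr _ measurableT (sqint_mul ha ha)).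
  have i3 : mu.-integrable setT (EFin \o (fun x => a x * a x * pi)).
    apply: eq_integrable_fun (integrableZr_fun pi ia2) => x.
    by rewrite mulrC expr2.
  apply: (le_Rintegral measurableT j1 i3) => s _.
  rewrite -expr2; apply: ler_wpM2l; first exact: sqr_ge0.
  exact: (poisson_mass_le s e0 T0).
have B_A : \int[mu]_s (chi_itv T s * \int[mu]_t (a t ^+ 2 * poisson e (s - t))) = A.
  rewrite E2; apply: eq_Rintegral => t _; apply: (congr1 ( *%R (a t ^+ 2))).
  by apply: eq_Rintegral => s _; rewrite /poisson -(sqrrN (t - s)) opprB.
have pw s : 2 * (a s * \int[mu]_t (a t * poisson e (s - t))) <=
    a s ^+ 2 * \int[mu]_t (chi_itv T t * poisson e (s - t)) +
    chi_itv T s * \int[mu]_t (a t ^+ 2 * poisson e (s - t)).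
  rewrite -(RintegralZl (a s) measurableT (is3 s)).
  rewrite -(RintegralZl (a s ^+ 2) measurableT (is1 s)).
  rewrite -(RintegralZl (chi_itv T s) measurableT (is2 s)).
  have k1 := integrableZr_fun (a s) (is3 s).
  have k2 := integrableZr_fun (a s ^+ 2) (is1 s).
  have k3 := integrableZr_fun (chi_itv T s) (is2 s).
  have k1' := integrableZr_fun 2 k1.
  rewrite -(RintegralZl 2 measurableT k1) -(RintegralD measurableT k2 k3).
  apply: (le_Rintegral measurableT k1' (integrableD_fun k2 k3)).
  move=> t _; have P0 : 0 <= poisson e (s - t) by exact: poisson_ge0.
  have a0 r : chi_itv T r = 0 -> a r = 0.
    by move=> c; rewrite -(supp_indic sa r) -/(chi_itv T r) c mul0r.
  have q0 := mulr_ge0 (sqr_ge0 (a s - a t)) P0.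
  have q1 := mulr_ge0 (sqr_ge0 (a s)) P0.
  have q2 := mulr_ge0 (sqr_ge0 (a t)) P0.
  have [c1|c1] := chi_itv_cases T s; have [c2|c2] := chi_itv_cases T t.
  - by rewrite c1 c2 (a0 _ c1) (a0 _ c2) expr0n /= !(mulr0, mul0r) addr0.
  - by rewrite c1 c2 (a0 _ c1) expr0n /= !(mulr0, mul0r) addr0.
  - by rewrite c1 c2 (a0 _ c2) expr0n /= !(mulr0, mul0r) addr0.
  - rewrite c1 c2 !mul1r; move: q0; rewrite -subr_ge0 => q0.
    rewrite -subr_ge0; move: q0; congr (0 <= _); ring.
have J := integrableD_fun j1 j2.
have iP2 := integrableZr_fun 2 iP.
have := le_Rintegral measurableT iP2 J (fun s _ => pw s).
rewrite (RintegralZl 2 measurableT iP) (RintegralD measurableT j1 j2) B_A -/A.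
move=> H; rewrite -(ler_pM2l (@ltr0Sn R 1)); apply: (le_trans H).
rewrite mulr_natl mulr2n; exact: (lerD A_le A_le).
Qed.

Lemma abel_weight_ge0 e x : 0 <= abel_weight e x.
Proof. by rewrite mulr_ge0 ?expR_ge0// indicE. Qed.

Lemma abel_weight_meas e : measurable_fun setT (abel_weight e).
Proof.
apply: measurable_funM; first exact: (measurable_indic measurable_halfline).
by apply: continuous_measurable_fun; exact: expNM_continuous.
Qed.

Lemma energy_integrable_weight T a e : 0 < e -> sqint a -> supp T a ->
  mu.-integrable setT (EFin \o (fun x => abel_weight e x * energy a x)).
Proof.
move=> e0 ha sa; have ia := supp_integrable ha sa.
have iw := abel_weight_integrable e0.
apply: (integrable_bddM (M := 2 * (c0 * \int[mu]_x `|a x|) ^+ 2) iw).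
  by apply: continuous_measurable_fun; exact: energy_continuous ha sa.
move=> x; rewrite ger0_norm ?energy_ge0//.
have := trigt_bound x trig_cos ia; have := trigt_bound x trig_sin ia.
rewrite /energy /ct /st.
set C := trigt cos a x; set S := trigt sin a x; set B := c0 * _ => SB CB.
have : C ^+ 2 <= B ^+ 2.
  by rewrite -(real_normK (num_real C)) ler_sqr ?nnegrE// (le_trans _ CB).
have : S ^+ 2 <= B ^+ 2.
  by rewrite -(real_normK (num_real S)) ler_sqr ?nnegrE// (le_trans _ SB).
lra.
Qed.

Lemma abel_weight_cvg x : halfline x ->
  abel_weight (k.+1%:R^-1) x @[k --> \oo] --> (1:R).
Proof.
move=> xh.
have h : - (k.+1%:R^-1 * x) @[k --> \oo] --> (0:R).
  rewrite -[X in _ --> X]oppr0 -[X in _ --> - X](mul0r x); apply: cvgN.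
  by apply: cvgM; [exact: cvg_harmonic|exact: cvg_cst].
have := continuous_cvg _ (@continuous_expR R 0) h; rewrite expR0.
have -> : (fun k : nat => abel_weight k.+1%:R^-1 x) =
    (fun k => expR (- (k.+1%:R^-1 * x))).
  by apply/funext => k; rewrite /abel_weight indicE mem_set// mul1r.
exact.
Qed.

Lemma c0_pi : c0 ^+ 2 * pi = 2^-1 :> R.
Proof. by rewrite c0_sqr invfM -mulrA mulVf ?mulr1// gt_eqF// pi_gt0. Qed.

(** Fatou's lemma as the damping is removed. *)
Lemma energy_le T a : 0 < T -> sqint a -> supp T a ->
  (\int[mu]_(x in halfline) (energy a x)%:E <= (sqn a / 2)%:E)%E.
Proof.
move=> T0 ha sa.
have cE := energy_continuous ha sa.
apply: (@fatou_cst _ halfline (fun k x => abel_weight (k.+1%:R^-1) x * energy a x)).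
- exact: measurable_halfline.
- move=> k; apply: measurable_funTS; apply: measurable_funM.
    exact: abel_weight_meas.
  exact: continuous_measurable_fun.
- by move=> k x _; rewrite mulr_ge0 ?energy_ge0 ?abel_weight_ge0.
- move=> k; have e0 : 0 < k.+1%:R^-1 :> R by rewrite invr_gt0.
  have [E _] := weighted_energy e0 ha sa.
  have iE := energy_integrable_weight e0 ha sa.
  apply: (@le_trans _ _ (\int[mu]_x (abel_weight (k.+1%:R^-1) x * energy a x)%:E)%E).
    apply: ge0_subset_integral => //; first exact: measurable_halfline.
      exact: (measurable_int mu iE).
    by move=> x _; rewrite lee_fin mulr_ge0 ?energy_ge0 ?abel_weight_ge0.
  rewrite -(fineK (integrable_fin_num measurableT iE)) lee_fin.
  rewrite -/(Rintegral mu setT (fun x => abel_weight (k.+1%:R^-1) x * energy a x)).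
  have -> : sqn a / 2 = c0 ^+ 2 * (pi * sqn a) by rewrite mulrA c0_pi mulrC.
  rewrite E; apply: ler_wpM2l; first exact: sqr_ge0.
  exact: poisson_form_le e0 T0 ha sa.
- move=> x xh; rewrite -[X in _ --> X](mul1r (energy a x)).
  by apply: cvgM; [exact: abel_weight_cvg|exact: cvg_cst].
Qed.

End plancherel_bounds.

Section plancherel_continuous.
Context {R : realType}.
Local Notation mu := (@lebesgue_measure R).
Local Notation mR := (measurableTypeR R).
Implicit Types (a b : R -> R) (e s t x T : R).

Lemma poisson_mass_cvg T s : 0 < T -> -T < s < T ->
  poisson_mass (n.+1%:R^-1) T s @[n --> \oo] --> (pi : R).
Proof.
move=> T0 /andP[s1 s2].
have H x : 0 < x -> atan (x / n.+1%:R^-1) @[n --> \oo] --> (pi / 2 : R).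
  move=> x0; have h : x / n.+1%:R^-1 @[n --> \oo] --> +oo.
    have -> : (fun n : nat => x / n.+1%:R^-1) = (fun n => x * n.+1%:R).
      by apply/funext => n; rewrite invrK.
    have h1 : n.+1%:R @[n --> \oo] --> (+oo : set_system R).
      apply/cvgryPge => A; apply: filterS (nbhs_infty_ger A) => n An.
      by rewrite (le_trans An)// ler_nat.
    have h2 : x * r @[r --> +oo] --> +oo by apply: gt0_cvgMry => //; exact: cvg_id.
    exact: (@cvg_comp _ _ _ (fun n : nat => n.+1%:R) (fun r : R => x * r) _ _ _ h1 h2).
  exact: (@cvg_comp _ _ _ (fun n : nat => x / n.+1%:R^-1) atan _ _ _ h (@cvgy_atan R)).
have -> : (fun n : nat => poisson_mass n.+1%:R^-1 T s) =
    (fun n => atan ((T - s) / n.+1%:R^-1) + atan ((T + s) / n.+1%:R^-1)).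
  apply/funext => n; rewrite poisson_massE ?invr_gt0//.
  by rewrite -opprD mulNr atanN opprK.
rewrite [X in _ --> X](splitr pi); apply: cvgD; apply: H; lra.
Qed.

Lemma poisson_far e u r : 0 < e -> 0 < r -> r <= `|u| -> poisson e u <= e / r ^+ 2.
Proof.
move=> e0 r0 ru; rewrite /poisson ler_pM2l// lef_pV2 ?posrE.
- rewrite -(real_normK (num_real u)).
  have : r ^+ 2 <= `|u| ^+ 2 by rewrite ler_sqr ?nnegrE// ltW.
  by have := sqr_ge0 e; lra.
- exact: poisson_den_gt0.
- by rewrite exprn_gt0.
Qed.

Lemma chi_itv1 T t : -T < t < T -> chi_itv T t = 1.
Proof. by move=> h; rewrite /chi_itv indicE mem_set. Qed.

Lemma chi_itv0 T t : ~ (`]-T, T[%classic t) -> chi_itv T t = 0.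
Proof. by move=> h; rewrite /chi_itv indicE memNset. Qed.

Lemma chi_itv_ge0 T t : 0 <= chi_itv T t.
Proof. by case: (chi_itv_cases T t) => ->. Qed.

Lemma chi_itv_meas T : measurable_fun setT (chi_itv T).
Proof. exact: measurable_indic. Qed.

Lemma chi_itv_int T : 0 < T -> \int[mu]_t chi_itv T t = 2 * T.
Proof.
move=> T0; rewrite /Rintegral /chi_itv integral_indic// setIT.
have := @lebesgue_measure_itv R `]- T, T[; rewrite /= lte_fin.
have -> : (- T < T) = true by lra.
move=> H; transitivity (fine (T%:E + (- - T)%:E)%E); last by rewrite /=; lra.
exact: (congr1 fine H).
Qed.

Lemma continuous_itv_bounded T b : 0 < T -> continuous b ->
  exists2 B, 0 <= B & forall t, `|chi_itv T t * b t| <= B.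
Proof.
move=> T0 cb; have TT : - T <= T by lra.
have cn : {within `[-T, T], continuous (fun t => `|b t|)}.
  by apply: continuous_subspaceT => t; apply: cvg_norm; exact: cb.
have [c _ cP] := EVT_max TT cn.
exists `|b c| => // t; rewrite normrM.
have [h|h] := pselect (`]-T, T[%classic t); last first.
  by rewrite chi_itv0// normr0 mul0r.
rewrite (chi_itv1 h) normr1 mul1r; apply: cP.
by move: h; rewrite /= !in_itv/= => /andP[? ?]; rewrite !ltW.
Qed.

Lemma poisson_conv_cvg T b s : 0 < T -> continuous b -> - T < s < T ->
  \int[mu]_t (chi_itv T t * b t * poisson (n.+1%:R^-1) (s - t)) @[n --> \oo]
    --> pi * b s.
Proof.
move=> T0 cb sT; have [B B0 bB] := continuous_itv_bounded T0 cb.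
apply/cvgrPdist_le => eta eta0.
pose eta1 := eta / (2 * pi).
have pi0 : 0 < pi :> R := pi_gt0 R.
have eta10 : 0 < eta1 by rewrite divr_gt0// mulr_gt0.
have [r r0 rP] : exists2 r, 0 < r & forall t, `|s - t| < r ->
    - T < t < T /\ `|b s - b t| <= eta1.
  have /cvgrPdist_le/(_ _ eta10)/nbhs_ballP[r1 r10 r1P] := cb s.
  move: sT => /andP[s1 s2].
  exists (Num.min r1 (Num.min (T - s) (s + T))).
    by rewrite !lt_min r10/=; apply/andP; split; lra.
  move=> t; rewrite !lt_min => /and3P[t1 t2 t3]; split.
    by move: t2 t3; rewrite !ltr_norml => /andP[? ?] /andP[? ?]; apply/andP; split; lra.
  exact: r1P.
pose K := 2 * B / r ^+ 2 * (2 * T).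
pose m n := poisson_mass (n.+1%:R^-1) T s.
have f0 : `|b s| * `|pi - m n| + K * n.+1%:R^-1 @[n --> \oo] --> (0:R).
  rewrite -[X in _ --> X](addr0 0); apply: cvgD.
    rewrite -[X in _ --> X](mulr0 `|b s|); apply: cvgM; first exact: cvg_cst.
    rewrite -[X in _ --> X](@normr0 _ R); apply: cvg_norm.
    rewrite -[X in _ --> X](subrr (pi:R)); apply: cvgB; first exact: cvg_cst.
    exact: poisson_mass_cvg.
  rewrite -[X in _ --> X](mulr0 K); apply: cvgM; first exact: cvg_cst.
  exact: cvg_harmonic.
have eta20 : 0 < eta / 2 by rewrite divr_gt0.
move/cvgrPdist_le/(_ _ eta20) : f0; apply: filterS => n.
rewrite sub0r normrN => hn.
set e := n.+1%:R^-1; have e0 : 0 < e by rewrite invr_gt0.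
have mk := meas2_poisson e0.
have bk t := poisson_norm_le s t e0.
have i1 : mu.-integrable setT (EFin \o (fun t => chi_itv T t * poisson e (s - t))).
  exact: (integrable_bddM (chi_itv_integrable T) (meas2_section s mk) bk).
have mcb : measurable_fun setT (fun t => chi_itv T t * b t).
  apply: measurable_funM; first exact: chi_itv_meas.
  exact: continuous_measurable_fun.
have ib : mu.-integrable setT (EFin \o (fun t => chi_itv T t * b t)).
  have sq : sqint (fun t => chi_itv T t * b t).
    apply: (@bounded_sqint _ T _ B) => // x xT.
    by rewrite chi_itv0// mul0r.
  by apply: (supp_integrable sq (T := T)) => x xT; rewrite chi_itv0// mul0r.
have i2 : mu.-integrable setT (EFin \o (fun t => chi_itv T t * b t * poisson e (s - t))).
  exact: (integrable_bddM ib (meas2_section s mk) bk).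
have i3 := integrableZr_fun (b s) i1.
have bs : b s = chi_itv T s * b s by rewrite chi_itv1// mul1r.
have -> : pi * b s - \int[mu]_t (chi_itv T t * b t * poisson e (s - t)) =
    b s * (pi - m n) + \int[mu]_t (b s * (chi_itv T t * poisson e (s - t)) -
      chi_itv T t * b t * poisson e (s - t)).
  rewrite (RintegralB measurableT i3 i2) (RintegralZl _ measurableT i1).
  rewrite -/(poisson_mass e T s) -/(m n).
  by set J := Rintegral _ _ _; ring.
have i4 := integrableZr_fun eta1 i1.
have i5 := integrableZr_fun (2 * B * e / r ^+ 2) (chi_itv_integrable T).
have i6 := integrableD_fun i4 i5.
have iN := integrableZr_fun (-1) i2.
have i7 : mu.-integrable setT (EFin \o (fun t => b s * (chi_itv T t * poisson e (s - t)) -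
      chi_itv T t * b t * poisson e (s - t))).
  by apply: eq_integrable_fun (integrableD_fun i3 iN) => t; rewrite mulN1r.
have main : `|\int[mu]_t (b s * (chi_itv T t * poisson e (s - t)) -
      chi_itv T t * b t * poisson e (s - t))| <= eta1 * m n + K * e.
  apply: le_trans (le_normr_Rintegral measurableT i7) _.
  have -> : eta1 * m n + K * e = \int[mu]_t (eta1 * (chi_itv T t * poisson e (s - t)) +
      2 * B * e / r ^+ 2 * chi_itv T t).
    rewrite (RintegralD measurableT i4 i5) (RintegralZl _ measurableT i1).
    rewrite (RintegralZl _ measurableT (chi_itv_integrable T)) chi_itv_int//.
    congr (_ + _); rewrite /K; ring.
  apply: (le_Rintegral measurableT (integrable_norm i7) i6) => t _.
  have P0 : 0 <= poisson e (s - t) := poisson_ge0 _ e0.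
  rewrite /=.
  have -> : b s * (chi_itv T t * poisson e (s - t)) -
    chi_itv T t * b t * poisson e (s - t) =
    chi_itv T t * ((b s - b t) * poisson e (s - t)) by ring.
  have [c|c] := chi_itv_cases T t; first by rewrite c !(mul0r, mulr0) normr0 addr0.
  rewrite c !mul1r normrM (ger0_norm P0) mulr1.
  have q0 : 0 <= 2 * B * e / r ^+ 2.
    by rewrite divr_ge0 ?sqr_ge0// !mulr_ge0// ltW.
  have [st|st] := ltP `|s - t| r.
    rewrite -[leLHS]addr0; apply: lerD => //; apply: ler_wpM2r => //.
    exact: (rP _ st).2.
  rewrite -[leLHS]add0r; apply: lerD; first by rewrite mulr_ge0// ltW.
  have -> : 2 * B * e / r ^+ 2 = (2 * B) * (e / r ^+ 2) by ring.
  apply: ler_pM => //; last exact: poisson_far.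
  rewrite (le_trans (ler_normB _ _))// mulr_natl mulr2n; apply: lerD.
    by rewrite bs; exact: bB.
  by have := bB t; rewrite c mul1r.
apply: (le_trans (ler_normD _ _)).
have m_pi : m n <= pi by exact: poisson_mass_le.
have e1m : eta1 * m n <= eta / 2.
  have -> : eta / 2 = eta1 * pi by rewrite /eta1 invfM mulrA -mulrA (mulVf (lt0r_neq0 pi0)) mulr1.
  by rewrite ler_pM2l.
move: hn; rewrite ger0_norm; last first.
  have T00 := ltW T0; have e00 := ltW e0; have r00 := sqr_ge0 r.
  have K0 : 0 <= K by rewrite /K !mulr_ge0// invr_ge0.
  by apply: addr_ge0; apply: mulr_ge0.
rewrite normrM -/e => hn.
rewrite (splitr eta); apply: (@le_trans _ _ (`|b s| * `|pi - m n| + (eta1 * m n + K * e))).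
  by rewrite lerD2l.
by rewrite addrCA addrC; apply: lerD.
Qed.

End plancherel_continuous.

Section plancherel.
Context {R : realType}.
Local Notation mu := (@lebesgue_measure R).
Local Notation mR := (measurableTypeR R).
Implicit Types (a b : R -> R) (e s t x T : R).

Lemma sqnER a : sqn a = \int[mu]_x (a x ^+ 2).
Proof. by apply: eq_Rintegral => x _; rewrite expr2. Qed.

Lemma supp_chi T b : supp T (fun t => chi_itv T t * b t).
Proof. by move=> x xT; rewrite chi_itv0// mul0r. Qed.

Lemma sqint_chi_continuous T b : 0 < T -> continuous b ->
  sqint (fun t => chi_itv T t * b t).
Proof.
move=> T0 cb; have [B _ bB] := continuous_itv_bounded T0 cb.
apply: (@bounded_sqint _ T _ B) => //; last exact: supp_chi.
apply: measurable_funM; first exact: chi_itv_meas.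
exact: continuous_measurable_fun.
Qed.

Lemma energy_weight_le T a e : 0 < e -> sqint a -> supp T a ->
  ((\int[mu]_x (abel_weight e x * energy a x))%:E <=
   \int[mu]_(x in halfline) (energy a x)%:E)%E.
Proof.
move=> e0 ha sa.
have iE := energy_integrable_weight e0 ha sa.
have mE : measurable_fun halfline (fun x => (energy a x)%:E).
  by apply: continuous_EFin_measurable; exact: energy_continuous ha sa.
rewrite /Rintegral fineK; last exact: (integrable_fin_num measurableT iE).
rewrite [leRHS]integral_mkcond; apply: ge0_le_integral.
- exact: measurableT.
- by move=> x _; rewrite lee_fin mulr_ge0 ?energy_ge0 ?abel_weight_ge0.
- exact: (measurable_int mu iE).
- apply/(measurable_restrictT _ _).1 => //; exact: measurable_halfline.
move=> x _; rewrite patchE /abel_weight indicE.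
case: ifP => [xh|_]; last by rewrite !mul0r.
rewrite mul1r lee_fin ler_piMl ?energy_ge0//.
rewrite -[leRHS](@expR0 R) ler_expR oppr_le0 mulr_ge0 ?(ltW e0)//.
by move: xh; rewrite inE /halfline/= in_itv/= andbT.
Qed.

(** The Poisson integrals of a continuous function b converge to pi b(s) inside
    the interval, so nothing is lost in the limit. *)
Lemma energy_ge_continuous T b : 0 < T -> continuous b ->
  ((sqn (fun t => chi_itv T t * b t) / 2)%:E <=
   \int[mu]_(x in halfline) (energy (fun t => chi_itv T t * b t) x)%:E)%E.
Proof.
move=> T0 cb; pose a t := chi_itv T t * b t; rewrite -/a.
have ha : sqint a by exact: sqint_chi_continuous.
have sa : supp T a by exact: supp_chi.
have ia := supp_integrable ha sa.
have [B B0 bB] := continuous_itv_bounded T0 cb.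
pose e (n : nat) : R := n.+1%:R^-1.
have e0 n : 0 < e n by rewrite invr_gt0.
pose G n s := \int[mu]_t (a t * poisson (e n) (s - t)).
have G_le n s : `|G n s| <= B * pi.
  have mk := meas2_poisson (e0 n).
  have bk t := poisson_norm_le s t (e0 n).
  have i1 := integrable_bddM ia (meas2_section s mk) bk.
  have i2 := integrable_bddM (chi_itv_integrable T) (meas2_section s mk) bk.
  apply: (le_trans (le_normr_Rintegral measurableT i1)).
  apply: (@le_trans _ _ (B * poisson_mass (e n) T s)); last first.
    by apply: ler_wpM2l => //; exact: poisson_mass_le.
  rewrite -(RintegralZl B measurableT i2).
  apply: (le_Rintegral measurableT (integrable_norm i1) (integrableZr_fun B i2)).
  move=> t _; rewrite /= normrM (ger0_norm (poisson_ge0 _ (e0 n))) mulrA.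
  apply: ler_wpM2r; first exact: poisson_ge0.
  rewrite /a; have := bB t.
  by case: (chi_itv_cases T t) => ->; rewrite ?mul0r ?normr0 ?mulr0// mulr1.
have iF n := (weighted_energy (e0 n) ha sa).2.
have mF n : measurable_fun setT (fun s => a s * G n s).
  by apply/measurable_EFinP; exact: (measurable_int mu (iF n)).
have cF s : a s * G n s @[n --> \oo] --> a s * (pi * a s).
  have [h|h] := pselect (`]-T, T[%classic s).
    apply: cvgM; first exact: cvg_cst.
    have -> : a s = b s by rewrite /a chi_itv1// mul1r.
    exact: poisson_conv_cvg.
  have as0 : a s = 0 by rewrite /a chi_itv0// mul0r.
  rewrite as0 mul0r; have -> : (fun n => 0 * G n s) = (fun=> 0).
    by apply/funext => n; rewrite mul0r.
  exact: cvg_cst.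
have ig : mu.-integrable setT (EFin \o (fun s => B * pi * `|a s|)).
  exact: integrableZr_fun (integrable_norm ia).
have dom n s : `|a s * G n s| <= B * pi * `|a s|.
  by rewrite normrM mulrC ler_wpM2r.
have cv := Rdominated_cvg mF cF ig dom.
have ipi : \int[mu]_s (a s * (pi * a s)) = pi * sqn a.
  rewrite /sqn /dot -(RintegralZl pi measurableT (sqint_mul ha ha)).
  by apply: eq_Rintegral => s _; rewrite mulrCA.
rewrite ipi in cv.
have -> : sqn a / 2 = c0 ^+ 2 * (pi * sqn a).
  by rewrite mulrA c0_pi mulrC.
have cv2 : (c0 ^+ 2 * \int[mu]_s (a s * G n s))%:E @[n --> \oo] -->
    (c0 ^+ 2 * (pi * sqn a))%:E.
  apply: cvg_EFin; first exact: nearW.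
  by apply: cvgM; [exact: cvg_cst|exact: cv].
rewrite -(cvg_lim _ cv2)//; apply: lime_le; first by apply/cvg_ex; eexists; exact: cv2.
apply: nearW => n; have := energy_weight_le (e0 n) ha sa.
by rewrite (weighted_energy (e0 n) ha sa).1.
Qed.

Definition clip (k x : R) : R := Num.max (- k) (Num.min x k).

Lemma clip_le k x : 0 <= k -> `|clip k x| <= k.
Proof.
move=> k0; rewrite /clip ler_norml; apply/andP; split; first by rewrite le_max lexx.
rewrite ge_max; apply/andP; split; first lra.
by rewrite ge_min lexx orbT.
Qed.

Lemma clip_id k x : `|x| <= k -> clip k x = x.
Proof.
rewrite ler_norml /clip => /andP[kx xk].
by rewrite (min_idPl xk) (max_idPr kx).
Qed.

Lemma clip_lip k x y : 0 <= k -> `|clip k x - clip k y| <= `|x - y|.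
Proof.
move=> k0; rewrite /clip ler_norml.
have A := ler_norm (x - y); have := ler_norm (- (x - y)); rewrite normrN => C.
have D := normr_ge0 (x - y).
case: (lerP x k) => xk; case: (lerP y k) => yk;
  repeat case: (lerP (- k) _) => ?; apply/andP; split; lra.
Qed.

Lemma clip_dist k x : 0 <= k -> `|x - clip k x| <= `|x|.
Proof.
move=> k0; rewrite /clip ler_norml.
have A := ler_norm x; have := ler_norm (- x); rewrite normrN => C.
have D := normr_ge0 x.
case: (lerP x k) => xk; repeat case: (lerP (- k) _) => ?; apply/andP; split; lra.
Qed.

Lemma clip_continuous k : 0 <= k -> continuous (clip k).
Proof.
move=> k0 x; apply/cvgrPdist_le => e e0.
have /cvgrPdist_le/(_ _ e0) : y @[y --> x] --> x by exact: cvg_id.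
by apply: filterS => y; apply: le_trans; exact: clip_lip.
Qed.

Lemma continuous_dense T a e : 0 < T -> 0 < e -> sqint a -> supp T a ->
  exists2 b, continuous b & sqn (a \- (fun t => chi_itv T t * b t)) <= e.
Proof.
move=> T0 e0 ha sa; have ma := sqint_meas ha.
have mclip (k : nat) : measurable_fun setT (fun x => clip k%:R (a x)).
  apply: (@measurableT_comp _ _ _ _ _ _ (clip k%:R)) => //.
  by apply: continuous_measurable_fun; exact: clip_continuous.
have clip0 (k : nat) : clip k%:R 0 = 0 by rewrite clip_id// normr0.
have sclip (k : nat) : supp T (fun x => clip k%:R (a x)).
  by move=> x xT; rewrite sa.
have hclip (k : nat) : sqint (fun x => clip k%:R (a x)).
  by apply: (bounded_sqint (mclip k) (sclip k)) => x; exact: clip_le.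
have [k kP] : exists k : nat, sqn (a \- (fun x => clip k%:R (a x))) <= e / 4.
  have cF s : (a s - clip k%:R (a s)) ^+ 2 @[k --> \oo] --> (0:R).
    apply: cvg_near_cst; apply: filterS (nbhs_infty_ger `|a s|) => k ak.
    by rewrite clip_id// subrr expr0n.
  have mF (k : nat) : measurable_fun setT (fun s => (a s - clip k%:R (a s)) ^+ 2).
    by apply: measurable_funX; exact: measurable_funB.
  have dom (k : nat) s : `|(a s - clip k%:R (a s)) ^+ 2| <= a s ^+ 2.
    rewrite ger0_norm ?sqr_ge0// -(real_normK (num_real (a s - _))).
    by rewrite -(real_normK (num_real (a s))) ler_sqr ?nnegrE// clip_dist.
  have := Rdominated_cvg mF cF ha.2 dom.
  rewrite Rintegral_cst// mul0r => /cvgrPdist_le/(_ (e/4)).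
  case; first by rewrite divr_gt0.
  move=> k _ /(_ k (leqnn k)) /=; rewrite sub0r normrN => h.
  exists k; apply: le_trans h; apply: le_trans (ler_norm _).
  by rewrite sqnER.
pose ak x := clip k%:R (a x).
have iak := supp_integrable (hclip k) (sclip k).
pose I := `]-T, T[%classic : set mR.
have mI : measurable I by exact: measurable_itv.
have muI : (mu I < +oo)%E.
  have := @lebesgue_measure_itv R `]- T, T[; rewrite /I => -> /=.
  by case: ifP => _; rewrite ltry.
have iI : mu.-integrable I (EFin \o ak) by exact: integrableS iak.
have [g [cg ig]] := approximation_continuous_integrable mI muI iI.
have e2 : 0 < e / (8 * k.+1%:R) by rewrite divr_gt0// mulr_gt0.
move=> /fine_cvgP[_ /cvgrPdist_le/(_ _ e2)] [n _ /(_ n (leqnn n))] /=.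
rewrite sub0r normrN => gn.
pose b t := clip k%:R (g n t).
have cb : continuous b.
  move=> t; apply: (@cvg_comp _ _ _ (g n) (clip k%:R)); first exact: cg.
  exact: clip_continuous.
exists b => //.
have mb : measurable_fun setT b by exact: continuous_measurable_fun.
have hcb := sqint_chi_continuous T0 cb.
have hak := hclip k.
have h1 : sqint (a \- ak) by exact: sqintB.
have h2 : sqint (ak \- (fun t => chi_itv T t * b t)) by exact: sqintB.
have sum2 : sqn (a \- (fun t => chi_itv T t * b t)) <=
    2 * sqn (a \- ak) + 2 * sqn (ak \- (fun t => chi_itv T t * b t)).
  have -> : a \- (fun t => chi_itv T t * b t) =
    (a \- ak) \+ (ak \- (fun t => chi_itv T t * b t)).
    by apply/funext => t /=; rewrite addrA subrK.
  by rewrite sqnD//; have := dot_le h1 h2; lra.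
have ak_b : sqn (ak \- (fun t => chi_itv T t * b t)) <= e / 4.
  have igd : mu.-integrable I (EFin \o (fun t => `|ak t - g n t|)).
    have := integrable_norm (integrableB mI iI (ig n)); exact.
  rewrite -lee_fin sqnE//.
  have -> : (\int[mu]_x ((ak \- (fun t => chi_itv T t * b t)) x ^+ 2)%:E =
      \int[mu]_(x in I) ((ak x - b x) ^+ 2)%:E)%E.
    rewrite [RHS]integral_mkcond; apply: eq_integral => x _; rewrite patchE.
    case: ifPn => xI; first by rewrite /= chi_itv1 ?mul1r//; move: xI; rewrite inE.
    by move: xI; rewrite notin_setE => xI /=; rewrite /ak sa// clip0 chi_itv0// mul0r subr0 expr0n.
  apply: (@le_trans _ _ (\int[mu]_(x in I) ((2 * k%:R)%:E * `|(ak x - g n x)%:E|))%E).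
    apply: ge0_le_integral => //.
    - by move=> x _; rewrite lee_fin sqr_ge0.
    - apply/measurable_EFinP; apply: measurable_funTS; apply: measurable_funX.
      exact: measurable_funB (mclip k) mb.
    - by apply: measurable_funeM; exact: (measurable_int mu igd).
    move=> x _; rewrite -EFinM lee_fin -(real_normK (num_real (ak x - b x))) expr2.
    apply: ler_pM => //; last first.
      by rewrite -[in leLHS](@clip_id k%:R (ak x)) ?clip_le//; exact: clip_lip.
    rewrite (le_trans (ler_normB _ _))// mulr_natl mulr2n; apply: lerD.
      exact: clip_le.
    exact: clip_le.
  rewrite ge0_integralZl//; last exact: (measurable_int mu igd).
  have fI : (\int[mu]_(x in I) `|(ak x - g n x)%:E|)%E \is a fin_num.
    exact: (integrable_fin_num mI igd).
  rewrite -(fineK fI) -EFinM lee_fin.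
  apply: (@le_trans _ _ (2 * k%:R * (e / (8 * k.+1%:R)))).
    by rewrite ler_wpM2l ?mulr_ge0// (le_trans _ gn)// ler_norm.
  have -> : 2 * k%:R * (e / (8 * k.+1%:R)) = e / 4 * (k%:R / k.+1%:R) by field.
  have e40 : 0 <= e / 4 by rewrite divr_ge0// ltW.
  by apply: ler_piMr => //; rewrite ler_pdivrMr// mul1r ler_nat.
by rewrite (le_trans sum2)//; move: kP ak_b; rewrite -/ak; clear; lra.
Qed.

Lemma sqr_add_le (eta x y : R) : 0 < eta ->
  (x + y) ^+ 2 <= (1 + eta) * x ^+ 2 + (1 + eta^-1) * y ^+ 2.
Proof.
move=> e0; have h := sqr_ge0 (eta * x - y).
have ei : eta * eta^-1 = 1 by rewrite mulfV// gt_eqF.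
rewrite -subr_ge0 -(pmulr_rge0 _ e0).
have -> : eta * ((1 + eta) * x ^+ 2 + (1 + eta^-1) * y ^+ 2 - (x + y) ^+ 2) =
  (eta * x - y) ^+ 2 + (eta * eta^-1 - 1) * y ^+ 2 by ring.
by rewrite ei subrr mul0r addr0.
Qed.

Lemma energy_add_le T a b eta x : 0 < eta -> sqint a -> supp T a ->
  sqint b -> supp T b ->
  energy (a \+ b) x <= (1 + eta) * energy a x + (1 + eta^-1) * energy b x.
Proof.
move=> eta0 ha sa hb sb.
have ia := supp_integrable ha sa; have ib := supp_integrable hb sb.
rewrite /energy /ct /st (trigtD _ trig_cos ia ib) (trigtD _ trig_sin ia ib).
have := sqr_add_le (trigt cos a x) (trigt cos b x) eta0.
have := sqr_add_le (trigt sin a x) (trigt sin b x) eta0.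
lra.
Qed.

Lemma sqn_add_le eta a b : 0 < eta -> sqint a -> sqint b ->
  sqn (a \+ b) <= (1 + eta) * sqn a + (1 + eta^-1) * sqn b.
Proof.
move=> eta0 ha hb; rewrite !sqnER.
rewrite -(RintegralZl _ measurableT ha.2) -(RintegralZl _ measurableT hb.2).
have i1 := integrableZr_fun (1 + eta) ha.2.
have i2 := integrableZr_fun (1 + eta^-1) hb.2.
rewrite -(RintegralD measurableT i1 i2).
apply: (le_Rintegral measurableT (sqintD ha hb).2 (integrableD_fun i1 i2)) => x _.
exact: sqr_add_le.
Qed.

(** Plancherel's identity on the half-line, for real functions with compact
    support. The bound from above is energy_le; both sides being squares of
    seminorms that are continuous for sqn, equality extends from the dense
    class of continuous_dense, where it is energy_ge_continuous. *)
Theorem plancherel T a : 0 < T -> sqint a -> supp T a ->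
  (\int[mu]_(x in halfline) (energy a x)%:E = (sqn a / 2)%:E)%E.
Proof.
move=> T0 ha sa; apply/eqP; rewrite eq_le (energy_le T0 ha sa) /=.
have E_le := energy_le T0 ha sa.
have Efin : (\int[mu]_(x in halfline) (energy a x)%:E)%E \is a fin_num.
  rewrite ge0_fin_numE; first exact: le_lt_trans E_le (ltry _).
  by apply: integral_ge0 => x _; rewrite lee_fin energy_ge0.
rewrite -(fineK Efin) lee_fin; set E := fine _.
have E0 : 0 <= E by rewrite fine_ge0// integral_ge0// => x _; rewrite lee_fin energy_ge0.
have main eta : 0 < eta -> sqn a / 2 <= (1 + eta) ^+ 2 * E + eta.
  move=> eta0.
  pose C := (1 + eta) * (1 + eta^-1) / 2 + (1 + eta^-1) / 2.
  have C0 : 0 < C.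
    by rewrite addr_gt0// ?divr_gt0// ?mulr_gt0// addr_gt0// invr_gt0.
  have [|b cb ab] := continuous_dense T0 (_ : 0 < eta / C) ha sa.
    by rewrite divr_gt0.
  pose d t := chi_itv T t * b t.
  have hd : sqint d by exact: sqint_chi_continuous.
  have sd : supp T d by exact: supp_chi.
  have had := sqintB ha hd; have sad := suppB sa sd.
  have hda := sqintB hd ha; have sda := suppB sd sa.
  have dE : d = a \+ (d \- a) by apply/funext => t /=; rewrite addrC subrK.
  have n1 : sqn a <= (1 + eta) * sqn d + (1 + eta^-1) * sqn (a \- d).
    have := sqn_add_le eta0 hd had; congr (_ <= _).
    by congr sqn; apply/funext => x /=; rewrite addrC subrK.
  have nda : sqn (d \- a) = sqn (a \- d).
    by rewrite !sqnB// (dotC d a); ring.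
  have n2 : sqn d / 2 <= (1 + eta) * E + (1 + eta^-1) * (sqn (a \- d) / 2).
    rewrite -lee_fin (le_trans (energy_ge_continuous T0 cb))//.
    have cE := @continuous_EFin_measurable R halfline _ (energy_continuous ha sa).
    have cE' := @continuous_EFin_measurable R halfline _ (energy_continuous hda sda).
    have p1 : 0 <= 1 + eta by rewrite addr_ge0// ltW.
    have p2 : 0 <= 1 + eta^-1 by rewrite addr_ge0// invr_ge0 ltW.
    apply: (@le_trans _ _ (\int[mu]_(x in halfline) ((1 + eta)%:E * (energy a x)%:E +
        (1 + eta^-1)%:E * (energy (d \- a) x)%:E))%E).
      apply: ge0_le_integral => //.
      - exact: measurable_halfline.
      - by move=> x _; rewrite lee_fin energy_ge0.
      - exact: continuous_EFin_measurable (energy_continuous hd sd).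
      - by apply: emeasurable_funD; exact: measurable_funeM.
      move=> x _; rewrite -!EFinM -EFinD lee_fin.
      by have := energy_add_le x eta0 ha sa hda sda; rewrite -dE.
    rewrite ge0_integralD; last 5 first.
    - exact: measurable_halfline.
    - by move=> x _; rewrite -EFinM lee_fin; apply: mulr_ge0 => //; exact: energy_ge0.
    - exact: measurable_funeM.
    - by move=> x _; rewrite -EFinM lee_fin; apply: mulr_ge0 => //; exact: energy_ge0.
    - exact: measurable_funeM.
    rewrite !ge0_integralZl//; try exact: measurable_halfline;
      try (by move=> x _; rewrite lee_fin energy_ge0).
    rewrite [leRHS]EFinD; apply: leeD.
      by rewrite EFinM fineK.
    rewrite EFinM; apply: lee_wpmul2l; first by rewrite lee_fin.
    by rewrite -nda; exact: energy_le T0 hda sda.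
  have Cab : C * sqn (a \- d) <= eta.
    by have := ab; rewrite ler_pdivlMr// mulrC.
  have h : sqn a / 2 <= (1 + eta) * (sqn d / 2) + (1 + eta^-1) / 2 * sqn (a \- d).
    by move: n1; clear; lra.
  apply: (le_trans h); have p1 : 0 <= 1 + eta by rewrite addr_ge0// ltW.
  apply: le_trans (_ : (1 + eta) * ((1 + eta) * E + (1 + eta^-1) * (sqn (a \- d) / 2)) +
    (1 + eta^-1) / 2 * sqn (a \- d) <= _).
    by rewrite lerD2r ler_wpM2l.
  have -> : (1 + eta) * ((1 + eta) * E + (1 + eta^-1) * (sqn (a \- d) / 2)) +
    (1 + eta^-1) / 2 * sqn (a \- d) = (1 + eta) ^+ 2 * E + C * sqn (a \- d).
    by rewrite /C; ring.
  by rewrite lerD2l.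
apply/ler_addgt0Pr => e e0.
pose eta := Num.min 1 (e / (3 * E + 1)).
have D0 : 0 < 3 * E + 1 by rewrite ltr_pwDr// mulr_ge0.
have eta0 : 0 < eta by rewrite lt_min ltr01 divr_gt0.
have eta1 : eta <= 1 by rewrite ge_min lexx.
have eta2 : eta * (3 * E + 1) <= e.
  by rewrite -ler_pdivlMr// ge_min lexx orbT.
apply: (le_trans (main _ eta0)).
have : eta ^+ 2 * E <= eta * E by rewrite ler_wpM2r// expr2 ler_piMl// ltW.
move: eta2; rewrite sqrrD expr1n mul1r; clear; nra.
Qed.

End plancherel.

(** * Complex square-integrable functions *)

Section complex_L2.
Context {R : realType}.
Local Notation mu := (@lebesgue_measure R).
Local Notation mR := (measurableTypeR R).
Implicit Types (f g h k : R -> R[i]) (T : R).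

Definition re g : R -> R := fun x => complex.Re (g x).
Definition im g : R -> R := fun x => complex.Im (g x).

Definition csq g : Prop := sqint (re g) /\ sqint (im g).
Definition cdot g h : R := dot (re g) (re h) + dot (im g) (im h).
Definition csqn g : R := cdot g g.

Lemma reD g h : re (g \+ h) = re g \+ re h.
Proof. by apply/funext => x; rewrite /re /=; case: (g x); case: (h x). Qed.
Lemma imD g h : im (g \+ h) = im g \+ im h.
Proof. by apply/funext => x; rewrite /im /=; case: (g x); case: (h x). Qed.
Lemma reB g h : re (g \- h) = re g \- re h.
Proof. by apply/funext => x; rewrite /re /=; case: (g x); case: (h x). Qed.
Lemma imB g h : im (g \- h) = im g \- im h.
Proof. by apply/funext => x; rewrite /im /=; case: (g x); case: (h x). Qed.

Lemma csqB g h : csq g -> csq h -> csq (g \- h).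
Proof. by move=> [? ?] [? ?]; rewrite /csq reB imB; split; exact: sqintB. Qed.

Lemma csqnE g : csqn g = sqn (re g) + sqn (im g).
Proof. by []. Qed.

Lemma csqn_ge0 g : 0 <= csqn g.
Proof. by rewrite addr_ge0 ?sqn_ge0. Qed.

Lemma cdotC g h : cdot g h = cdot h g.
Proof. by rewrite /cdot dotC (dotC (im g)). Qed.

Lemma cdotBl f g h : csq f -> csq g -> csq h ->
  cdot (f \- g) h = cdot f h - cdot g h.
Proof.
by move=> [? ?] [? ?] [? ?]; rewrite /cdot reB imB !dotBl//; ring.
Qed.

Lemma csqnB g h : csq g -> csq h ->
  csqn (g \- h) = csqn g - 2 * cdot g h + csqn h.
Proof.
by move=> [? ?] [? ?]; rewrite !csqnE reB imB !sqnB// /cdot; ring.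
Qed.

Lemma csqnD g h : csq g -> csq h ->
  csqn (g \+ h) = csqn g + 2 * cdot g h + csqn h.
Proof.
by move=> [? ?] [? ?]; rewrite !csqnE reD imD !sqnD// /cdot; ring.
Qed.

Lemma csqn_sub_sym g h : csq g -> csq h -> csqn (g \- h) = csqn (h \- g).
Proof. by move=> hg hh; rewrite !csqnB// (cdotC h g); ring. Qed.

Lemma csqn_triangle f g h : csq f -> csq g -> csq h ->
  csqn (f \- h) <= 2 * csqn (f \- g) + 2 * csqn (g \- h).
Proof.
move=> hf hg hh; have h1 := csqB hf hg; have h2 := csqB hg hh.
have -> : f \- h = (f \- g) \+ (g \- h).
  by apply/funext => x /=; rewrite addrA subrK.
rewrite csqnD//; have := csqn_ge0 ((f \- g) \- (g \- h)); rewrite csqnB//; lra.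
Qed.

Lemma add_mul_sqr_le (p q r s : R) (P Q U V : R) : 0 <= P -> 0 <= Q -> 0 <= U -> 0 <= V ->
  p ^+ 2 <= P * Q -> q ^+ 2 <= U * V -> (p + q) ^+ 2 <= (P + U) * (Q + V).
Proof.
move=> P0 Q0 U0 V0 hp hq.
suff : 2 * (p * q) <= P * V + U * Q by move: hp hq; clear; nra.
have h1 : (p * q) ^+ 2 <= (P * V) * (U * Q).
  rewrite exprMn (le_trans (ler_pM (sqr_ge0 _) (sqr_ge0 _) hp hq))//.
  by rewrite le_eqVlt; apply/orP; left; apply/eqP; ring.
have PV : 0 <= P * V by rewrite mulr_ge0.
have UQ : 0 <= U * Q by rewrite mulr_ge0.
have h2 : (2 * (p * q)) ^+ 2 <= (P * V + U * Q) ^+ 2.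
  by have := sqr_ge0 (P * V - U * Q); move: h1; clear; nra.
have [pq|pq] := leP 0 (p * q); last by move: pq PV UQ; clear; lra.
by rewrite -ler_sqr ?nnegrE ?addr_ge0// mulr_ge0.
Qed.

Lemma cdot_sqr_le g h : csq g -> csq h -> cdot g h ^+ 2 <= csqn g * csqn h.
Proof.
move=> [g1 g2] [h1 h2]; rewrite !csqnE /cdot.
by apply: (add_mul_sqr_le 0 0); rewrite ?sqn_ge0//; exact: dot_sqr_le.
Qed.

Lemma csqn0_cdot g h k : csq g -> csq h -> csq k -> csqn (g \- h) = 0 ->
  cdot g k = cdot h k.
Proof.
move=> hg hh hk e; have := cdot_sqr_le (csqB hg hh) hk.
rewrite e mul0r cdotBl// => le0; apply/eqP; rewrite -subr_eq0 -sqrf_eq0.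
by rewrite eq_le le0 sqr_ge0.
Qed.

Lemma csqn0_csqn g h : csq g -> csq h -> csqn (g \- h) = 0 -> csqn g = csqn h.
Proof.
move=> hg hh e; rewrite /csqn (csqn0_cdot hg hh hg e) cdotC.
exact: csqn0_cdot.
Qed.

Lemma sqr_cvg0 (x eps : nat -> R) : (forall n, x n ^+ 2 <= eps n) ->
  eps n @[n --> \oo] --> 0 -> x n @[n --> \oo] --> 0.
Proof.
move=> xe e0; apply/cvgrPdist_le => e ee.
have e2 : 0 < e ^+ 2 by rewrite exprn_gt0.
move/cvgrPdist_le/(_ _ e2) : e0; apply: filterS => n; rewrite !sub0r !normrN => h.
rewrite -ler_sqr ?nnegrE//; last exact: ltW.
by rewrite real_normK ?num_real// (le_trans (xe n))// (le_trans _ h)// ler_norm.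
Qed.

Definition cvg2 (u : nat -> R -> R[i]) h := csqn (u n \- h) @[n --> \oo] --> (0:R).

Lemma cvg2_cdot u h k : (forall n, csq (u n)) -> csq h -> csq k ->
  cvg2 u h -> cdot (u n) k @[n --> \oo] --> cdot h k.
Proof.
move=> hu hh hk uh.
have c : cdot (u n) k - cdot h k @[n --> \oo] --> (0:R).
  apply: (@sqr_cvg0 _ (fun n => csqn (u n \- h) * csqn k)).
    by move=> n /=; rewrite -cdotBl//; apply: cdot_sqr_le => //; exact: csqB.
  rewrite -[X in _ --> X](mul0r (csqn k)); apply: cvgM => //; exact: cvg_cst.
exact/subr_cvg0.
Qed.

Lemma cvg2_csqn u h : (forall n, csq (u n)) -> csq h ->
  cvg2 u h -> csqn (u n) @[n --> \oo] --> csqn h.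
Proof.
move=> hu hh uh.
have -> : (fun n => csqn (u n)) =
    (fun n => csqn (u n \- h) + 2 * cdot (u n) h - csqn h).
  by apply/funext => n; rewrite csqnB//; ring.
have E : csqn h = 0 + 2 * cdot h h - csqn h by rewrite /csqn; ring.
rewrite [X in _ --> X]E.
apply: cvgB; last exact: cvg_cst.
apply: cvgD => //; apply: cvgM; [exact: cvg_cst|exact: cvg2_cdot].
Qed.

Lemma cvg2_unique u h h' : (forall n, csq (u n)) -> csq h -> csq h' ->
  cvg2 u h -> cvg2 u h' -> csqn (h \- h') = 0.
Proof.
move=> hu hh hh' c c'; apply/eqP; rewrite eq_le csqn_ge0 andbT.
have c2 : 2 * csqn (u n \- h) + 2 * csqn (u n \- h') @[n --> \oo] --> (0:R).
  rewrite -[X in _ --> X](addr0 0); apply: cvgD;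
  by rewrite -[X in _ --> X](mulr0 2); apply: cvgM => //; exact: cvg_cst.
rewrite -(cvg_lim _ c2)//; apply: limr_ge; first by apply/cvg_ex; eexists; exact: c2.
apply: nearW => n; rewrite (csqn_sub_sym (hu n) hh); exact: csqn_triangle.
Qed.

Lemma csqn_complete (u : nat -> R -> R[i]) : (forall n, csq (u n)) ->
  (forall e, 0 < e -> exists N, forall n m, (N <= n)%N -> (N <= m)%N ->
    csqn (u n \- u m) <= e) ->
  exists h, [/\ csq h, (forall x, (forall n, u n x = 0) -> h x = 0) & cvg2 u h].
Proof.
move=> hu uC.
have small (v : nat -> R -> R) : (forall n m, sqn (v n \- v m) <= csqn (u n \- u m)) ->
    forall e, 0 < e -> exists N, forall n m, (N <= n)%N -> (N <= m)%N ->
    sqn (v n \- v m) <= e.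
  move=> vu e /uC[N NP]; exists N => n m Nn Nm.
  exact: le_trans (vu n m) (NP n m Nn Nm).
have [|a [ha za ca]] := sqn_complete (fun n => (hu n).1) (small _ _).
  by move=> n m; rewrite csqnE reB lerDl sqn_ge0.
have [|b [hb zb cb]] := sqn_complete (fun n => (hu n).2) (small _ _).
  by move=> n m; rewrite csqnE imB lerDr sqn_ge0.
pose h x : R[i] := (a x +i* b x)%C.
have hh : csq h by [].
exists h; split => //.
  move=> x ux0; rewrite /h za ?zb// => n.
    by rewrite /im ux0.
  by rewrite /re ux0.
apply/cvgrPdist_le => e e0; have e20 : 0 < e / 2 by rewrite divr_gt0.
have [N1 P1] := ca _ e20; have [N2 P2] := cb _ e20.
exists (maxn N1 N2) => // n /=; rewrite geq_max => /andP[n1 n2].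
rewrite sub0r normrN ger0_norm ?csqn_ge0// csqnE reB imB (splitr e).
by apply: lerD; [exact: P1|exact: P2].
Qed.

Lemma L2normE g : measurable_fun setT (re g) -> measurable_fun setT (im g) ->
  L2norm g = sqrte (\int[mu]_x (re g x ^+ 2 + im g x ^+ 2)%:E)%E.
Proof.
move=> mr mi; rewrite /L2norm unlock.
have -> : (\int[mu]_x `|(ComplexField.Normc.normc (g x))%:E| `^ 2 =
    \int[mu]_x (re g x ^+ 2 + im g x ^+ 2)%:E)%E.
  apply: eq_integral => x _; rewrite /re /im; case: (g x) => a b /=.
  rewrite ger0_norm ?sqrtr_ge0//.
  set c := a ^+ 2 + b ^+ 2; have c0 : 0 <= c by rewrite addr_ge0 ?sqr_ge0.
  by rewrite (powR_mulrn 2 (sqrtr_ge0 c)) sqr_sqrtr.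
rewrite poweR12_sqrt//; apply: integral_ge0 => x _.
by rewrite lee_fin addr_ge0 ?sqr_ge0.
Qed.

Lemma csqn_int g : csq g ->
  (\int[mu]_x (re g x ^+ 2 + im g x ^+ 2)%:E)%E = (csqn g)%:E.
Proof.
move=> [hr hi]; under eq_integral do rewrite EFinD.
by rewrite (integralD measurableT hr.2 hi.2) csqnE EFinD (sqnE hr) (sqnE hi).
Qed.

Lemma L2norm_csq g : csq g -> L2norm g = (Num.sqrt (csqn g))%:E.
Proof.
move=> hg; rewrite L2normE ?csqn_int//.
  exact: sqint_meas hg.1.
exact: sqint_meas hg.2.
Qed.

Lemma L2_csq E g : L2 E g <-> csq g /\ (forall x, ~ E x -> g x = 0).
Proof.
split; last first.
  move=> [hg sg]; split => //; [exact: sqint_meas hg.1|exact: sqint_meas hg.2|].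
  by rewrite L2norm_csq// ltry.
move=> [mr mi lt sg]; split => //.
have fin : (\int[mu]_x (re g x ^+ 2 + im g x ^+ 2)%:E < +oo)%E.
  move: lt; rewrite L2normE//; case: (\int[_]_x _)%E => //= r _; exact: ltry.
have bnd (a : R -> R) : measurable_fun setT a ->
    (forall x, a x ^+ 2 <= re g x ^+ 2 + im g x ^+ 2) -> sqint a.
  move=> ma ag; apply: sqint_sqn => //; apply: le_lt_trans fin.
  apply: ge0_le_integral => //.
  - by move=> x _; rewrite lee_fin sqr_ge0.
  - by apply/measurable_EFinP/measurable_funX.
  - by apply/measurable_EFinP/measurable_funD; exact: measurable_funX.
  - by move=> x _; rewrite lee_fin.
split; apply: bnd => // x; rewrite ?lerDl ?lerDr ?sqr_ge0//.
Qed.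

End complex_L2.

(** * Fourier transform of compactly supported functions *)

Section fourier_compact.
Context {R : realType}.
Local Notation mu := (@lebesgue_measure R).
Local Notation mR := (measurableTypeR R).
Implicit Types (f g h k : R -> R[i]) (a b : R -> R) (T : R).

Definition csupp T g : Prop := forall x, ~ (`]- T, T[%classic x) -> g x = 0.

Lemma csuppP T g : csupp T g -> supp T (re g) /\ supp T (im g).
Proof. by move=> sg; split=> x /sg; rewrite /re /im => ->. Qed.

Lemma csuppB T g h : csupp T g -> csupp T h -> csupp T (g \- h).
Proof. by move=> sg sh x xT /=; rewrite sg// sh// subr0. Qed.

Lemma csupp_le T T' g : T <= T' -> csupp T g -> csupp T' g.
Proof.
move=> TT sg x xT; apply: sg => /=; rewrite in_itv/= => /andP[xT1 xT2].
by apply: xT; rewrite /= in_itv/= (le_lt_trans _ xT1) ?lerN2//= (lt_le_trans xT2).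
Qed.

Definition ft g : R -> R[i] := fun t =>
  ((ct (re g) t + st (im g) t) +i* (ct (im g) t - st (re g) t))%C.

(** The inverse transform of g, that is, the transform followed by t |-> - t,
    written out so as to avoid integrability side conditions. *)
Definition ift g : R -> R[i] := fun t =>
  ((ct (re g) t - st (im g) t) +i* (ct (im g) t + st (re g) t))%C.

Lemma continuousD_fun a b : continuous a -> continuous b -> continuous (a \+ b).
Proof. by move=> ca cb x; apply: cvgD; [exact: ca|exact: cb]. Qed.

Lemma continuousB_fun a b : continuous a -> continuous b -> continuous (a \- b).
Proof. by move=> ca cb x; apply: cvgB; [exact: ca|exact: cb]. Qed.

(** Folding the line at the origin: the transform of a real function satisfies
    |f(-x)| = |f(x)|, so that half-line statements suffice for real data. *)
Lemma ge0_integral_fold (f : R -> R) : measurable_fun setT f ->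
  (forall x, 0 <= f x) ->
  (\int[mu]_x (f x)%:E = \int[mu]_(x in halfline) (f x + f (- x))%:E)%E.
Proof.
move=> mf f0.
have mf' : measurable_fun [set: R] (fun x : R => (f x)%:E) by exact/measurable_EFinP.
have mN : measurable_fun setT (fun x : R => f (- x)).
  by apply: (@measurableT_comp _ _ _ _ _ _ f) => //; exact: measurable_funN.
have mfN : measurable_fun [set: R] (fun x : R => (f (- x))%:E) by exact/measurable_EFinP.
have -> : (setT : set mR) = `]-oo, (0:R)[%classic `|` `[0, +oo[%classic.
  by apply/seteqP; split => // x _; rewrite /= !in_itv/= andbT; have [|] := ltP x 0; [left|right].
rewrite ge0_integral_setU//; last 3 first.
- exact: measurable_funTS.
- by move=> x _; rewrite lee_fin.
- by apply/disj_setPS => x [/=]; rewrite !in_itv/= andbT => x0 /le_lt_trans/(_ x0); rewrite ltxx.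
under [RHS]eq_integral do rewrite EFinD.
rewrite [RHS]ge0_integralD//; last 5 first.
- exact: measurable_halfline.
- by move=> x _; rewrite lee_fin.
- exact: measurable_funTS.
- by move=> x _; rewrite lee_fin.
- exact: measurable_funTS.
rewrite addeC; congr (_ + _)%E.
have -> : (\int[mu]_(x in `]-oo, 0%R[) (f x)%:E =
           \int[mu]_(x in `]-oo, 0%R]) (f x)%:E)%E.
  by apply: integral_itv_bndo_bndc; exact: measurable_funTS.
rewrite (@ge0_integration_by_substitution0 R (fun x => (f (- x))%:E))//; last first.
  by move=> x; rewrite lee_fin.
by apply: eq_integral => x _; rewrite opprK.
Qed.

Section one_function.
Variables (T : R) (g : R -> R[i]).
Hypotheses (T0 : 0 < T) (hg : csq g) (sg : csupp T g).

Let sre : supp T (re g). Proof. by have [] := csuppP sg. Qed.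
Let sim : supp T (im g). Proof. by have [] := csuppP sg. Qed.
Let ire : mu.-integrable setT (EFin \o re g).
Proof. exact: supp_integrable hg.1 sre. Qed.
Let iim : mu.-integrable setT (EFin \o im g).
Proof. exact: supp_integrable hg.2 sim. Qed.

Lemma ft_continuous : continuous (re (ft g)) /\ continuous (im (ft g)).
Proof.
split.
  exact: continuousD_fun (ct_continuous hg.1 sre) (st_continuous hg.2 sim).
exact: continuousB_fun (ct_continuous hg.2 sim) (st_continuous hg.1 sre).
Qed.

Lemma ift_continuous : continuous (re (ift g)) /\ continuous (im (ift g)).
Proof.
split.
  exact: continuousB_fun (ct_continuous hg.1 sre) (st_continuous hg.2 sim).
exact: continuousD_fun (ct_continuous hg.2 sim) (st_continuous hg.1 sre).
Qed.

Definition cenergy g x : R := energy (re g) x + energy (im g) x.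

Lemma ft_fold x : re (ft g) x ^+ 2 + im (ft g) x ^+ 2 +
  (re (ft g) (- x) ^+ 2 + im (ft g) (- x) ^+ 2) = 2 * cenergy g x.
Proof. by rewrite /re /im /ft /= !ctN !stN// /cenergy /energy; ring. Qed.

Lemma cenergy_ge0 x : 0 <= cenergy g x.
Proof. by rewrite addr_ge0 ?energy_ge0. Qed.

Lemma cenergy_continuous : continuous (cenergy g).
Proof.
exact: continuousD_fun (energy_continuous hg.1 sre) (energy_continuous hg.2 sim).
Qed.

Lemma cenergy_int :
  (\int[mu]_(x in halfline) (2 * cenergy g x)%:E = (csqn g)%:E)%E.
Proof.
have mE := @continuous_EFin_measurable R halfline _ (energy_continuous hg.1 sre).
have mE' := @continuous_EFin_measurable R halfline _ (energy_continuous hg.2 sim).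
under eq_integral do rewrite EFinM.
rewrite ge0_integralZl//; last 3 first.
- exact: measurable_halfline.
- exact: (@continuous_EFin_measurable R halfline _ cenergy_continuous).
- by move=> x _; rewrite lee_fin cenergy_ge0.
under eq_integral do rewrite EFinD.
rewrite ge0_integralD//; last 3 first.
- exact: measurable_halfline.
- by move=> x _; rewrite lee_fin energy_ge0.
- by move=> x _; rewrite lee_fin energy_ge0.
rewrite (plancherel T0 hg.1 sre) (plancherel T0 hg.2 sim).
by rewrite -EFinD -EFinM csqnE; congr EFin; field.
Qed.

Lemma ft_sqr_int (a : R -> R) : measurable_fun setT a -> (forall x, 0 <= a x) ->
  (forall x, a x + a (- x) = 2 * cenergy g x) ->
  (\int[mu]_x (a x)%:E = (csqn g)%:E)%E.
Proof.
move=> ma a0 aE; rewrite ge0_integral_fold// -cenergy_int.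
by apply: eq_integral => x _; rewrite aE.
Qed.

Lemma csq_csqn_cont (h : R -> R[i]) : continuous (re h) -> continuous (im h) ->
  (forall x, re h x ^+ 2 + im h x ^+ 2 + (re h (- x) ^+ 2 + im h (- x) ^+ 2) =
    2 * cenergy g x) -> csq h /\ csqn h = csqn g.
Proof.
move=> cr ci hE.
have mr := continuous_measurable_fun cr; have mi := continuous_measurable_fun ci.
have I : (\int[mu]_x (re h x ^+ 2 + im h x ^+ 2)%:E = (csqn g)%:E)%E.
  apply: ft_sqr_int => //.
    by apply: measurable_funD; exact: measurable_funX.
  by move=> x; rewrite addr_ge0 ?sqr_ge0.
have hh : csq h.
  suff /L2_csq[] : L2 setT h by [].
  split; [exact: mr|exact: mi| |by move=> x nx; case: nx].
  by rewrite L2normE// I/= ltry.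
split => //; apply: EFin_inj; rewrite -I csqn_int//.
Qed.

Lemma ft_csqn : csq (ft g) /\ csqn (ft g) = csqn g.
Proof.
by apply: csq_csqn_cont => [||x]; [exact: ft_continuous.1|exact: ft_continuous.2|
  exact: ft_fold].
Qed.

Lemma ift_csqn : csq (ift g) /\ csqn (ift g) = csqn g.
Proof.
apply: csq_csqn_cont => [||x]; [exact: ift_continuous.1|exact: ift_continuous.2|].
by rewrite /re /im /ift /= !ctN !stN// /cenergy /energy; ring.
Qed.

End one_function.

Lemma ftB T g h : csq g -> csupp T g -> csq h -> csupp T h ->
  ft (g \- h) = ft g \- ft h.
Proof.
move=> [g1 g2] /csuppP[s1 s2] [h1 h2] /csuppP[r1 r2].
have i1 := supp_integrable g1 s1; have i2 := supp_integrable g2 s2.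
have j1 := supp_integrable h1 r1; have j2 := supp_integrable h2 r2.
apply/funext => x; rewrite /ft reB imB /ct /st.
rewrite (trigtB _ trig_cos i1 j1) (trigtB _ trig_cos i2 j2).
rewrite (trigtB _ trig_sin i1 j1) (trigtB _ trig_sin i2 j2).
by apply/eqP; rewrite eq_complex /=; apply/andP; split; apply/eqP; ring.
Qed.

Lemma iftB T g h : csq g -> csupp T g -> csq h -> csupp T h ->
  ift (g \- h) = ift g \- ift h.
Proof.
move=> [g1 g2] /csuppP[s1 s2] [h1 h2] /csuppP[r1 r2].
have i1 := supp_integrable g1 s1; have i2 := supp_integrable g2 s2.
have j1 := supp_integrable h1 r1; have j2 := supp_integrable h2 r2.
apply/funext => x; rewrite /ift reB imB /ct /st.
rewrite (trigtB _ trig_cos i1 j1) (trigtB _ trig_cos i2 j2).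
rewrite (trigtB _ trig_sin i1 j1) (trigtB _ trig_sin i2 j2).
by apply/eqP; rewrite eq_complex /=; apply/andP; split; apply/eqP; ring.
Qed.

Lemma cdot_ft T g h : 0 < T -> csq g -> csupp T g -> csq h -> csupp T h ->
  cdot (ft g) (ft h) = cdot g h.
Proof.
move=> T0 hg sg hh sh.
have [a1 e1] := ft_csqn T0 hg sg; have [a2 e2] := ft_csqn T0 hh sh.
have [a3 e3] := ft_csqn T0 (csqB hg hh) (csuppB sg sh).
move: e3; rewrite (ftB hg sg hh sh) (csqnB a1 a2) (csqnB hg hh) e1 e2.
by move=> /addIr/addrI/oppr_inj/mulfI; apply; rewrite pnatr_eq0.
Qed.

Lemma cdot_ift T g h : 0 < T -> csq g -> csupp T g -> csq h -> csupp T h ->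
  cdot (ift g) (ift h) = cdot g h.
Proof.
move=> T0 hg sg hh sh.
have [a1 e1] := ift_csqn T0 hg sg; have [a2 e2] := ift_csqn T0 hh sh.
have [a3 e3] := ift_csqn T0 (csqB hg hh) (csuppB sg sh).
move: e3; rewrite (iftB hg sg hh sh) (csqnB a1 a2) (csqnB hg hh) e1 e2.
by move=> /addIr/addrI/oppr_inj/mulfI; apply; rewrite pnatr_eq0.
Qed.

Lemma trigt_sym phi a b : trig_like phi ->
  mu.-integrable setT (EFin \o a) -> mu.-integrable setT (EFin \o b) ->
  dot (trigt phi a) b = dot a (trigt phi b).
Proof.
move=> tphi ia ib.
have bk (x y : R) : `|phi (x * y)| <= 1 := tphi.2 _.
have [E i1] := fubini_bdd ib ia (meas2_trig tphi) bk.
have [_ i2] := fubini_bdd ia ib (meas2_trig tphi) bk.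
transitivity (c0 * \int[mu]_x (b x * \int[mu]_y (a y * phi (x * y)))).
  rewrite -(RintegralZl c0 measurableT i1); apply: eq_Rintegral => x _.
  rewrite /trigt -mulrA; apply: (congr1 ( *%R c0)).
  rewrite mulrC; apply: (congr1 ( *%R (b x))).
  by apply: eq_Rintegral => y _; rewrite (mulrC y).
rewrite E.
have F y : \int[mu]_x (b x * phi (x * y)) = \int[mu]_x (b x * phi (y * x)).
  by apply: eq_Rintegral => x _; rewrite (mulrC x).
have -> : \int[mu]_y (a y * \int[mu]_x (b x * phi (x * y))) =
  \int[mu]_y (a y * \int[mu]_x (b x * phi (y * x))).
  by apply: eq_Rintegral => y _; rewrite F.
rewrite -(RintegralZl c0 measurableT i2); apply: eq_Rintegral => y _.
by rewrite -F /trigt mulrCA.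
Qed.

Lemma sqint_trigt T a : 0 < T -> sqint a -> supp T a ->
  sqint (ct a) /\ sqint (st a).
Proof.
move=> T0 ha sa; have ia := supp_integrable ha sa.
have cE := energy_continuous ha sa.
have I : (\int[mu]_x (energy a x)%:E < +oo)%E.
  rewrite ge0_integral_fold//; last by move=> x; exact: energy_ge0.
    have -> : (\int[mu]_(x in halfline) (energy a x + energy a (- x))%:E =
        \int[mu]_(x in halfline) (2%:E * (energy a x)%:E))%E.
      apply: eq_integral => x _; rewrite -EFinM /energy ctN stN// sqrrN.
      by congr EFin; ring.
    rewrite ge0_integralZl//.
    - by rewrite (plancherel T0 ha sa) -EFinM ltry.
    - exact: measurable_halfline.
    - exact: (@continuous_EFin_measurable R halfline _ cE).
    - by move=> x _; rewrite lee_fin energy_ge0.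
  exact: continuous_measurable_fun.
have bnd (b : R -> R) : continuous b -> (forall x, b x ^+ 2 <= energy a x) -> sqint b.
  move=> cb ba; have mb := continuous_measurable_fun cb.
  apply: sqint_sqn => //; apply: le_lt_trans I; apply: ge0_le_integral => //.
  - by move=> x _; rewrite lee_fin sqr_ge0.
  - by apply/measurable_EFinP/measurable_funX.
  - by apply/measurable_EFinP; exact: continuous_measurable_fun.
  - by move=> x _; rewrite lee_fin.
split; apply: bnd => [|x].
- exact: ct_continuous ha sa.
- by rewrite lerDl sqr_ge0.
- exact: st_continuous ha sa.
- by rewrite lerDr sqr_ge0.
Qed.

(** The adjoint of the transform is its inverse, by exchanging the two integrals. *)
Lemma cdot_ft_ift T g h : 0 < T -> csq g -> csupp T g -> csq h -> csupp T h ->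
  cdot (ft g) h = cdot g (ift h).
Proof.
move=> T0 [g1 g2] /csuppP[s1 s2] [h1 h2] /csuppP[r1 r2].
have i1 := supp_integrable g1 s1; have i2 := supp_integrable g2 s2.
have j1 := supp_integrable h1 r1; have j2 := supp_integrable h2 r2.
have [gc gs] := sqint_trigt T0 g1 s1; have [gc' gs'] := sqint_trigt T0 g2 s2.
have [hc hs] := sqint_trigt T0 h1 r1; have [hc' hs'] := sqint_trigt T0 h2 r2.
transitivity (dot (ct (re g) \+ st (im g)) (re h) +
  dot (ct (im g) \- st (re g)) (im h)); first by [].
transitivity (dot (ct (re h) \- st (im h)) (re g) +
  dot (ct (im h) \+ st (re h)) (im g)); last by rewrite cdotC.
rewrite !dotBl// !dotDl//.
rewrite (trigt_sym trig_cos i1 j1) (trigt_sym trig_cos i2 j2).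
rewrite (trigt_sym trig_sin i2 j1).
rewrite (dotC (trigt cos (re h))) (dotC (trigt sin (im h))) (dotC (trigt cos (im h))) (dotC (trigt sin (re h))).
rewrite -(trigt_sym trig_sin i1 j2).
have E (p q r s : R) : p + q + (r - s) = p - s + (r + q) by ring.
rewrite /st; exact: E.
Qed.

End fourier_compact.

(** * Fourier transform on the whole line *)

Section fourier_L2.
Context {R : realType}.
Local Notation mu := (@lebesgue_measure R).
Local Notation mR := (measurableTypeR R).
Implicit Types (f g h k : R -> R[i]) (a b : R -> R) (T : R) (N : nat).

Definition trunc N g : R -> R[i] := fun x => ((chi_itv N%:R x)%:C * g x)%C.

Lemma re_trunc N g : re (trunc N g) = fun x => chi_itv N%:R x * re g x.
Proof. by apply/funext => x; rewrite /re /trunc; case: (g x) => p q /=; ring. Qed.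

Lemma im_trunc N g : im (trunc N g) = fun x => chi_itv N%:R x * im g x.
Proof. by apply/funext => x; rewrite /im /trunc; case: (g x) => p q /=; ring. Qed.

Lemma csq_trunc N g : csq g -> csq (trunc N g).
Proof.
move=> [? ?]; rewrite /csq re_trunc im_trunc.
by split; apply: sqint_indicM => //; exact: measurable_itv.
Qed.

Lemma csupp_trunc N g : csupp N%:R (trunc N g).
Proof. by move=> x xN; rewrite /trunc chi_itv0// mul0r. Qed.

Lemma csupp_truncS N g : csupp N.+1%:R (trunc N g).
Proof. by apply: (@csupp_le _ N%:R N.+1%:R _ _ (@csupp_trunc N g)); rewrite ler_nat. Qed.

Lemma trunc_supp T N g : T <= N%:R -> csupp T g -> trunc N g = g.
Proof.
move=> TN sg; apply/funext => x; rewrite /trunc.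
have [xN|xN] := pselect (`]- N%:R, N%:R[%classic x).
  by rewrite chi_itv1// mul1r.
by rewrite chi_itv0// mul0r; apply/esym/sg => xT; apply: xN; move: xT;
  rewrite /= !in_itv/= => /andP[x1 x2]; rewrite (le_lt_trans _ x1) ?lerN2//= (lt_le_trans x2).
Qed.

Lemma sqn_trunc_cvg a : sqint a ->
  sqn ((fun x => chi_itv N%:R x * a x) \- a) @[N --> \oo] --> (0:R).
Proof.
move=> ha; have ma := sqint_meas ha.
have cF x : ((chi_itv N%:R x * a x) - a x) ^+ 2 @[N --> \oo] --> (0:R).
  apply: cvg_near_cst; apply: filterS (nbhs_infty_ger (`|x| + 1)) => N xN.
  rewrite chi_itv1 ?mul1r ?subrr ?expr0n//.
  have := ler_norm x; have := ler_norm (- x); rewrite normrN.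
  by move=> ? ?; apply/andP; split; move: xN; lra.
have mF N : measurable_fun setT (fun x => ((chi_itv N%:R x * a x) - a x) ^+ 2).
  apply: measurable_funX; apply: measurable_funB => //.
  by apply: measurable_funM => //; exact: chi_itv_meas.
have dom N x : `|((chi_itv N%:R x * a x) - a x) ^+ 2| <= a x ^+ 2.
  rewrite ger0_norm ?sqr_ge0//.
  case: (chi_itv_cases N%:R x) => ->; first by rewrite mul0r sub0r sqrrN.
  by rewrite mul1r subrr expr0n sqr_ge0.
have := Rdominated_cvg mF cF ha.2 dom.
rewrite Rintegral_cst// mul0r.
by under eq_fun do rewrite -sqnER.
Qed.

Lemma trunc_cvg g : csq g -> cvg2 (fun N => trunc N g) g.
Proof.
move=> [hr hi]; rewrite /cvg2.
have -> : (fun N => csqn (trunc N g \- g)) =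
    (fun N => sqn ((fun x => chi_itv N%:R x * re g x) \- re g) +
              sqn ((fun x => chi_itv N%:R x * im g x) \- im g)).
  by apply/funext => N; rewrite csqnE reB imB re_trunc im_trunc.
by rewrite -[X in _ --> X](addr0 0); apply: cvgD; exact: sqn_trunc_cvg.
Qed.

Lemma cvg2_cauchy (u : nat -> R -> R[i]) h : (forall n, csq (u n)) -> csq h ->
  cvg2 u h -> forall e, 0 < e -> exists N, forall n m, (N <= n)%N -> (N <= m)%N ->
    csqn (u n \- u m) <= e.
Proof.
move=> hu hh uh e e0; have e4 : 0 < e / 4 by rewrite divr_gt0.
move/cvgrPdist_le/(_ _ e4) : uh => [N _ NP]; exists N => n m Nn Nm.
have hn : csqn (u n \- h) <= e / 4.
  by have := NP n Nn; rewrite /= sub0r normrN ger0_norm// csqn_ge0.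
have hm : csqn (h \- u m) <= e / 4.
  rewrite csqn_sub_sym//; have := NP m Nm.
  by rewrite /= sub0r normrN ger0_norm// csqn_ge0.
have := csqn_triangle (hu n) hh (hu m).
move: hn hm; set x := csqn _; set y := csqn _; set z := csqn _; clear; lra.
Qed.

Lemma ft_trunc_csq N g : csq g -> csq (ft (trunc N g)).
Proof.
move=> hg; have N0 : (0:R) < N.+1%:R by [].
by have [] := ft_csqn N0 (csq_trunc N hg) (@csupp_truncS N g).
Qed.

Lemma ift_trunc_csq N g : csq g -> csq (ift (trunc N g)).
Proof.
move=> hg; have N0 : (0:R) < N.+1%:R by [].
by have [] := ift_csqn N0 (csq_trunc N hg) (@csupp_truncS N g).
Qed.

Lemma csupp_trunc_max n m g : csupp (maxn n m).+1%:R (trunc n g).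
Proof. by apply: (@csupp_le _ n%:R (maxn n m).+1%:R _ _ (@csupp_trunc n g)); rewrite ler_nat leqW// leq_maxl. Qed.

Lemma ft_trunc_cvg g : csq g -> exists2 h, csq h & cvg2 (fun N => ft (trunc N g)) h.
Proof.
move=> hg.
have [|h [hh _ c]] := @csqn_complete R (fun N => ft (trunc N g)) (fun N => ft_trunc_csq N hg).
  move=> e e0.
  have [N NP] := cvg2_cauchy (fun n => csq_trunc n hg) hg (trunc_cvg hg) e0.
  exists N => n m Nn Nm; have M0 : (0:R) < (maxn n m).+1%:R by [].
  have sn := @csupp_trunc_max n m g.
  have sm : csupp (maxn n m).+1%:R (trunc m g) by rewrite maxnC; exact: csupp_trunc_max.
  rewrite -(ftB (csq_trunc n hg) sn (csq_trunc m hg) sm).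
  have hB := csqB (csq_trunc n hg) (csq_trunc m hg).
  by rewrite (ft_csqn M0 hB (csuppB sn sm)).2; exact: NP.
by exists h.
Qed.

Lemma ift_trunc_cvg g : csq g -> exists2 h, csq h & cvg2 (fun N => ift (trunc N g)) h.
Proof.
move=> hg.
have [|h [hh _ c]] := @csqn_complete R (fun N => ift (trunc N g)) (fun N => ift_trunc_csq N hg).
  move=> e e0.
  have [N NP] := cvg2_cauchy (fun n => csq_trunc n hg) hg (trunc_cvg hg) e0.
  exists N => n m Nn Nm; have M0 : (0:R) < (maxn n m).+1%:R by [].
  have sn := @csupp_trunc_max n m g.
  have sm : csupp (maxn n m).+1%:R (trunc m g) by rewrite maxnC; exact: csupp_trunc_max.
  rewrite -(iftB (csq_trunc n hg) sn (csq_trunc m hg) sm).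
  have hB := csqB (csq_trunc n hg) (csq_trunc m hg).
  by rewrite (ift_csqn M0 hB (csuppB sn sm)).2; exact: NP.
by exists h.
Qed.

Lemma ft_truncE N g t : csq g ->
  (Num.sqrt (2 * pi))^-1%:C%C *
    cintegral `]- N%:R, N%:R[ (fun xi => g xi * cexp (0 -i* (xi * t))%C) =
  ft (trunc N g) t.
Proof.
move=> hg; have hN := csq_trunc N hg; have [sr si] := csuppP (@csupp_trunc N g).
have ir := supp_integrable hN.1 sr; have ii := supp_integrable hN.2 si.
have ec (xi : R) : cexp (0 -i* (xi * t))%C = (cos (xi * t) -i* sin (xi * t))%C.
  by rewrite /cexp /= expR0 cosN sinN mul1r.
have prodE xi : g xi * cexp (0 -i* (xi * t))%C =
    ((re g xi * cos (xi * t) + im g xi * sin (xi * t)) +i*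
     (im g xi * cos (xi * t) - re g xi * sin (xi * t)))%C.
  rewrite ec /re /im; case: (g xi) => p q /=.
  by apply/eqP; rewrite eq_complex /=; apply/andP; split; apply/eqP; ring.
have rI (a b : R -> R) : \int[mu]_(x in `]- N%:R, N%:R[) (a x) =
    \int[mu]_x (chi_itv N%:R x * a x).
  rewrite Rintegral_mkcond; apply: eq_Rintegral => x _.
  by rewrite /chi_itv indicE patchE; case: ifP => _; rewrite ?mul1r ?mul0r.
have jr := trig_integrable t trig_cos ir; have ji := trig_integrable t trig_cos ii.
have kr := trig_integrable t trig_sin ir; have ki := trig_integrable t trig_sin ii.
rewrite /cintegral.
have -> : \int[mu]_(x in `]- N%:R, N%:R[) complex.Re (g x * cexp (0 -i* (x * t))%C) =
    \int[mu]_x (re (trunc N g) x * cos (x * t)) + \int[mu]_x (im (trunc N g) x * sin (x * t)).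
  rewrite -(RintegralD measurableT jr ki) (rI _ (fun=> 0)); apply: eq_Rintegral => x _.
  by rewrite prodE re_trunc im_trunc /=; ring.
have -> : \int[mu]_(x in `]- N%:R, N%:R[) complex.Im (g x * cexp (0 -i* (x * t))%C) =
    \int[mu]_x (im (trunc N g) x * cos (x * t)) - \int[mu]_x (re (trunc N g) x * sin (x * t)).
  rewrite -(RintegralB measurableT ji kr) (rI _ (fun=> 0)); apply: eq_Rintegral => x _.
  by rewrite prodE re_trunc im_trunc /=; ring.
rewrite /ft /ct /st /trigt -/c0.
apply/eqP; rewrite eq_complex /=; apply/andP; split; apply/eqP; ring.
Qed.

Lemma sqrt_cvg0 (T' : Type) (F : set_system T') {FF : Filter F} (v : T' -> R) :
  v t @[t --> F] --> (0:R) -> (Num.sqrt (v t))%:E @[t --> F] --> 0%E.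
Proof.
move=> v0; apply: cvg_EFin; first exact: nearW.
rewrite -[X in _ --> X](@sqrtr0 R).
have := @continuous_cvg _ _ _ F FF v (@Num.sqrt R) 0; apply => //.
exact: sqrt_continuous.
Qed.

Lemma sqrt_cvg0_inv (T' : Type) (F : set_system T') {FF : Filter F} (v : T' -> R) :
  (forall t, 0 <= v t) ->
  (Num.sqrt (v t))%:E @[t --> F] --> 0%E -> v t @[t --> F] --> (0:R).
Proof.
move=> v0 /fine_cvg /= h.
have -> : v = fun t => Num.sqrt (v t) * Num.sqrt (v t).
  by apply/funext => t; rewrite -expr2 sqr_sqrtr.
by rewrite -[X in _ --> X](mul0r 0); apply: cvgM; exact: h.
Qed.

(** L2lim only picks some representative; one known limit makes the chosen value
    a limit as well. *)
Lemma L2lim_csq E (T' : Type) (F : set_system T') {FF : Filter F}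
    (u : T' -> R -> R[i]) h :
  (\forall t \near F, csq (u t)) -> csq h -> (forall x, ~ E x -> h x = 0) ->
  csqn (u t \- h) @[t --> F] --> (0:R) ->
  [/\ csq (L2lim E F u), (forall x, ~ E x -> L2lim E F u x = 0) &
      csqn (u t \- L2lim E F u) @[t --> F] --> (0:R)].
Proof.
move=> hu hh sh uh.
have E2 k : csq k -> \forall t \near F,
    (Num.sqrt (csqn (u t \- k)))%:E = L2norm (fun x => u t x - k x).
  by move=> hk; apply: filterS hu => t ht; rewrite -L2norm_csq//; exact: csqB.
have : is_L2lim E F u (L2lim E F u).
  apply: (xgetPex (fun=> 0)); exists h; split; first exact/L2_csq.
  apply: (cvg_trans (near_eq_cvg (E2 h hh))); exact: sqrt_cvg0.
move=> [/L2_csq[hl sl] c]; split => //.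
apply: sqrt_cvg0_inv; first by move=> t; exact: csqn_ge0.
have E3 : \forall t \near F, L2norm (fun x => u t x - L2lim E F u x) =
    (Num.sqrt (csqn (u t \- L2lim E F u)))%:E.
  by apply: filterS (E2 _ hl) => t ->.
exact: (cvg_trans (near_eq_cvg E3) c).
Qed.

Lemma fourier_spec g : csq g ->
  csq (fourier g) /\ cvg2 (fun N => ft (trunc N g)) (fourier g).
Proof.
move=> hg; have [h hh c] := ft_trunc_cvg hg.
have uE : (fun (N : nat) t => (Num.sqrt (2 * pi))^-1%:C%C *
    cintegral `]- N%:R, N%:R[ (fun xi => g xi * cexp (0 -i* (xi * t))%C)) =
    (fun N => ft (trunc N g)).
  by apply/funext => N; apply/funext => t; exact: ft_truncE.
have [|||? _ ?] := @L2lim_csq setT _ \oo _ (fun N => ft (trunc N g)) h _ hh.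
- by apply: nearW => N; exact: ft_trunc_csq.
- by move=> x nx; case: nx.
- exact: c.
by rewrite /fourier uE.
Qed.

Lemma cvgr_eq (u : nat -> R) (p q : R) :
  u n @[n --> \oo] --> p -> u n @[n --> \oo] --> q -> p = q.
Proof. by move=> up uq; apply: (@cvg_unique _ _ (u n @[n --> \oo])). Qed.

Lemma cdot_fourier_trunc N g h : csq g -> csq h ->
  cdot (fourier g) (ft (trunc N h)) = cdot g (trunc N h).
Proof.
move=> hg hh; have [hf fc] := fourier_spec hg.
have c1 := cvg2_cdot (fun M => ft_trunc_csq M hg) hf (ft_trunc_csq N hh) fc.
have c2 := cvg2_cdot (fun M => csq_trunc M hg) hg (csq_trunc N hh) (trunc_cvg hg).
apply: (cvgr_eq c1).
have -> : (fun M => cdot (ft (trunc M g)) (ft (trunc N h))) =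
    (fun M => cdot (trunc M g) (trunc N h)); last exact: c2.
apply/funext => M; have M0 : (0:R) < (maxn M N).+1%:R by [].
apply: (cdot_ft M0); [exact: csq_trunc|exact: csupp_trunc_max|exact: csq_trunc|].
by rewrite maxnC; exact: csupp_trunc_max.
Qed.

(** Parseval's identity, passing to the limit in one argument at a time. *)
Lemma cdot_fourier g h : csq g -> csq h -> cdot (fourier g) (fourier h) = cdot g h.
Proof.
move=> hg hh; have [hf fc] := fourier_spec hg; have [hf' fc'] := fourier_spec hh.
rewrite (cdotC (fourier g)) (cdotC g).
have c1 := cvg2_cdot (fun M => ft_trunc_csq M hh) hf' hf fc'.
have c2 := cvg2_cdot (fun M => csq_trunc M hh) hh hg (trunc_cvg hh).
apply: (cvgr_eq c1).
have -> : (fun M => cdot (ft (trunc M h)) (fourier g)) =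
    (fun M => cdot (trunc M h) g); last exact: c2.
by apply/funext => M; rewrite cdotC cdot_fourier_trunc// cdotC.
Qed.

Lemma fourier_csupp T g : 0 < T -> csq g -> csupp T g -> csqn (fourier g \- ft g) = 0.
Proof.
move=> T0 hg sg; have [hf fc] := fourier_spec hg; have [hF _] := ft_csqn T0 hg sg.
apply: (cvg2_unique (fun M => ft_trunc_csq M hg) hf hF fc).
apply: cvg_near_cst; apply: filterS (nbhs_infty_ger T) => N TN.
rewrite (trunc_supp TN sg) /csqn /cdot.
have e0 (a b : R -> R) : a = b -> dot (a \- b) (a \- b) = 0.
  by move=> ->; rewrite -[RHS](dot0l (fun=> 0)); congr dot; apply/funext => x /=; rewrite subrr.
by rewrite reB imB !e0// addr0.
Qed.

(** Surjectivity: the limit of the inverse transforms of the truncations of h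
    has a transform with the same pairing as h against every compactly supported
    function, by moving the transform to the other side twice. *)
Lemma fourier_surj h : csq h -> exists2 G, csq G & csqn (fourier G \- h) = 0.
Proof.
move=> hh; have [G hG Gc] := ift_trunc_cvg hh; exists G => //.
have [hf fc] := fourier_spec hG; have hD := csqB hf hh.
have E N k : csq k -> cdot (fourier G) (trunc N k) = cdot h (trunc N k).
  move=> hk; have hNk := csq_trunc N hk; have hik := ift_trunc_csq N hk.
  have sNk M := @csupp_trunc_max N M k.
  have M0 M : (0:R) < (maxn N M).+1%:R by [].
  transitivity (cdot G (ift (trunc N k))).
    have c1 := cvg2_cdot (fun M => ft_trunc_csq M hG) hf hNk fc.
    have c2 := cvg2_cdot (fun M => csq_trunc M hG) hG hik (trunc_cvg hG).
    apply: (cvgr_eq c1).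
    have -> : (fun M => cdot (ft (trunc M G)) (trunc N k)) =
      (fun M => cdot (trunc M G) (ift (trunc N k))); last exact: c2.
    apply/funext => M; apply: (cdot_ft_ift (M0 M) (csq_trunc M hG) _ hNk (sNk M)).
    by rewrite maxnC; exact: csupp_trunc_max.
  have c1 := cvg2_cdot (fun M => ift_trunc_csq M hh) hG hik Gc.
  have c2 := cvg2_cdot (fun M => csq_trunc M hh) hh hNk (trunc_cvg hh).
  apply: (cvgr_eq c1).
  have -> : (fun M => cdot (ift (trunc M h)) (ift (trunc N k))) =
      (fun M => cdot (trunc M h) (trunc N k)); last exact: c2.
  apply/funext => M; apply: (cdot_ift (M0 M) (csq_trunc M hh) _ hNk (sNk M)).
  by rewrite maxnC; exact: csupp_trunc_max.
have c := cvg2_cdot (fun M => csq_trunc M hD) hD hD (trunc_cvg hD).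
apply: (cvgr_eq c).
have -> : (fun M => cdot (trunc M (fourier G \- h)) (fourier G \- h)) = (fun=> 0);
  last exact: cvg_cst.
apply/funext => M; rewrite cdotC (cdotBl hf hh (csq_trunc M hD)) (E _ _ hD).
exact: subrr.
Qed.

Lemma csqn0_ae g : csq g -> csqn g = 0 -> {ae mu, forall x, g x = 0}.
Proof.
move=> hg g0; have := csqn_int hg; rewrite g0 => I0.
have mg : measurable_fun setT (fun x => (re g x ^+ 2 + im g x ^+ 2)%:E).
  apply/measurable_EFinP; apply: measurable_funD; apply: measurable_funX.
    exact: sqint_meas hg.1.
  exact: sqint_meas hg.2.
have /(ae_eq_integral_abs mu measurableT mg) :
    (\int[mu]_x `|(re g x ^+ 2 + im g x ^+ 2)%:E| = 0)%E.
  rewrite -[RHS]I0; apply: eq_integral => x _.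
  by rewrite gee0_abs// lee_fin addr_ge0 ?sqr_ge0.
apply: filterS => x /(_ I) /= -[] /eqP.
rewrite paddr_eq0 ?sqr_ge0// !sqrf_eq0 /re /im => /andP[/eqP r0 /eqP i0].
by apply/eqP; rewrite eq_complex r0 i0 !eqxx.
Qed.

Lemma ae_csqn0 g : csq g -> {ae mu, forall x, g x = 0} -> csqn g = 0.
Proof.
move=> hg g0; apply: EFin_inj; rewrite -csqn_int//.
rewrite (ae_eq_integral (cst 0)) ?integral0//.
- apply/measurable_EFinP; apply: measurable_funD; apply: measurable_funX.
    exact: sqint_meas hg.1.
  exact: sqint_meas hg.2.
- by move: g0; apply: (@filterS _ _ (ae_filter_ringOfSetsType mu)) => x g0 _; rewrite /re /im g0 /= expr0n /= addr0.
Qed.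

Lemma inv_fourier_spec h : csq h ->
  csq (inv_fourier h) /\ csqn (fourier (inv_fourier h) \- h) = 0.
Proof.
move=> hh; have [G hG G0] := fourier_surj hh.
have : L2 setT (inv_fourier h) /\ fourier (inv_fourier h) = h %[ae mu].
  apply: (@xgetPex _ (fun=> 0) [set g | L2 setT g /\ fourier g = h %[ae mu]]).
  exists G; split; first by apply/L2_csq; split=> // x; case.
  move: (csqn0_ae (csqB (fourier_spec hG).1 hh) G0); apply: (@filterS _ _ (ae_filter_ringOfSetsType mu)) => x /= e _.
  by apply/eqP; rewrite -subr_eq0; apply/eqP.
move=> [/L2_csq[hi _] e]; split; first exact: hi.
apply: ae_csqn0; first exact: csqB (fourier_spec hi).1 hh.
by move: e; apply: (@filterS _ _ (ae_filter_ringOfSetsType mu)) => x /= /(_ I) ->; rewrite subrr.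
Qed.

End fourier_L2.

(** * Operators bounded below and their quadratic forms *)

Section operator_form.
Context {R : realType}.
Local Notation mu := (@lebesgue_measure R).
Local Notation mR := (measurableTypeR R).
Implicit Types (f g h k : R -> R[i]) (a b : R -> R) (T : R) (K : set nat).

(** One direction is the inequality between the square norm of A g and the form,
    the other is the Cauchy-Schwarz inequality. *)
Lemma bounded_below_form (E : set R) (A : (R -> R[i]) -> R -> R[i])
    (q : (R -> R[i]) -> R) (B : R) : 0 < B ->
  (forall g, L2 E g -> [/\ csq (A g), cdot (A g) g = q g & csqn (A g) <= B * q g]) ->
  bounded_below E A <-> exists2 c, 0 < c & forall g, L2 E g -> c * csqn g <= q g.
Proof.
move=> B0 hA; split=> -[c c0 cP].
  exists (c ^+ 2 / B) => [|g hg]; first by rewrite divr_gt0// exprn_gt0.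
  have [hAg _ AB] := hA g hg; have /L2_csq[hg' _] := hg.
  rewrite mulrAC ler_pdivrMr// mulrC (mulrC (q g)); apply: le_trans AB.
  have := cP g hg; rewrite !L2norm_csq// -EFinM lee_fin => cn.
  have c1 : 0 <= c * Num.sqrt (csqn g) by apply: mulr_ge0; [exact: ltW|exact: sqrtr_ge0].
  have := ler_pXn2r (n := 2) isT c1 (sqrtr_ge0 (csqn (A g))).
  by rewrite cn exprMn !sqr_sqrtr ?csqn_ge0// mulrC.
exists c => // g hg; have [hAg Aq _] := hA g hg; have /L2_csq[hg' _] := hg.
rewrite !L2norm_csq// -EFinM lee_fin.
have c1 : 0 <= c * Num.sqrt (csqn g) by apply: mulr_ge0; [exact: ltW|exact: sqrtr_ge0].
rewrite -(ler_pXn2r (n := 2)) ?nnegrE ?sqrtr_ge0// exprMn !sqr_sqrtr ?csqn_ge0//.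
have q1 := cP g hg; have := cdot_sqr_le hAg hg'; rewrite Aq.
have := csqn_ge0 g; have := csqn_ge0 (A g).
move: q1; move: (csqn g) (csqn (A g)) (q g) => x y z xz y0; rewrite le_eqVlt => /orP[/eqP <- _|x0 h].
  by rewrite mulr0.
rewrite -(ler_pM2r x0); apply: le_trans h.
have -> : c ^+ 2 * x * x = (c * x) ^+ 2 by ring.
have cx : 0 <= c * x by apply: mulr_ge0; exact: ltW.
by rewrite ler_pXn2r// nnegrE (le_trans cx).
Qed.

Lemma csq_chi (E : set R) f : measurable (E : set mR) -> csq f -> csq (chi E f).
Proof.
move=> mE [hr hi]; split.
  rewrite (_ : re _ = fun x => \1_E x * re f x); first exact: sqint_indicM.
  by apply/funext => x; rewrite /re /chi; case: (f x) => p r /=; ring.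
rewrite (_ : im _ = fun x => \1_E x * im f x); first exact: sqint_indicM.
by apply/funext => x; rewrite /im /chi; case: (f x) => p r /=; ring.
Qed.

Lemma csqn_chi (E : set R) f : measurable (E : set mR) -> csq f ->
  (csqn (chi E f))%:E = (\int[mu]_x (\1_E x * (re f x ^+ 2 + im f x ^+ 2))%:E)%E.
Proof.
move=> mE hf; rewrite -csqn_int; last exact: csq_chi.
apply: eq_integral => x _; congr EFin; rewrite /re /im /chi indicE.
by case: (f x) => p r /=; case: (x \in E) => /=; ring.
Qed.

Lemma csqn_chi_le (E : set R) f : measurable (E : set mR) -> csq f ->
  csqn (chi E f) <= csqn f.
Proof.
move=> mE hf; rewrite -lee_fin csqn_chi// -(csqn_int hf).
have m : measurable_fun setT (fun x => re f x ^+ 2 + im f x ^+ 2).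
  apply: measurable_funD; apply: measurable_funX.
    exact: sqint_meas hf.1.
  exact: sqint_meas hf.2.
have p x : 0 <= re f x ^+ 2 + im f x ^+ 2 by rewrite addr_ge0 ?sqr_ge0.
apply: ge0_le_integral => //.
- by move=> x _; rewrite lee_fin mulr_ge0.
- by apply/measurable_EFinP; apply: measurable_funM => //; exact: measurable_indic.
- exact/measurable_EFinP.
- by move=> x _; rewrite lee_fin ler_piMl.
Qed.

Lemma cdot_chi (E : set R) f g : cdot (chi E f) g = cdot f (chi E g).
Proof.
rewrite /cdot /dot; congr (_ + _); apply: eq_Rintegral => x _; rewrite /re /im /chi.
  by case: (f x) (g x) => p r [p' r'] /=; ring.
by case: (f x) (g x) => p r [p' r'] /=; ring.
Qed.

Lemma chi_chi (E : set R) f : chi E (chi E f) = chi E f.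
Proof.
apply/funext => x; rewrite /chi mulrA indicE.
by case: (x \in E); rewrite ?mulr1// mul0r.
Qed.

Lemma chi_id (E : set R) f : (forall x, ~ E x -> f x = 0) -> chi E f = f.
Proof.
move=> sf; apply/funext => x; rewrite /chi indicE.
by case: (boolP (x \in E)) => [|/negP xE]; rewrite ?mul1r// mul0r sf// => /mem_set.
Qed.

Lemma chiB (E : set R) f g : chi E (f \- g) = chi E f \- chi E g.
Proof. by apply/funext => x; rewrite /chi /= mulrBr. Qed.

Lemma cdot_chi_self (E : set R) f : cdot (chi E f) f = csqn (chi E f).
Proof. by rewrite /csqn -[LHS]cdotC -[in LHS]chi_chi -cdot_chi. Qed.

(** Both sides of the symmetric set Lset fold onto this one. *)
Definition Lpos K : set R := \bigcup_(n in K) [set` `[ln n%:R, ln n.+1%:R[].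

Lemma measurable_Lpos K : measurable (Lpos K : set mR).
Proof. by apply: bigcup_measurable => n _; exact: measurable_itv. Qed.

Lemma measurable_Lset K : measurable (Lset K : set mR).
Proof.
by apply: bigcup_measurable => n _; apply: measurableU; exact: measurable_itv.
Qed.

Lemma LsetN K (x : R) : Lset K x -> Lset K (- x).
Proof.
move=> [n Kn nx]; exists n => //; case: nx; rewrite /= in_itv/= => /andP[h1 h2].
  by right; rewrite /= in_itv/=; apply/andP; split; lra.
by left; rewrite /= in_itv/=; apply/andP; split; lra.
Qed.

Lemma Lset_pos K (x : R) : K `<=` [set n | (0 < n)%N] -> 0 <= x ->
  Lset K x <-> Lpos K x.
Proof.
move=> hK x0; split=> -[n Kn nx]; exists n => //; last by right.
case: nx => //; rewrite /= !in_itv/= => /andP[h1 h2].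
have n0 := hK _ Kn; have n1 : 0 <= ln n%:R :> R by rewrite ln_ge0// ler1n.
have : ln n%:R < ln n.+1%:R :> R by rewrite ltr_ln ?posrE ?ltr0n// ltr_nat.
by move=> ?; apply/andP; split; lra.
Qed.

Lemma csqn_chi_Lset K T g : K `<=` [set n | (0 < n)%N] -> 0 < T -> csq g -> csupp T g ->
  ((csqn (chi (Lset K) (ft g)))%:E = 2%:E * \int[mu]_(x in Lpos K) (cenergy g x)%:E)%E.
Proof.
move=> hK T0 hg sg; have [hf _] := ft_csqn T0 hg sg.
have mL := measurable_Lset K; have mLp := measurable_Lpos K.
have cE := cenergy_continuous hg sg.
have m : measurable_fun setT (fun x => re (ft g) x ^+ 2 + im (ft g) x ^+ 2).
  apply: measurable_funD; apply: measurable_funX.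
    exact: sqint_meas hf.1.
  exact: sqint_meas hf.2.
rewrite csqn_chi// ge0_integral_fold//; first last.
- by move=> x; rewrite mulr_ge0// addr_ge0 ?sqr_ge0.
- by apply: measurable_funM => //; exact: measurable_indic.
rewrite -ge0_integralZl//; last 2 first.
- exact: (@continuous_EFin_measurable R _ _ cE).
- by move=> x _; rewrite lee_fin cenergy_ge0.
rewrite [LHS]integral_mkcond [RHS]integral_mkcond; apply: (@eq_integral _ _ R mu) => x _.
rewrite !patchE; case: (boolP (x \in halfline)) => [|/negP xh].
  rewrite inE /halfline/= in_itv/= andbT => x0.
  have e1 : (\1_(Lset K) (- x) = \1_(Lset K) x :> R).
    rewrite !indicE; congr (_%:R); congr nat_of_bool; apply/idP/idP; rewrite !inE => /LsetN//.
    by rewrite opprK.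
  have e2 : (x \in Lset K) = (x \in Lpos K).
    by apply/idP/idP; rewrite !inE => /(Lset_pos hK x0).
  rewrite e1 -mulrDr (ft_fold hg sg) indicE e2.
  by case: (x \in Lpos K); rewrite ?mul1r ?mul0r// -EFinM.
rewrite ifF//; apply/negP; rewrite inE => -[n Kn]; rewrite /= in_itv/= => /andP[nx _].
apply: xh; rewrite inE /halfline/= in_itv/= andbT; apply: le_trans nx.
by rewrite ln_ge0// ler1n; exact: hK.
Qed.

Lemma trigt0l (phi : R -> R) x : trigt phi (fun=> 0) x = 0.
Proof.
by rewrite /trigt -[RHS](mulr0 c0) -[in RHS](dot0l (fun y => phi (y * x))).
Qed.

Definition form_below T (q : (R -> R) -> \bar R) : Prop :=
  exists2 c : R, 0 < c & forall a, sqint a -> supp T a -> ((c * sqn a)%:E <= q a)%E.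

Lemma energy0 x : energy (fun=> 0) x = 0 :> R.
Proof. by rewrite /energy /ct /st !trigt0l expr0n/= addr0. Qed.

(** A form that acts separately on real and imaginary parts is bounded below
    as soon as it is so on real functions. *)
Lemma form_belowP T (q : (R -> R[i]) -> R) (Q : (R -> R) -> \bar R) :
  Q (fun=> 0) = 0%E ->
  (forall g, L2 [set` `]- T, T[] g -> (q g)%:E = (2%:E * (Q (re g) + Q (im g)))%E) ->
  (exists2 c, 0 < c & forall g, L2 [set` `]- T, T[] g -> c * csqn g <= q g) <->
  form_below T Q.
Proof.
move=> Q0 qQ; split=> -[c c0 cP].
  exists (c / 2) => [|a ha sa]; first by rewrite divr_gt0.
  pose g : R -> R[i] := fun x => (a x)%:C%C.
  have hg : csq g by split=> //; exact: sqint0.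
  have sg : csupp T g by move=> x xT; rewrite /g sa.
  have Lg : L2 [set` `]- T, T[] g by apply/L2_csq.
  have := cP g Lg; rewrite -lee_fin qQ// [Q (im g)]Q0 adde0.
  have -> : csqn g = sqn a by rewrite csqnE /sqn [dot (im g) _]dot0l addr0.
  move=> h; rewrite mulrAC mulrC EFinM; apply: le_trans (lee_wpmul2l _ h) _ => //.
  by rewrite muleA -EFinM mulVf// mul1e.
exists (2 * c) => [|g Lg]; first by rewrite mulr_gt0.
have /L2_csq[hg sg] := Lg; have [s1 s2] := csuppP sg.
rewrite -lee_fin qQ// -mulrA EFinM lee_wpmul2l// csqnE mulrDr EFinD.
by apply: leeD; [exact: cP hg.1 s1|exact: cP hg.2 s2].
Qed.

Definition Lform K a : \bar R := (\int[mu]_(x in Lpos K) (energy a x)%:E)%E.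

(** For f = fourier g the form <A g, g> is the square norm of chi L f, which also
    bounds that of A g: the inverse transform is isometric and restriction to I
    does not increase norms. *)
Lemma Fourier_form K T : K `<=` [set n | (0 < n)%N] -> 0 < T ->
  bounded_below [set` `]- T, T[]
    (fun g => chi [set` `]- T, T[] (inv_fourier (chi (Lset K) (fourier g)))) <->
  form_below T (Lform K).
Proof.
move=> hK T0; set E : set R := [set` `]- T, T[].
have mE : measurable (E : set mR) by exact: measurable_itv.
have mL := measurable_Lset K.
pose q g := csqn (chi (Lset K) (fourier g)).
have qE g : L2 E g -> q g = csqn (chi (Lset K) (ft g)).
  move=> /L2_csq[hg sg]; have hf := (fourier_spec hg).1.
  have hF := (ft_csqn T0 hg sg).1.
  apply: csqn0_csqn; [exact: csq_chi|exact: csq_chi|].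
  apply/eqP; rewrite eq_le csqn_ge0 andbT -chiB -(fourier_csupp T0 hg sg).
  by apply: csqn_chi_le => //; exact: csqB.
rewrite (@bounded_below_form E _ q 1 ltr01); last first.
  move=> g /L2_csq[hg sg]; have hf := (fourier_spec hg).1.
  have hc := csq_chi mL hf; have [hP P0] := inv_fourier_spec hc.
  have hfP := (fourier_spec hP).1.
  have hA := csq_chi mE hP; split=> //.
    rewrite cdot_chi (chi_id sg) -(cdot_fourier hP hg) (csqn0_cdot hfP hc hf P0).
    exact: cdot_chi_self.
  rewrite mul1r; apply: le_trans (csqn_chi_le mE hP) _.
  by rewrite [X in X <= _]/csqn -(cdot_fourier hP hP) -/(csqn _) (csqn0_csqn hfP hc P0).
apply: form_belowP => [|g Lg].
  by apply: integral0_eq => x _; rewrite energy0.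
have /L2_csq[hg sg] := Lg; have [s1 s2] := csuppP sg.
rewrite qE// (csqn_chi_Lset hK T0 hg sg); apply: (congr1 (fun z => 2%:E * z)%E).
rewrite /Lform -ge0_integralD//; first exact: measurable_Lpos.
- by move=> x _; rewrite lee_fin energy_ge0.
- exact: (@continuous_EFin_measurable R _ _ (energy_continuous hg.1 s1)).
- by move=> x _; rewrite lee_fin energy_ge0.
- exact: (@continuous_EFin_measurable R _ _ (energy_continuous hg.2 s2)).
Qed.

End operator_form.

(** * Logarithmic blocks and the Bessel inequality *)

Section sobolev.
Context {R : realType}.
Local Notation mu := (@lebesgue_measure R).
Local Notation mR := (measurableTypeR R).
Implicit Types (u v : R -> R) (p q x y s : R).

Lemma sqr_increment_le u v s p q : (forall y, is_derive y (1:R) u (v y)) ->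
  continuous v -> (s = 1 \/ s = - 1) -> p <= q ->
  ((s * u q ^+ 2 - s * u p ^+ 2)%:E <= \int[mu]_(y in `[p, q]) (u y ^+ 2 + v y ^+ 2)%:E)%E.
Proof.
move=> du cv hs pq; have cu := is_derive_continuous du.
have pos y : 0 <= u y ^+ 2 + v y ^+ 2 by rewrite addr_ge0 ?sqr_ge0.
move: pq; rewrite le_eqVlt => /orP[/eqP <-|pq].
  by rewrite subrr; apply: integral_ge0 => y _; rewrite lee_fin.
have dF y : is_derive y (1:R) (fun y => s * u y ^+ 2) (s * (2 * u y * v y)).
  have -> : s * (2 * u y * v y) = s *: ((2 * u y ^+ 1) *: v y).
    by rewrite /GRing.scale/= expr1.
  exact: (is_deriveZ s (is_deriveX 2 (du y))).
have cF := is_derive_continuous dF.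
have cf : continuous (fun y => s * (2 * u y * v y)).
  move=> y; apply: cvgM; first exact: cvg_cst.
  by apply: cvgM; [apply: cvgM; [exact: cvg_cst|exact: cu]|exact: cv].
have cw : continuous (fun y => u y ^+ 2 + v y ^+ 2).
  by move=> y; apply: cvgD; (apply: cvgM; [|]); first [exact: cu|exact: cv].
have H : (\int[mu]_(y in `[p, q]) (s * (2 * u y * v y))%:E =
    (s * u q ^+ 2)%:E - (s * u p ^+ 2)%:E)%E.
  apply: (continuous_FTC2 pq (F := fun y => s * u y ^+ 2)).
  - exact: continuous_subspaceT.
  - split.
    + by move=> x _; have [] := dF x.
    + by apply: cvg_at_right_filter; exact: cF.
    + by apply: cvg_at_left_filter; exact: cF.
  - by move=> x _; rewrite derive1E; have [_ ->] := dF x.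
rewrite EFinB -H; apply: le_integral.
- exact: measurable_itv.
- by apply: continuous_compact_integrable; [exact: segment_compact|exact: continuous_subspaceT].
- by apply: continuous_compact_integrable; [exact: segment_compact|exact: continuous_subspaceT].
move=> y _; rewrite lee_fin.
have := sqr_ge0 (u y - s * v y).
by case: hs => ->; move: (u y) (v y) => a b; clear; nra.
Qed.

(** The minimum of u^2 over the interval is at most its mean, and u^2 varies by
    at most the integral of |2uu'|. *)
Lemma sobolev_sqr u v p q x : (forall y, is_derive y (1:R) u (v y)) ->
  continuous v -> p <= x <= q ->
  (((q - p) * u x ^+ 2)%:E <=
   (1 + (q - p))%:E * \int[mu]_(y in `[p, q[) (u y ^+ 2 + v y ^+ 2)%:E)%E.
Proof.
move=> du cv /andP[px xq]; have cu := is_derive_continuous du.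
have pq : p <= q by apply: le_trans xq.
have cw : continuous (fun y => u y ^+ 2 + v y ^+ 2).
  by move=> y; apply: cvgD; (apply: cvgM; [|]); first [exact: cu|exact: cv].
have cu2 : continuous (fun y => u y ^+ 2) by move=> y; apply: cvgM; exact: cu.
have pos y : 0 <= u y ^+ 2 + v y ^+ 2 by rewrite addr_ge0 ?sqr_ge0.
have mw D : measurable_fun D (fun y => (u y ^+ 2 + v y ^+ 2)%:E).
  exact: (@continuous_EFin_measurable R D _ cw).
rewrite integral_itv_bndo_bndc; last exact: mw.
have [m mpq mP] := EVT_min pq (continuous_subspaceT (A := `[p, q]) cu2).
move: mpq; rewrite in_itv/= => /andP[pm mq].
set W := (\int[mu]_(y in `[p, q]) (u y ^+ 2 + v y ^+ 2)%:E)%E.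
have sub a b : p <= a -> b <= q ->
    (\int[mu]_(y in `[a, b]) (u y ^+ 2 + v y ^+ 2)%:E <= W)%E.
  move=> pa bq; apply: ge0_subset_integral.
  - exact: measurable_itv.
  - exact: measurable_itv.
  - exact: mw.
  - by move=> y _; rewrite lee_fin.
  - by move=> y /=; rewrite !in_itv/= => /andP[h1 h2]; rewrite (le_trans pa)// (le_trans h2).
have D1 : ((u x ^+ 2 - u m ^+ 2)%:E <= W)%E.
  have [mx|xm] := leP m x.
    have := sqr_increment_le du cv (or_introl erefl) mx.
    by rewrite !mul1r => /le_trans; apply; exact: sub.
  have := sqr_increment_le du cv (or_intror erefl) (ltW xm).
  by rewrite !mulN1r opprK addrC => /le_trans; apply; exact: sub.
have D2 : (((q - p) * u m ^+ 2)%:E <= W)%E.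
  have -> : ((q - p) * u m ^+ 2)%:E = (\int[mu]_(y in `[p, q]) (u m ^+ 2)%:E)%E.
    rewrite integral_cst; last exact: measurable_itv.
    rewrite /= lebesgue_measure_itv/= lte_fin; case: ltP => [_|qp].
      by rewrite -EFinD -EFinM mulrC.
    by rewrite (_ : q - p = 0) ?mul0r ?mule0//; lra.
  apply: ge0_le_integral.
  - exact: measurable_itv.
  - by move=> y _; rewrite lee_fin sqr_ge0.
  - exact: measurable_cst.
  - exact: mw.
  - move=> y yI; rewrite lee_fin; apply: le_trans (mP y yI) _.
    by rewrite lerDl sqr_ge0.
have W0 : (0 <= W)%E by apply: integral_ge0 => y _; rewrite lee_fin.
have qp0 : 0 <= q - p by lra.
rewrite EFinD ge0_muleDl ?lee_fin// mul1e.
have -> : ((q - p) * u x ^+ 2)%:E =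
    (((q - p) * u m ^+ 2)%:E + (q - p)%:E * (u x ^+ 2 - u m ^+ 2)%:E)%E.
  by rewrite -EFinM -EFinD; congr EFin; ring.
by apply: leeD => //; apply: lee_wpmul2l.
Qed.

End sobolev.

Section logarithmic_blocks.
Context {R : realType}.
Local Notation mu := (@lebesgue_measure R).
Local Notation mR := (measurableTypeR R).
Implicit Types (a b : R -> R) (T x : R) (K : set nat) (n : nat).

Definition lblock n : set R := [set` `[ln n%:R, ln n.+1%:R[].

Lemma lblock_measurable n : measurable (lblock n : set mR).
Proof. exact: measurable_itv. Qed.

Lemma ln_nat_ge0 n : 0 <= ln n%:R :> R.
Proof. by case: n => [|n]; [rewrite ln0|rewrite ln_ge0// ler1n]. Qed.

Lemma ln_nat_le n m : (n <= m)%N -> ln n%:R <= ln m%:R :> R.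
Proof.
case: n => [_|n nm]; first by rewrite ln0// ln_nat_ge0.
by rewrite ler_ln ?posrE ?ltr0n ?ler_nat// (leq_trans _ nm).
Qed.

Lemma lblock_trivIset : trivIset setT lblock.
Proof.
apply/trivIsetP => n m _ _ nm; wlog {nm} : n m / (n < m)%N.
  by move=> H; case: (ltngtP n m) nm => // [h|h] _; [|rewrite setIC]; exact: H.
move=> nm; rewrite -subset0 => x []; rewrite /lblock /= !in_itv/= => /andP[_ h1] /andP[h2 _].
have := @ln_nat_le n.+1 m nm; move: h1 h2; clear; lra.
Qed.

Lemma ln_succ_ge n : (0 < n)%N -> (2 * n%:R)^-1 <= ln n.+1%:R - ln n%:R :> R.
Proof.
move=> n0; have n0' : (0:R) < n%:R by rewrite ltr0n.
have s0 : (0:R) < n.+1%:R by rewrite ltr0n.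
have : ln (n%:R / n.+1%:R) <= n%:R / n.+1%:R - 1 :> R.
  by rewrite -[X in _ <= X - 1](lnK) ?posrE ?divr_gt0// lerBrDl expR_ge1Dx.
rewrite ln_div ?posrE// => h.
have e : (n%:R / n.+1%:R - 1 : R) = - n.+1%:R^-1.
  have s1 : n%:R + 1 != 0 :> R by rewrite natr1 gt_eqF.
  by rewrite -!natr1; field.
have : (2 * n%:R)^-1 <= n.+1%:R^-1 :> R.
  rewrite lef_pV2 ?posrE ?mulr_gt0//.
  have : (1:R) <= n%:R by rewrite ler1n.
  by rewrite -natr1; lra.
by move: h; rewrite e; move: (n.+1%:R^-1) ((2 * n%:R)^-1) (ln _) (ln _) => p q r s; lra.
Qed.

Lemma ln_succ_le n : (0 < n)%N -> ln n.+1%:R - ln n%:R <= n%:R^-1 :> R.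
Proof.
move=> n0; have n0' : (0:R) < n%:R by rewrite ltr0n.
have s0 : (0:R) < n.+1%:R by rewrite ltr0n.
have : ln (n.+1%:R / n%:R) <= n.+1%:R / n%:R - 1 :> R.
  by rewrite -[X in _ <= X - 1](lnK) ?posrE ?divr_gt0// lerBrDl expR_ge1Dx.
rewrite ln_div ?posrE// => h.
have e : (n.+1%:R / n%:R - 1 : R) = n%:R^-1 by rewrite -natr1; field; rewrite gt_eqF.
by move: h; rewrite e.
Qed.

Lemma lblock_halfline n : lblock n `<=` halfline.
Proof.
move=> x; rewrite /lblock /halfline /= !in_itv/= andbT => /andP[h _].
exact: le_trans (ln_nat_ge0 n) h.
Qed.

Lemma Lpos_series K (f : R -> \bar R) : measurable_fun setT f -> (forall x, 0 <= f x)%E ->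
  (\int[mu]_(x in Lpos K) f x = \sum_(n <oo | n \in K) \int[mu]_(x in lblock n) f x)%E.
Proof.
move=> mf f0; pose F n := if n \in K then lblock n else set0.
have -> : Lpos K = \bigcup_n F n.
  apply/seteqP; split=> x.
    by move=> [n Kn xn]; exists n => //; rewrite /F mem_set.
  by move=> [n _]; rewrite /F; case: ifPn => //; rewrite inE => Kn xn; exists n.
rewrite ge0_integral_bigcup//.
- rewrite [RHS]eseries_mkcond; apply: eq_eseriesr => n _; rewrite /F.
  by case: ifP => // _; rewrite integral_set0.
- by move=> n; rewrite /F; case: ifP => // _; exact: lblock_measurable.
- exact: measurable_funTS.
- apply/trivIsetP => n m _ _ nm; rewrite /F.
  case: ifP => _; last by rewrite set0I.
  case: ifP => _; last by rewrite setI0.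
  by move/trivIsetP: lblock_trivIset; exact.
Qed.

Definition Zform K a : \bar R :=
  (\sum_(n <oo | n \in K) (energy a (ln n%:R) / n%:R)%:E)%E.

(** The block has length comparable to 1/n, and the derivatives of ct a and st a
    are, up to sign, the transforms of x a. *)
Lemma energy_point_le T a n : sqint a -> supp T a -> (0 < n)%N ->
  ((energy a (ln n%:R) / n%:R)%:E <=
   4%:E * \int[mu]_(y in lblock n) (energy a y + energy (fun x => (x * a x)%R) y)%:E)%E.
Proof.
move=> ha sa n0; pose xa x := x * a x.
have hxa := sqint_mulid ha sa; have sxa : supp T xa by exact: supp_mull.
have cs := st_continuous hxa sxa; have cc := ct_continuous hxa sxa.
have cs' := st_continuous ha sa; have cc' := ct_continuous ha sa.
have n0' : (0:R) < n%:R by rewrite ltr0n.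
have l1 := ln_succ_ge n0; have l2 := ln_succ_le n0.
have l3 : n%:R^-1 <= 1 :> R by rewrite invf_le1// ler1n.
have l4 : (0:R) < (2 * n%:R)^-1 by rewrite invr_gt0 mulr_gt0.
set l : R := ln n.+1%:R - ln n%:R in l1 l2.
have cN : continuous (fun y => - st xa y) by move=> y; apply: cvgN; exact: cs.
pose p0 : R := ln n%:R.
have nb : p0 <= p0 <= ln n.+1%:R by rewrite lexx /=; exact: ln_nat_le (leqnSn n).
have S1 := sobolev_sqr (fun y => ct_is_derive y ha sa) cN nb.
have S2 := sobolev_sqr (fun y => st_is_derive y ha sa) cc nb.
have mC (u v : R -> R) D : continuous u -> continuous v ->
    measurable_fun D (fun y => (u y ^+ 2 + v y ^+ 2)%:E).
  move=> cu cv; apply: (@continuous_EFin_measurable R D) => y.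
  by apply: cvgD; (apply: cvgM; [|]); first [exact: cu|exact: cv].
have pos (u v : R -> R) y : (0 <= (u y ^+ 2 + v y ^+ 2)%:E)%E.
  by rewrite lee_fin addr_ge0 ?sqr_ge0.
have IE : (\int[mu]_(y in lblock n) (energy a y + energy xa y)%:E =
   \int[mu]_(y in lblock n) (ct a y ^+ 2 + (- st xa y) ^+ 2)%:E +
   \int[mu]_(y in lblock n) (st a y ^+ 2 + ct xa y ^+ 2)%:E)%E.
  rewrite -ge0_integralD.
  - by apply: eq_integral => y _; rewrite -EFinD /energy sqrrN; congr EFin; ring.
  - exact: lblock_measurable.
  - by move=> y _; exact: (pos (ct a) (fun y => - st xa y)).
  - exact: (mC (ct a) (fun y => - st xa y)).
  - by move=> y _; exact: (pos (st a) (ct xa)).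
  - exact: (mC (st a) (ct xa)).
set I1 := (\int[mu]_(y in lblock n) (ct a y ^+ 2 + (- st xa y) ^+ 2)%:E)%E in IE.
set I2 := (\int[mu]_(y in lblock n) (st a y ^+ 2 + ct xa y ^+ 2)%:E)%E in IE.
have I10 : (0 <= I1)%E by apply: integral_ge0 => y _; exact: (pos (ct a) (fun y => - st xa y)).
have I20 : (0 <= I2)%E by apply: integral_ge0 => y _; exact: (pos (st a) (ct xa)).
rewrite -/xa IE.
have S (z : R) (J : \bar R) : (0 <= J)%E -> 0 <= z -> ((l * z)%:E <= (1 + l)%:E * J)%E ->
    ((z / n%:R)%:E <= 4%:E * J)%E.
  move=> J0 z0 h.
  have h1 : ((z * (2 * n%:R)^-1)%:E <= 2%:E * J)%E.
    apply: le_trans (_ : (l * z)%:E <= _)%E; first by rewrite lee_fin mulrC ler_wpM2r.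
    apply: (le_trans h); apply: lee_wpmul2r => //; rewrite lee_fin.
    by move: l2 l3; clear; lra.
  have -> : (z / n%:R)%:E = (2%:E * (z * (2 * n%:R)^-1)%:E)%E.
    by rewrite -EFinM; congr EFin; rewrite invfM; field; rewrite gt_eqF.
  have -> : (4%:E * J = 2%:E * (2%:E * J))%E by rewrite muleA -EFinM -natrM.
  by apply: lee_wpmul2l.
rewrite /energy mulrDl EFinD ge0_muleDr//; apply: leeD.
  by apply: S => //; exact: sqr_ge0.
by apply: S => //; exact: sqr_ge0.
Qed.

(** This form dominates both Zform and Lform up to a constant factor, so that a
    single argument serves both operators. *)
Definition Wform K a : \bar R :=
  (\int[mu]_(y in Lpos K) (energy a y + energy (fun x => (x * a x)%R) y)%:E)%E.

Lemma energyD_measurable T a : sqint a -> supp T a ->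
  measurable_fun setT (fun y => (energy a y + energy (fun x => (x * a x)%R) y)%:E).
Proof.
move=> ha sa; have hxa := sqint_mulid ha sa.
have sxa : supp T (fun x => x * a x) by exact: supp_mull.
have c := continuousD_fun (energy_continuous ha sa) (energy_continuous hxa sxa).
exact: (@continuous_EFin_measurable R setT _ c).
Qed.

Lemma Zform_le T K a : K `<=` [set n | (0 < n)%N] -> sqint a -> supp T a ->
  (Zform K a <= 4%:E * Wform K a)%E.
Proof.
move=> hK ha sa; rewrite /Wform Lpos_series; last 2 first.
- exact: energyD_measurable ha sa.
- by move=> x; rewrite lee_fin addr_ge0 ?energy_ge0.
rewrite -nneseriesZl; last first.
  by move=> n _; apply: integral_ge0 => y _; rewrite lee_fin addr_ge0 ?energy_ge0.
apply: lee_nneseries => [n _ _|n]; first by rewrite lee_fin divr_ge0 ?energy_ge0.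
by rewrite inE => /hK n0; exact: energy_point_le ha sa n0.
Qed.

Lemma Wform_bound T K a : 0 < T -> sqint a -> supp T a ->
  (Wform K a <= ((1 + T ^+ 2) / 2 * sqn a)%:E)%E.
Proof.
move=> T0 ha sa; have hxa := sqint_mulid ha sa.
have sxa : supp T (fun x => x * a x) by exact: supp_mull.
have mE := energyD_measurable ha sa.
apply: le_trans (_ : _ <= \int[mu]_(y in halfline) (energy a y + energy (fun x => (x * a x)%R) y)%:E)%E _.
  apply: ge0_subset_integral.
  - exact: measurable_Lpos.
  - exact: measurable_halfline.
  - exact: measurable_funTS.
  - by move=> x _; rewrite lee_fin addr_ge0 ?energy_ge0.
  - by move=> x [n _]; exact: lblock_halfline.
under eq_integral do rewrite EFinD.
rewrite ge0_integralD; last 5 first.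
- exact: measurable_halfline.
- by move=> x _; rewrite lee_fin energy_ge0.
- exact: (@continuous_EFin_measurable R halfline _ (energy_continuous ha sa)).
- by move=> x _; rewrite lee_fin energy_ge0.
- exact: (@continuous_EFin_measurable R halfline _ (energy_continuous hxa sxa)).
rewrite (plancherel T0 ha sa) (plancherel T0 hxa sxa) -EFinD lee_fin.
have := sqn_mulid_le ha sa; move: (sqn a) (sqn _) => p q; clear; lra.
Qed.

Lemma Zform_bound T K a : K `<=` [set n | (0 < n)%N] -> 0 < T -> sqint a -> supp T a ->
  (Zform K a <= (2 * (1 + T ^+ 2) * sqn a)%:E)%E.
Proof.
move=> hK T0 ha sa; apply: le_trans (Zform_le hK ha sa) _.
apply: le_trans (_ : 4%:E * ((1 + T ^+ 2) / 2 * sqn a)%:E <= _)%E.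
  by apply: lee_wpmul2l => //; exact: Wform_bound.
rewrite -EFinM lee_fin; move: (sqn a) (T ^+ 2) => p q.
have -> : 4 * ((1 + q) / 2 * p) = 2 * (1 + q) * p by field.
exact: lexx.
Qed.

End logarithmic_blocks.

(** * Finite-rank approximations of the zeta operator *)

Section partial_operators.
Context {R : realType}.
Local Notation mu := (@lebesgue_measure R).
Local Notation mR := (measurableTypeR R).
Implicit Types (a b phi : R -> R) (g h : R -> R[i]) (T l : R) (K : set nat)
  (w : nat -> R) (n N M : nat).

Definition wave T phi l : R -> R := fun t => chi_itv T t * phi (t * l).

Lemma wave_supp T phi l : supp T (wave T phi l).
Proof. exact: supp_chi. Qed.

Lemma wave_sqint T phi l : 0 < T -> trig_like phi -> sqint (wave T phi l).
Proof.
move=> T0 [cphi _]; apply: sqint_chi_continuous => // t.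
apply: (@cvg_comp _ _ _ (fun t : R => t * l) phi); last exact: cphi.
by apply: cvgM; [exact: cvg_id|exact: cvg_cst].
Qed.

Lemma dot_wave T phi l b : supp T b -> c0 * dot (wave T phi l) b = trigt phi b l.
Proof.
move=> sb; rewrite /trigt; apply: (congr1 ( *%R c0)); apply: eq_Rintegral => t _.
rewrite /wave mulrAC; have -> : chi_itv T t * b t = b t by exact: supp_indic.
by [].
Qed.

Definition kterm T w a n : R -> R :=
  ((2 * c0 * (w n / n%:R) * ct a (ln n%:R)) \*o wave T cos (ln n%:R)) \+
  ((2 * c0 * (w n / n%:R) * st a (ln n%:R)) \*o wave T sin (ln n%:R)).

Lemma kterm_supp T w a n : supp T (kterm T w a n).
Proof. by apply: suppD; apply: suppZ; exact: wave_supp. Qed.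

Lemma kterm_sqint T w a n : 0 < T -> sqint (kterm T w a n).
Proof.
move=> T0; apply: sqintD; apply: sqintZ; apply: wave_sqint => //.
  exact: trig_cos.
exact: trig_sin.
Qed.

Lemma dot_kterm T w a b n : 0 < T -> sqint b -> supp T b ->
  dot (kterm T w a n) b = 2 * (w n / n%:R) *
    (ct a (ln n%:R) * ct b (ln n%:R) + st a (ln n%:R) * st b (ln n%:R)).
Proof.
move=> T0 hb sb.
have hc := wave_sqint (ln n%:R) T0 trig_cos; have hs := wave_sqint (ln n%:R) T0 trig_sin.
rewrite dotDl; [|exact: sqintZ|exact: sqintZ|exact: hb].
rewrite (dotZl _ hc hb) (dotZl _ hs hb).
rewrite /ct /st -(dot_wave cos _ sb) -(dot_wave sin _ sb).
move: (dot _ _) (dot _ _) (trigt _ _ _) (trigt _ _ _) c0 => p q r s c; ring.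
Qed.

Definition Kop K T w N a : R -> R :=
  fun t => \sum_(0 <= n < N | n \in K) kterm T w a n t.

Lemma Kop_supp K T w N a : supp T (Kop K T w N a).
Proof. by move=> x xT; rewrite /Kop big1// => n _; exact: kterm_supp. Qed.

Lemma Kop_sqint K T w N a : 0 < T -> sqint (Kop K T w N a).
Proof. by move=> T0; apply: sqint_sum => n; exact: kterm_sqint. Qed.

Lemma dot_Kop K T w N a b : 0 < T -> sqint b -> supp T b ->
  dot (Kop K T w N a) b = \sum_(0 <= n < N | n \in K) 2 * (w n / n%:R) *
    (ct a (ln n%:R) * ct b (ln n%:R) + st a (ln n%:R) * st b (ln n%:R)).
Proof.
move=> T0 hb sb; rewrite dot_suml//; last by move=> n; exact: kterm_sqint.
by apply: eq_bigr => n _; exact: dot_kterm.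
Qed.

Definition bessel T : R := 2 * (1 + T ^+ 2).

Lemma bessel_gt0 T : 0 < bessel T.
Proof. by rewrite mulr_gt0// ltr_pwDl// sqr_ge0. Qed.

Lemma bessel_le K T N a : K `<=` [set n | (0 < n)%N] -> 0 < T -> sqint a -> supp T a ->
  \sum_(0 <= n < N | n \in K) energy a (ln n%:R) / n%:R <= bessel T * sqn a.
Proof.
move=> hK T0 ha sa; rewrite -lee_fin -sumEFin; apply: le_trans (Zform_bound hK T0 ha sa).
by apply: nneseries_lim_ge => n _ _; rewrite lee_fin divr_ge0 ?energy_ge0.
Qed.

(** Duality: pair with the image itself, split the product by Young's inequality
    and absorb half of the square norm by the Bessel bound. *)
Lemma Kop_sqn_le K T w N a : K `<=` [set n | (0 < n)%N] -> 0 < T -> sqint a -> supp T a ->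
  sqn (Kop K T w N a) <=
    4 * bessel T * \sum_(0 <= n < N | n \in K) w n ^+ 2 * (energy a (ln n%:R) / n%:R).
Proof.
move=> hK T0 ha sa; set b := Kop _ _ _ _ _.
have hb : sqint b by exact: Kop_sqint.
have sb : supp T b by exact: Kop_supp.
have B0 := bessel_gt0 T; have Bb := bessel_le N hK T0 hb sb.
have D : sqn b <= 2 * bessel T *
    (\sum_(0 <= n < N | n \in K) w n ^+ 2 * (energy a (ln n%:R) / n%:R)) +
    (2 * bessel T)^-1 * \sum_(0 <= n < N | n \in K) energy b (ln n%:R) / n%:R.
  rewrite {1}/sqn {1}/b dot_Kop// !big_distrr -big_split /=; apply: ler_sum => n _.
  rewrite /energy; move: (ct a _) (st a _) (ct b _) (st b _) (w n) => p q r s v.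
  have i0 : (0:R) <= n%:R^-1 by rewrite invr_ge0.
  have Y (x y : R) : 2 * (v * x * y) <= 2 * bessel T * (v ^+ 2 * x ^+ 2) + (2 * bessel T)^-1 * y ^+ 2.
    have B2 : 0 < 2 * bessel T by rewrite mulr_gt0.
    have := sqr_ge0 (2 * bessel T * v * x - y).
    rewrite -(@ler_pM2l _ (2 * bessel T)^-1) ?invr_gt0// mulr0.
    have E1 : (2 * bessel T)^-1 * (2 * bessel T * v * x - y) ^+ 2 =
      2 * bessel T * (v ^+ 2 * x ^+ 2) + (2 * bessel T)^-1 * y ^+ 2 - 2 * (v * x * y).
      by field; rewrite gt_eqF.
    by rewrite E1; move: (2 * bessel T * _) (_ * y ^+ 2) => P Q; clear; lra.
  have := Y p r; have := Y q s.
  move: (2 * bessel T) ((2 * bessel T)^-1) (n%:R^-1) i0 => B Bi m m0; clear -m0; nra.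
have E : (2 * bessel T)^-1 * (bessel T * sqn b) = sqn b / 2.
  by move: (sqn b) => z; field; rewrite gt_eqF.
have : (2 * bessel T)^-1 * (\sum_(0 <= n < N | n \in K) energy b (ln n%:R) / n%:R)
    <= sqn b / 2.
  by rewrite -E ler_pM2l// invr_gt0 mulr_gt0.
move: D; set S := \sum_(0 <= n < N | n \in K) w n ^+ 2 * _.
set U := (2 * bessel T)^-1 * _; move: (sqn b) S U (bessel T) => x y z B; clear; lra.
Qed.

Lemma KopB K T w w' N a : Kop K T w N a \- Kop K T w' N a = Kop K T (w \- w') N a.
Proof.
apply/funext => t; rewrite /Kop /= -sumrB; apply: eq_bigr => n _.
rewrite /kterm /=; move: (wave _ _ _ _) (wave _ _ _ _) c0 (ct _ _) (st _ _) => p q r s u.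
ring.
Qed.

Lemma Kop_widen K T w N M a : (M <= N)%N ->
  Kop K T w M a = Kop K T (fun n => (n < M)%:R * w n) N a.
Proof.
move=> MN; apply/funext => t; rewrite /Kop [RHS](big_cat_nat (n := M))//=.
rewrite [X in _ = _ + X]big_nat_cond [X in _ = _ + X]big1 ?addr0.
  rewrite big_nat_cond [RHS]big_nat_cond; apply: eq_bigr => n /andP[/andP[_ nM] _].
  by rewrite /kterm nM mul1r.
move=> n /andP[/andP[Mn _] _]; rewrite /kterm ltnNge Mn /=.
by rewrite !mul0r mulr0 !mul0r addr0.
Qed.

Definition CK K T w N g : R -> R[i] :=
  fun t => (Kop K T w N (re g) t +i* Kop K T w N (im g) t)%C.

Definition cpoint g n : R := cenergy g (ln n%:R) / n%:R.

Lemma cpoint_ge0 g n : 0 <= cpoint g n.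
Proof. by rewrite divr_ge0// addr_ge0 ?energy_ge0. Qed.

Definition czpart K N g : R := \sum_(0 <= n < N | n \in K) cpoint g n.

Variables (K : set nat) (T : R).
Hypotheses (hK : K `<=` [set n | (0 < n)%N]) (T0 : 0 < T).

Lemma CK_csq w N g : csq (CK K T w N g).
Proof. by split; exact: Kop_sqint. Qed.

Lemma CK_csupp w N g : csupp T (CK K T w N g).
Proof. by move=> x xT; rewrite /CK !Kop_supp. Qed.

Section with_function.
Variable g : R -> R[i].
Hypotheses (hg : csq g) (sg : csupp T g).

Let s1 := (csuppP sg).1.
Let s2 := (csuppP sg).2.

Lemma CK_csqn_le w N : csqn (CK K T w N g) <=
  4 * bessel T * \sum_(0 <= n < N | n \in K) w n ^+ 2 * cpoint g n.
Proof.
have := lerD (Kop_sqn_le w N hK T0 hg.1 s1) (Kop_sqn_le w N hK T0 hg.2 s2).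
rewrite -mulrDr -big_split csqnE => /le_trans; apply.
rewrite ler_wpM2l//; first by rewrite mulr_ge0// ltW// bessel_gt0.
by apply: ler_sum => n _ /=; rewrite -mulrDr -mulrDl.
Qed.

Lemma CK_cdot N : cdot (CK K T (fun=> 1) N g) g = 2 * czpart K N g.
Proof.
rewrite /cdot [dot (re _) _](dot_Kop _ _ _ _ T0 hg.1 s1).
rewrite [dot (im _) _](dot_Kop _ _ _ _ T0 hg.2 s2) -big_split /czpart big_distrr.
apply: eq_bigr => n _ /=; rewrite /cpoint /cenergy /energy.
move: (ct _ _) (st _ _) (ct _ _) (st _ _) (n%:R^-1) => p q r s m; ring.
Qed.

Lemma CKB w w' N : CK K T w N g \- CK K T w' N g = CK K T (w \- w') N g.
Proof.
by apply/funext => t; rewrite /CK -(KopB K T w w' N (re g)) -(KopB K T w w' N (im g)).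
Qed.

Lemma CK_diff N M : (M <= N)%N ->
  csqn (CK K T (fun=> 1) N g \- CK K T (fun=> 1) M g) <=
  4 * bessel T * (czpart K N g - czpart K M g).
Proof.
move=> MN.
have -> : CK K T (fun=> 1) M g = CK K T (fun n => (n < M)%:R * 1) N g.
  by apply/funext => t; rewrite /CK !(Kop_widen K T _ _ MN).
rewrite CKB; apply: le_trans (CK_csqn_le _ _) _.
rewrite ler_wpM2l//; first by rewrite mulr_ge0// ltW// bessel_gt0.
rewrite lerBrDl /czpart [leRHS](big_cat_nat (n := M))//= lerD2l [leLHS](big_cat_nat (n := M))//=.
have -> : \sum_(0 <= i < M | i \in K) (1 - (i < M)%:R * 1) ^+ 2 * cpoint g i = 0.
  rewrite big_nat_cond big1// => i /andP[/andP[_ iM] _].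
  by rewrite iM mulr1 subrr expr0n mul0r.
rewrite add0r [leLHS]big_nat_cond [leRHS]big_nat_cond; apply: ler_sum => i /andP[/andP[Mi _] _].
by rewrite ltnNge Mi mul0r subr0 expr1n mul1r.
Qed.

Lemma czpart_nd : nondecreasing_seq (fun N => czpart K N g).
Proof.
move=> M N MN; rewrite /czpart [leRHS](big_cat_nat (n := M))//= lerDl.
by apply: sumr_ge0 => n _; exact: cpoint_ge0.
Qed.

Lemma czpart_bound N : czpart K N g <= bessel T * csqn g.
Proof.
have := lerD (bessel_le N hK T0 hg.1 s1) (bessel_le N hK T0 hg.2 s2).
rewrite -mulrDr -big_split csqnE => /(le_trans _); apply.
by apply: ler_sum => n _ /=; rewrite -mulrDl.
Qed.

Lemma czpart_cvg : exists2 z : R, czpart K N g @[N --> \oo] --> z &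
  forall N, czpart K N g <= z.
Proof.
have ub : has_ubound (range (fun N => czpart K N g)).
  by exists (bessel T * csqn g) => _ [N _ <-]; exact: czpart_bound.
have c := nondecreasing_cvgn czpart_nd ub.
eexists; first exact: c.
by move=> N; apply: ub_le_sup => //; exists N.
Qed.

Lemma CK_cvg : exists z : R -> R[i], [/\ csq z, csupp T z &
  cvg2 (fun N => CK K T (fun=> 1) N g) z].
Proof.
have [z cz zle] := czpart_cvg; have B4 : 0 < 4 * bessel T by rewrite mulr_gt0// bessel_gt0.
have [|h [hh sh c]] := @csqn_complete R (fun N => CK K T (fun=> 1) N g)
    (fun N => CK_csq (fun=> 1) N g).
  move=> e e0; have e1 : 0 < e / (4 * bessel T) by rewrite divr_gt0.
  move/cvgrPdist_le/(_ _ e1) : cz => [N _ NP]; exists N.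
  have H n m : (N <= m)%N -> (m <= n)%N ->
      csqn (CK K T (fun=> 1) n g \- CK K T (fun=> 1) m g) <= e.
    move=> Nm mn; apply: le_trans (CK_diff mn) _.
    have := NP m Nm; rewrite /= ger0_norm ?subr_ge0// ler_pdivlMr// mulrC.
    apply: le_trans; rewrite ler_pM2l// lerD2r; exact: zle.
  move=> n m Nn Nm; have [mn|nm] := leqP m n; first exact: H.
  rewrite csqn_sub_sym; [|exact: CK_csq|exact: CK_csq].
  by apply: H => //; exact: ltnW.
exists h; split => // x xT; apply: sh => n; exact: CK_csupp.
Qed.

End with_function.
End partial_operators.

(** * Real part of the zeta sum near the line Re s = 1 *)

Section complex_limit.
Context {R : realType}.
Implicit Types (x y : nat -> R).

Lemma normc_le_add (a b : R) : `|(a +i* b)%C| <= (`|a| + `|b|)%:C%C.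
Proof.
have ab0 : 0 <= `|a| + `|b| by rewrite addr_ge0.
rewrite normc_def lecR /= -[leRHS](ger0_norm ab0) -[leRHS]sqrtr_sqr.
rewrite ler_sqrt ?sqr_ge0// -(real_normK (num_real a)) -(real_normK (num_real b)).
by rewrite sqrrD lerD2r lerDl mulrn_wge0// mulr_ge0.
Qed.

Lemma complex_cvg x y (p q : R) : x n @[n --> \oo] --> p -> y n @[n --> \oo] --> q ->
  ((x n +i* y n)%C : (R[i] : numFieldType)) @[n --> \oo] --> ((p +i* q)%C : (R[i] : numFieldType)).
Proof.
move=> xp yq; apply/cvgrPdist_le => e; rewrite ltcE => /andP[/eqP ie re0].
have e2 : 0 < complex.Re e / 2 by rewrite divr_gt0.
move/cvgrPdist_le/(_ _ e2) : xp => xp; move/cvgrPdist_le/(_ _ e2) : yq => yq.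
near=> n; apply: (@le_trans _ _ (`|p - x n| + `|q - y n|)%:C%C).
  exact: normc_le_add.
rewrite (complexE e) ie mulr0 addr0 lecR.
have : `|p - x n| <= complex.Re e / 2 by near: n.
have : `|q - y n| <= complex.Re e / 2 by near: n.
lra.
Unshelve. all: by end_near. Qed.

Lemma cvg_of_tail_bound x (V : nat -> R) :
  (forall M N, (2 <= M <= N)%N -> `|x N - x M| <= V M) -> V n @[n --> \oo] --> (0:R) ->
  exists2 l, x n @[n --> \oo] --> l & forall M, (2 <= M)%N -> `|l - x M| <= V M.
Proof.
move=> xV V0.
have cx : cvgn x.
  apply/cauchy_cvgP/cauchy_ballP => e e0.
  have e4 : 0 < e / 4 by rewrite divr_gt0.
  move/cvgrPdist_le/(_ _ e4) : V0 => [N _ NP].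
  pose M := maxn N 2.
  have VM : V M <= e / 4.
    have := NP M (leq_maxl _ _); rewrite /= sub0r normrN; exact: le_trans (ler_norm _).
  exists (x @` [set n | (M <= n)%N], x @` [set n | (M <= n)%N]) => /=.
    by split; exists M => // n Mn; exists n.
  move=> [_ _] /= [[n Mn <-] [m Mm <-]]; rewrite /ball/=.
  have h1 := xV M n; rewrite leq_maxr Mn in h1.
  have h2 := xV M m; rewrite leq_maxr Mm in h2.
  have -> : x n - x m = (x n - x M) - (x m - x M) by lra.
  have := ler_normB (x n - x M) (x m - x M).
  by move: (h1 isT) (h2 isT); lra.
exists (limn x) => // M M2.
have c : `|x N - x M| @[N --> \oo] --> `|limn x - x M|.
  by apply: cvg_norm; apply: cvgB; [exact: cx|exact: cvg_cst].
have H := cvg_lim (@Rhausdorff R) c; rewrite -H.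
apply: limr_le; first by apply: cvgP c.
by exists M => // N /= MN; apply: xV; rewrite M2.
Qed.

End complex_limit.

Section damped_zeta.
Context {R : realType}.
Local Notation mu := (@lebesgue_measure R).
Local Notation mR := (measurableTypeR R).
Implicit Types (a b phi : R -> R) (d s t T : R) (K : set nat) (n N M : nat).

(** The factor n^(-d) that damps the divergent sums. *)
Definition damp d n : R := expR (- (d * ln n%:R)).

Lemma damp_ge0 d n : 0 <= damp d n. Proof. exact: expR_ge0. Qed.

Definition phase_sum phi K d N s : R :=
  \sum_(0 <= n < N | n \in K) damp d n / n%:R * phi (s * ln n%:R).

Definition damp_tail d N : R := damp d N.-1 / d.

(** n^(-1-d) is at most the decrement of n^(-d) / d, by e^x >= 1 + x. *)
Lemma damp_term_le d n : 0 < d -> (2 <= n)%N ->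
  damp d n / n%:R <= damp_tail d n - damp_tail d n.+1.
Proof.
move=> d0; case: n => // -[//|m] _; rewrite /damp_tail /=.
set n := m.+2.
have n0 : (0:R) < n%:R by rewrite ltr0n.
have m0 : (0:R) < m.+1%:R by rewrite ltr0n.
have L : n%:R^-1 <= ln n%:R - ln m.+1%:R :> R.
  have : ln (m.+1%:R / n%:R) <= m.+1%:R / n%:R - 1 :> R.
    by rewrite -[X in _ <= X - 1](lnK) ?posrE ?divr_gt0// lerBrDl expR_ge1Dx.
  rewrite ln_div ?posrE//.
  have -> : m.+1%:R / n%:R - 1 = - n%:R^-1 :> R.
    have F (p : R) : p + 1 != 0 -> p / (p + 1) - 1 = - (p + 1)^-1 by move=> ?; field.
    by rewrite /n -(natr1 m.+1) F// natr1 gt_eqF.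
  by move: (n%:R^-1) (ln _) (ln _) => p q r; lra.
have E : damp d m.+1 = damp d n * expR (d * (ln n%:R - ln m.+1%:R)).
  by rewrite /damp -expRD; congr expR; ring.
rewrite -mulrBl ler_pdivlMr// E.
have h1 := expR_ge1Dx (d * (ln n%:R - ln m.+1%:R)).
have h := damp_ge0 d n.
have h2 : d * n%:R^-1 <= d * (ln n%:R - ln m.+1%:R) by rewrite ler_pM2l.
have F (p q r u : R) : 0 <= p -> d * r <= u -> 1 + u <= q -> p * r * d <= p * q - p.
  by clear; nra.
exact: F h h2 h1.
Qed.

Lemma damp_tail_ge0 d N : 0 < d -> 0 <= damp_tail d N.
Proof. by move=> d0; rewrite divr_ge0 ?damp_ge0// ltW. Qed.

Lemma damp_tail_cvg d : 0 < d -> damp_tail d N @[N --> \oo] --> (0:R).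
Proof.
move=> d0; apply/cvgrPdist_le => e e0.
have ed : 0 < e * d by rewrite mulr_gt0.
apply: filterS (nbhs_infty_ger (expR (- ln (e * d) / d) + 1)) => N NP.
rewrite sub0r normrN ger0_norm ?damp_tail_ge0// /damp_tail ler_pdivrMr//.
rewrite /damp -[leRHS]lnK ?posrE// ler_expR.
have eN := expR_gt0 (- ln (e * d) / d).
case: N NP => [|N]; first by move=> h; exfalso; move: h eN; lra.
rewrite -natr1 => NP /=.
have N0 : (0:R) < N%:R by move: NP eN; lra.
have : - ln (e * d) / d <= ln N%:R.
  by rewrite -[leLHS]expRK ler_ln ?posrE//; move: NP; lra.
by rewrite ler_pdivrMr// => h; rewrite lerNl (le_trans h)// mulrC.
Qed.

Lemma phase_sum_tail phi K d s M N : 0 < d -> trig_like phi -> (2 <= M <= N)%N ->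
  `|phase_sum phi K d N s - phase_sum phi K d M s| <= damp_tail d M.
Proof.
move=> d0 [_ phi1] /andP[M2 MN]; rewrite /phase_sum (big_cat_nat (n := M) (p := N))//=.
rewrite addrAC subrr add0r; apply: le_trans (ler_norm_sum _ _ _) _.
apply: (@le_trans _ _ (\sum_(M <= n < N) (damp_tail d n - damp_tail d n.+1))).
  rewrite [leLHS]big_mkcond [leLHS]big_nat_cond [leRHS]big_nat_cond.
  apply: ler_sum => n /andP[/andP[Mn _] _].
  have h := damp_term_le d0 (leq_trans M2 Mn).
  have p0 : 0 <= damp d n / n%:R by rewrite divr_ge0 ?damp_ge0.
  case: ifP => _; last exact: le_trans h.
  by apply: le_trans h; rewrite normrM ger0_norm// ler_piMr.
have -> : \sum_(M <= n < N) (damp_tail d n - damp_tail d n.+1) =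
   - \sum_(M <= n < N) (damp_tail d n.+1 - damp_tail d n).
  by rewrite -sumrN; apply: eq_bigr => n _; rewrite opprB.
rewrite telescope_sumr// opprB lerBlDr lerDl; exact: damp_tail_ge0.
Qed.

Lemma natpow_phase d s n : (0 < n)%N ->
  natpow n (- ((1 + d) +i* s)%C) =
  (damp d n / n%:R * cos (s * ln n%:R) +i* - (damp d n / n%:R * sin (s * ln n%:R)))%C.
Proof.
move=> n0; have n0' : (0:R) < n%:R by rewrite ltr0n.
rewrite /natpow /cexp /= !mulr0 subr0 add0r.
have -> : expR (- (1 + d) * ln n%:R) = damp d n / n%:R :> R.
  rewrite /damp -[X in _ / X](@lnK R n%:R) ?posrE// -expRN -expRD.
  by congr expR; ring.
rewrite mulNr cosN sinN; move: (damp d n / n%:R) (cos _) (sin _) => p q r.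
by apply/eqP; rewrite eq_complex /=; apply/andP; split; apply/eqP; ring.
Qed.

Definition rezeta K d s : R := complex.Re (zeta K ((1 + d) +i* s)%C).

(** The remainder bound is uniform in s, which allows integration against a
    translate. *)
Lemma rezeta_cvg K d s : K `<=` [set n | (0 < n)%N] -> 0 < d ->
  phase_sum cos K d N s @[N --> \oo] --> rezeta K d s /\
  forall M, (2 <= M)%N -> `|rezeta K d s - phase_sum cos K d M s| <= damp_tail d M.
Proof.
move=> hK d0.
have [lc cc cb] := cvg_of_tail_bound
  (fun M N => @phase_sum_tail cos K d s M N d0 trig_cos) (damp_tail_cvg d0).
have [ls cs _] := cvg_of_tail_bound
  (fun M N => @phase_sum_tail sin K d s M N d0 trig_sin) (damp_tail_cvg d0).
suff -> : rezeta K d s = lc by [].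
have c := complex_cvg cc (cvgN (FF := eventually_filter) cs).
rewrite /rezeta /zeta.
have -> : (fun N => \sum_(0 <= n < N | n \in K) natpow n (- ((1 + d) +i* s)%C)
    : (R[i] : numFieldType)) =
  (fun N => (phase_sum cos K d N s +i* - phase_sum sin K d N s)%C).
  apply/funext => N; rewrite /phase_sum -sumrN.
  have add (p q r u : R) : (p +i* q)%C + (r +i* u)%C = ((p + r) +i* (q + u))%C by [].
  elim: (index_iota 0 N) => [|n l ih]; first by rewrite !big_nil.
  rewrite !big_cons; case: ifPn => // nK; rewrite ih natpow_phase//.
  by move: nK; rewrite inE => /hK.
by rewrite (cvg_lim (@norm_hausdorff _ (R[i] : numFieldType)) c).
Qed.

End damped_zeta.

Section zeta_operator.
Context {R : realType}.
Local Notation mu := (@lebesgue_measure R).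
Local Notation mR := (measurableTypeR R).
Implicit Types (a b : R -> R) (g h : R -> R[i]) (d s t : R) (n N M : nat).

Lemma sqn_bounded (T : R) f (B : R) : 0 < T -> measurable_fun setT f -> supp T f ->
  (forall x, `|f x| <= B) -> sqint f /\ sqn f <= 2 * T * B ^+ 2.
Proof.
move=> T0 mf sf fB; have hf := bounded_sqint mf sf fB; split => //.
rewrite sqnER mulrC -(chi_itv_int T0) -(RintegralZl (B ^+ 2) measurableT (chi_itv_integrable T)).
apply: le_Rintegral => //; first exact: hf.2.
  exact: integrableZr_fun (chi_itv_integrable T).
move=> x _; have [xT|xT] := pselect (`]- T, T[%classic x); last first.
  by rewrite sf// expr0n/= mulr_ge0 ?sqr_ge0 ?chi_itv_ge0.
rewrite chi_itv1 ?mulr1//.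
rewrite -real_normK ?num_real// ler_pXn2r ?nnegrE//.
exact: le_trans (normr_ge0 _) (fB x).
Qed.

Variables (K : set nat) (T : R).
Hypotheses (hK : K `<=` [set n | (0 < n)%N]) (T0 : 0 < T).

Definition zconv d a t : R := \int[mu]_u (a u * rezeta K d (t - u)).

Definition Zapp d g : R -> R[i] := fun t =>
  (\1_([set` `]- T, T[]) t / pi)%:C%C *
  cintegral [set` `]- T, T[] (fun tau =>
    g tau * (complex.Re (zeta K ((1 + d) +i* (t - tau))%C))%:C%C).

Lemma supp_Rintegral (f : R -> R) : supp T f ->
  \int[mu]_(x in [set` `]- T, T[]) f x = \int[mu]_x f x.
Proof.
move=> sf; rewrite [LHS]Rintegral_mkcond; apply: eq_Rintegral => x _.
rewrite patchE; case: (boolP (x \in _)) => // xT; rewrite sf// => xT'.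
by move: xT; rewrite notin_setE.
Qed.

Lemma Zapp_reim d g : csupp T g ->
  re (Zapp d g) = (fun t => chi_itv T t / pi * zconv d (re g) t) /\
  im (Zapp d g) = (fun t => chi_itv T t / pi * zconv d (im g) t).
Proof.
move=> /csuppP[sr si].
have s1 (a : R -> R) t : supp T a -> supp T (fun u => a u * rezeta K d (t - u)).
  by move=> sa x xT; rewrite sa// mul0r.
split; apply/funext => t; rewrite /re /im /Zapp /cintegral /= /zconv.
  rewrite mul0r subr0 -(supp_Rintegral (s1 _ t sr)) /chi_itv.
  apply: (congr1 (fun z => _ * z)); apply: eq_Rintegral => x _.
  by rewrite /re /rezeta; case: (g x) => p q /=; rewrite mulr0 subr0.
rewrite mul0r addr0 -(supp_Rintegral (s1 _ t si)) /chi_itv.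
apply: (congr1 (fun z => _ * z)); apply: eq_Rintegral => x _.
by rewrite /im /rezeta; case: (g x) => p q /=; rewrite mulr0 add0r.
Qed.

(** The addition formula for cos ((t - u) ln n) separates the variables. *)
Lemma phase_conv d N a t : sqint a -> supp T a ->
  chi_itv T t / pi * (\int[mu]_u (a u * phase_sum cos K d N (t - u))) =
  Kop K T (damp d) N a t.
Proof.
move=> ha sa.
pose w n := damp d n / n%:R.
pose G n := ((w n * cos (t * ln n%:R)) \*o wave T cos (ln n%:R)) \+
            ((w n * sin (t * ln n%:R)) \*o wave T sin (ln n%:R)).
have hc n := wave_sqint (ln n%:R) T0 (@trig_cos R).
have hs n := wave_sqint (ln n%:R) T0 (@trig_sin R).
have hG n : sqint (G n) by apply: sqintD; exact: sqintZ.
have -> : \int[mu]_u (a u * phase_sum cos K d N (t - u)) =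
    dot (fun u => \sum_(0 <= n < N | n \in K) G n u) a.
  apply: eq_Rintegral => u _.
  rewrite -{1}(supp_indic sa u) mulrAC mulrC (mulrC _ (a u)).
  apply: (congr1 (fun z => a u * z)); rewrite /phase_sum big_distrr /=.
  apply: eq_bigr => n _; rewrite /G /wave /chi_itv /= -/(w n) mulrBl cosB.
  move: (\1__ _) (w n) (cos _) (sin _) (cos _) (sin _) => p q r x y z; ring.
rewrite dot_suml// big_distrr /Kop /=; apply: eq_bigr => n _.
rewrite dotDl; [|exact: sqintZ|exact: sqintZ|exact: ha].
rewrite (dotZl _ (hc n) ha) (dotZl _ (hs n) ha).
rewrite /kterm /= /ct /st -(dot_wave cos _ sa) -(dot_wave sin _ sa) /wave -/(w n).
have cpi : pi^-1 = 2 * c0 ^+ 2 :> R.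
  by rewrite c0_sqr invfM mulrA mulfV ?mul1r.
rewrite cpi; move: (chi_itv T t) (w n) (cos _) (sin _) (dot _ _) (dot _ _) c0.
move=> p q r x y z c; ring.
Qed.

Lemma phase_sum_measurable d N : measurable_fun setT (fun s => phase_sum cos K d N s).
Proof.
rewrite /phase_sum; under eq_fun do rewrite big_mkcond.
pose F (n : nat) (s : R) := if n \in K then damp d n / n%:R * cos (s * ln n%:R) else 0.
apply: (@measurable_sum _ mR R setT _ (index_iota 0 N) F) => n; rewrite /F.
case: (n \in K); last exact: measurable_cst.
by apply: measurable_funM => //; apply: trig_meas; exact: trig_cos.
Qed.

Lemma rezeta_measurable d : 0 < d -> measurable_fun setT (rezeta K d).
Proof.
move=> d0; apply: (@measurable_fun_cvg _ _ _ _ (fun N s => phase_sum cos K d N s)).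
  by move=> N; exact: phase_sum_measurable.
by move=> s _; have [] := rezeta_cvg s hK d0.
Qed.

Lemma rezeta_bounded d : 0 < d -> exists B : R, forall s, `|rezeta K d s| <= B.
Proof.
move=> d0; exists (damp_tail d 2 + \sum_(0 <= n < 2 | n \in K) damp d n / n%:R) => s.
have [_ /(_ 2 isT) h] := rezeta_cvg s hK d0.
rewrite -[rezeta K d s](subrK (phase_sum cos K d 2 s)).
apply: le_trans (ler_normD _ _) _; apply: lerD => //.
apply: le_trans (ler_norm_sum _ _ _) _; apply: ler_sum => n _.
by rewrite normrM ger0_norm ?divr_ge0 ?damp_ge0// ler_piMr ?divr_ge0 ?damp_ge0// cos_max.
Qed.

Lemma zconv_diff d N a t : 0 < d -> (2 <= N)%N -> sqint a -> supp T a ->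
  `|chi_itv T t / pi * zconv d a t - Kop K T (damp d) N a t| <=
  damp_tail d N * ((\int[mu]_u `|a u|) / pi).
Proof.
move=> d0 N2 ha sa; have ia := supp_integrable ha sa.
have [B hB] := rezeta_bounded d0.
have mz : measurable_fun setT (fun u : R => rezeta K d (t - u)).
  apply: (measurableT_comp (rezeta_measurable d0) (g := fun u : mR => t - u)).
  exact: measurable_funB.
have mp : measurable_fun setT (fun u : R => phase_sum cos K d N (t - u)).
  apply: (measurableT_comp (phase_sum_measurable d N) (g := fun u : mR => t - u)).
  exact: measurable_funB.
have [_ tail] : True /\ forall s, `|rezeta K d s - phase_sum cos K d N s| <= damp_tail d N.
  by split=> // s; have [_] := rezeta_cvg s hK d0; exact.
have i1 := integrable_bddM ia mz (fun u => hB (t - u)).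
have i2 : mu.-integrable setT (EFin \o (fun u => a u * phase_sum cos K d N (t - u))).
  apply: (integrable_bddM (M := damp_tail d N + B) ia mp) => u.
  rewrite -(subrK (rezeta K d (t - u)) (phase_sum cos K d N (t - u))).
  apply: le_trans (ler_normD _ _) _; apply: lerD; last exact: hB.
  by rewrite distrC; exact: tail.
have i3 := integrableB measurableT i1 i2.
have V0 := damp_tail_ge0 N d0.
have D : `|zconv d a t - \int[mu]_u (a u * phase_sum cos K d N (t - u))| <=
    damp_tail d N * \int[mu]_u `|a u|.
  rewrite /zconv -(RintegralB measurableT i1 i2).
  apply: le_trans (le_normr_Rintegral measurableT i3) _.
  have ina := integrable_norm ia.
  rewrite -(RintegralZl (damp_tail d N) measurableT ina).
  apply: le_Rintegral => //.
  - exact: integrable_norm i3.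
  - exact: integrableZr_fun ina.
  move=> u _; rewrite -mulrBr normrM mulrC.
  by rewrite ler_wpM2r.
rewrite -phase_conv// -mulrBr normrM.
have p0 := pi_gt0 R.
have C1 : `|chi_itv T t / pi| <= pi^-1.
  case: (chi_itv_cases T t) => ->; first by rewrite mul0r normr0 invr_ge0 ltW.
  by rewrite mul1r ger0_norm// invr_ge0 ltW.
rewrite mulrA [leRHS]mulrC; apply: ler_pM => //.
Qed.

Lemma zconv_supp d a : supp T (fun t => chi_itv T t / pi * zconv d a t).
Proof. by move=> x xT; rewrite chi_itv0// !mul0r. Qed.

Lemma zconv_sqn d N a : 0 < d -> (2 <= N)%N -> sqint a -> supp T a ->
  let u := fun t => chi_itv T t / pi * zconv d a t in
  sqint u /\ sqn (u \- Kop K T (damp d) N a) <=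
    2 * T * (damp_tail d N * ((\int[mu]_u `|a u|) / pi)) ^+ 2.
Proof.
move=> d0 N2 ha sa u.
have mu' : measurable_fun setT u.
  apply: (@measurable_fun_cvg _ _ _ _ (fun N => Kop K T (damp d) N a)).
    by move=> M; exact: sqint_meas (Kop_sqint _ _ _ _ T0).
  move=> t _; apply/cvgrPdist_le => e e0.
  have c : damp_tail d M * ((\int[mu]_u `|a u|) / pi) @[M --> \oo] --> (0:R).
    rewrite -[X in _ --> X](mul0r ((\int[mu]_u `|a u|) / pi)).
    by apply: cvgM; [exact: damp_tail_cvg|exact: cvg_cst].
  move/cvgrPdist_le/(_ _ e0) : c; apply: filterS2 (nbhs_infty_ge 2) => M M2.
  rewrite sub0r normrN => /(le_trans (ler_norm _)); apply: le_trans.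
  exact: zconv_diff.
have hk := Kop_sqint K (damp d) N a T0.
have mD : measurable_fun setT (u \- Kop K T (damp d) N a).
  by apply: measurable_funB => //; exact: sqint_meas hk.
have sD : supp T (u \- Kop K T (damp d) N a).
  by apply: suppB; [exact: zconv_supp|exact: Kop_supp].
have [hD le] := sqn_bounded T0 mD sD (fun t => zconv_diff t d0 N2 ha sa).
split => //.
have -> : u = (u \- Kop K T (damp d) N a) \+ Kop K T (damp d) N a.
  by apply/funext => t /=; rewrite subrK.
exact: sqintD.
Qed.

Section with_function.
Variable g : R -> R[i].
Hypotheses (hg : csq g) (sg : csupp T g).
Let s1 := (csuppP sg).1.
Let s2 := (csuppP sg).2.

Lemma Zapp_csq d : 0 < d -> csq (Zapp d g).
Proof.
move=> d0; rewrite /csq !(Zapp_reim d sg).1 !(Zapp_reim d sg).2.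
by split; [case: (zconv_sqn d0 (leqnn 2) hg.1 s1)|case: (zconv_sqn d0 (leqnn 2) hg.2 s2)].
Qed.

Lemma Zapp_CK d : 0 < d ->
  csqn (Zapp d g \- CK K T (damp d) N g) @[N --> \oo] --> (0:R).
Proof.
move=> d0; pose A (a : R -> R) := (\int[mu]_u `|a u|) / pi.
pose S N := 2 * T * (damp_tail d N * A (re g)) ^+ 2 + 2 * T * (damp_tail d N * A (im g)) ^+ 2.
have S0 : S N @[N --> \oo] --> (0:R).
  have z (c : R) : 2 * T * (damp_tail d N * c) ^+ 2 @[N --> \oo] --> (0:R).
    rewrite -[X in _ --> X](mulr0 (2 * T)); apply: cvgM; first exact: cvg_cst.
    rewrite -[X in _ --> X](mul0r 0).
    by apply: cvgM; rewrite -[X in _ --> X](mul0r c);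
      (apply: cvgM; [exact: damp_tail_cvg|exact: cvg_cst]).
  by rewrite -[X in _ --> X](addr0 0); apply: cvgD; exact: z.
apply/cvgrPdist_le => e e0; move/cvgrPdist_le/(_ _ e0) : S0.
apply: filterS2 (nbhs_infty_ge 2) => N N2.
rewrite !sub0r !normrN => /(le_trans (ler_norm _)); apply: le_trans.
rewrite ger0_norm ?csqn_ge0// csqnE reB imB.
rewrite (Zapp_reim d sg).1 (Zapp_reim d sg).2.
by apply: lerD; [case: (zconv_sqn d0 N2 hg.1 s1)|case: (zconv_sqn d0 N2 hg.2 s2)].
Qed.

End with_function.
End zeta_operator.

(** * Quadratic form of the zeta operator *)

Lemma damp_budget (R : realType) (e x1 x2 x3 x4 x5 b u v : R) : 0 < e ->
  u * (16 * b) <= e -> 16 * b * v <= e ->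
  x1 <= e / 32 -> x2 <= e / 32 -> x3 <= 2 * x1 + 2 * x4 -> x4 <= 2 * x5 + 2 * x2 ->
  x5 <= b * (v + u) -> x3 <= e.
Proof. nra. Qed.

Section zeta_form.
Context {R : realType}.
Implicit Types (a b : R -> R) (g h : R -> R[i]) (d : R) (n N M : nat).
Variables (K : set nat) (T : R).
Hypotheses (hK : K `<=` [set n | (0 < n)%N]) (T0 : 0 < T).

Lemma damp_sqr_le d n : 0 < d -> (damp d n - 1) ^+ 2 <= 1 /\
  (damp d n - 1) ^+ 2 <= d * ln n%:R.
Proof.
move=> d0; have l0 := @ln_nat_ge0 R n.
have x0 : 0 <= d * ln n%:R by rewrite mulr_ge0// ltW.
have h := damp_ge0 d n.
have h1 : damp d n <= 1 by rewrite /damp expR_le1 oppr_le0.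
have h2 : 1 - d * ln n%:R <= damp d n by exact: expR_ge1Dx.
move: h h1 h2 x0; move: (damp d n) (d * _) => p q; clear; split; nra.
Qed.

Section with_function.
Variable g : R -> R[i].
Hypotheses (hg : csq g) (sg : csupp T g).

Lemma CK_damp_le d M N z : 0 < d -> (M <= N)%N -> czpart K N g <= z ->
  csqn (CK K T (damp d) N g \- CK K T (fun=> 1) N g) <=
  4 * bessel T * (d * (\sum_(0 <= n < M | n \in K) ln n%:R * cpoint g n) +
                  (z - czpart K M g)).
Proof.
move=> d0 MN zN; rewrite CKB; apply: le_trans (CK_csqn_le hK T0 hg sg _ _) _.
rewrite ler_wpM2l//; first by rewrite mulr_ge0// ltW// bessel_gt0.
rewrite [leLHS](big_cat_nat (n := M))//= big_distrr /=; apply: lerD.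
  apply: ler_sum => n _; rewrite mulrA ler_wpM2r ?cpoint_ge0//.
  by have [] := damp_sqr_le n d0.
move: zN; rewrite lerBrDl /czpart (big_cat_nat (n := M) (p := N))//=; apply: le_trans.
rewrite lerD2l; apply: ler_sum => n _.
by rewrite ler_piMl ?cpoint_ge0//; have [] := damp_sqr_le n d0.
Qed.

(** Convergence is uniform in the damping parameter: the tail of the Bessel sum
    controls the high frequencies, and finitely many low ones remain. *)
Lemma Zapp_cvg h : csq h -> cvg2 (fun N => CK K T (fun=> 1) N g) h ->
  csqn (Zapp K T d g \- h) @[d --> 0^'+] --> (0:R).
Proof.
move=> hh hc; have [z cz zle] := czpart_cvg hK T0 hg sg.
have [B BE B0] : exists2 B, B = 4 * bessel T & 0 < B.
  by exists (4 * bessel T) => //; rewrite mulr_gt0// bessel_gt0.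
apply/cvgrPdist_le => e e0.
have e1 : 0 < e / (16 * B) by rewrite divr_gt0// mulr_gt0.
move/cvgrPdist_le/(_ _ e1) : cz => [M _ /(_ M (leqnn M))/=].
move=> /(le_trans (ler_norm _)); rewrite ler_pdivlMr ?mulr_gt0// => zM.
pose D := \sum_(0 <= n < M | n \in K) ln n%:R * cpoint g n.
have D0 : 0 <= D.
  by apply: sumr_ge0 => n _; rewrite mulr_ge0 ?cpoint_ge0 ?ln_nat_ge0.
have d1 : 0 < e / (16 * B * (D + 1)) by rewrite divr_gt0// mulr_gt0 ?ltr_wpDl// mulr_gt0.
near=> d.
have d0 : 0 < d by near: d; exact: nbhs_right_gt.
have dD : 16 * B * (d * D) <= e.
  have : d <= e / (16 * B * (D + 1)) by near: d; exact: nbhs_right_le.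
  rewrite ler_pdivlMr; last by rewrite mulr_gt0 ?ltr_wpDl// mulr_gt0.
  apply: le_trans; have : 0 <= d * B by rewrite mulr_ge0// ltW.
  rewrite mulrCA => _; apply: ler_wpM2l; first exact: ltW.
  by rewrite ler_pM2l ?mulr_gt0// lerDl.
rewrite sub0r normrN ger0_norm ?csqn_ge0//.
have e32 : 0 < e / 32 by rewrite divr_gt0.
have := Zapp_CK hK T0 hg sg d0 => /cvgrPdist_le/(_ _ e32)[N1 _ P1].
move/cvgrPdist_le/(_ _ e32) : hc => [N2 _ P2].
pose N := maxn M (maxn N1 N2).
have MN : (M <= N)%N by exact: leq_maxl.
have N1N : (N1 <= N)%N by rewrite /N maxnCA leq_maxl.
have N2N : (N2 <= N)%N by rewrite /N !leq_max leqnn !orbT.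
have := P1 N N1N; have := P2 N N2N; rewrite /= !sub0r !normrN => q2 q1.
have r1 := le_trans (ler_norm _) q1; have r2 := le_trans (ler_norm _) q2.
have hZ := Zapp_csq hK T0 hg sg d0.
have hw := CK_csq K T0 (damp d) N g; have h1 := CK_csq K T0 (fun=> 1) N g.
have t1 := csqn_triangle hZ hw hh; have t2 := csqn_triangle hw h1 hh.
have t3 := CK_damp_le d0 MN (zle N).
apply: damp_budget e0 zM dD r1 r2 t1 t2 _; rewrite BE; exact: t3.
Unshelve. all: by end_near. Qed.

Local Notation Z := (Zop K [set` `]- T, T[] g).

(** The undamped partial operators converge, and their limit is also the limit of
    the damped operators as the damping is removed. *)
Lemma Zop_spec : [/\ csq Z, 2 * czpart K N g @[N --> \oo] --> cdot Z g &
  csqn Z <= 2 * bessel T * cdot Z g].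
Proof.
have [h [hh sh hc]] := CK_cvg hK T0 hg sg.
have c := Zapp_cvg hh hc.
have near_csq : \forall d \near 0^'+, csq (Zapp K T d g).
  by near=> d; apply: Zapp_csq => //; near: d; exact: nbhs_right_gt.
have [hZ _ cZ] := L2lim_csq near_csq hh sh c.
have Zh : csqn (Z \- h) = 0.
  have s0 : 2 * csqn (Zapp K T d g \- Z) + 2 * csqn (Zapp K T d g \- h) @[d --> 0^'+] --> (0:R).
    rewrite -[X in _ --> X](addr0 0).
    by apply: cvgD; rewrite -[X in _ --> X](mulr0 2); apply: cvgM => //; exact: cvg_cst.
  apply/eqP; rewrite eq_le csqn_ge0 andbT; apply/ler_addgt0Pr => e e0; rewrite add0r.
  move/cvgrPdist_le/(_ _ e0) : s0 => s0.
  have [d [dZ dle]] := @filter_ex _ _ (at_right_proper_filter (0:R)) _ (filterI near_csq s0).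
  move: dle; rewrite sub0r normrN => /(le_trans (ler_norm _)).
  apply: le_trans; rewrite (csqn_sub_sym dZ hZ); exact: csqn_triangle.
have c1 : 2 * czpart K N g @[N --> \oo] --> cdot Z g.
  rewrite (csqn0_cdot hZ hh hg Zh).
  have := cvg2_cdot (fun N => CK_csq K T0 (fun=> 1) N g) hh hg hc.
  by rewrite (_ : (fun N => cdot _ g) = (fun N => 2 * czpart K N g))//;
    apply/funext => N; exact: CK_cdot.
split => //; rewrite (csqn0_csqn hZ hh Zh).
have c2 := cvg2_csqn (fun N => CK_csq K T0 (fun=> 1) N g) hh hc.
have c3 : 2 * bessel T * (2 * czpart K N g) @[N --> \oo] --> 2 * bessel T * cdot Z g.
  by apply: cvgM => //; exact: cvg_cst.
apply: (ler_cvg_to c2 c3); apply: nearW => N.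
apply: le_trans (CK_csqn_le hK T0 hg sg _ _) _.
have -> : 2 * bessel T * (2 * czpart K N g) = 4 * bessel T * czpart K N g by ring.
have -> : czpart K N g = \sum_(0 <= n < N | n \in K) 1 ^+ 2 * cpoint g n.
  by apply: eq_bigr => n _; rewrite expr1n mul1r.
exact: lexx.
Unshelve. all: by end_near. Qed.

End with_function.

Lemma Zeta_form : bounded_below [set` `]- T, T[] (Zop K [set` `]- T, T[]) <->
  form_below T (Zform K).
Proof.
have B0 : 0 < 2 * bessel T by rewrite mulr_gt0// bessel_gt0.
rewrite (@bounded_below_form R _ _ (fun g => cdot (Zop K [set` `]- T, T[] g) g) _ B0); last first.
  by move=> g /L2_csq[hg sg]; have [] := Zop_spec hg sg.
apply: form_belowP => [|g /L2_csq[hg sg]].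
  by rewrite /Zform eseries0// => n _ _; rewrite energy0 mul0r.
have [_ c _] := Zop_spec hg sg.
rewrite /Zform -nneseriesD; first last.
- by move=> n _ _; rewrite lee_fin divr_ge0 ?energy_ge0.
- by move=> n _ _; rewrite lee_fin divr_ge0 ?energy_ge0.
rewrite -nneseriesZl; last first.
  by move=> n _; rewrite -EFinD lee_fin addr_ge0 ?divr_ge0 ?energy_ge0.
apply/esym/cvg_lim => //.
have -> : (fun N => \sum_(0 <= n < N | n \in K) (2%:E *
    ((energy (re g) (ln n%:R) / n%:R)%:E + (energy (im g) (ln n%:R) / n%:R)%:E)))%E =
    (fun N => (2 * czpart K N g)%:E).
  apply/funext => N; rewrite /czpart big_distrr -sumEFin; apply: eq_bigr => n _.
  rewrite -EFinD -EFinM; apply: (congr1 (fun z => (2 * z)%:E)).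
  by rewrite -mulrDl.
by apply: cvg_EFin => //; exact: nearW.
Qed.

End zeta_form.

(** * Interpolation *)

Section interpolation.
Context {R : realType}.
Implicit Types (u F : nat -> R -> R) (p q x y : R) (s : seq R) (d n : nat).

Definition deriv_chain u : Prop := forall i x, is_derive x (1:R) (u i) (u i.+1 x).

Lemma rolle_interlace (f g : R -> R) q s x : (forall y, is_derive y (1:R) f (g y)) ->
  path <%R x s -> f x = 0 -> (forall y, y \in s -> f y = 0 /\ y <= q) ->
  exists s', [/\ size s' = size s, path <%R x s' &
    forall y, y \in s' -> g y = 0 /\ y <= q].
Proof.
move=> df; elim: s x => [|y s ih] x /=; first by exists [::].
move=> /andP[xy ys] fx fs.
have [fy yq] := fs y (mem_head _ _).
have [|c cxy dc] := Rolle xy _ (continuous_subspaceT (is_derive_continuous df)) (etrans fx (esym fy)).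
  by move=> z _; have [] := df z.
move: cxy; rewrite in_itv/= => /andP[xc cy].
have [|s' [ss' ys' gs']] := ih y ys fy; first by move=> z zs; apply: fs; rewrite inE zs orbT.
exists (c :: s'); split => /=; first by rewrite ss'.
  rewrite xc/=; case: s' ys' {ss' gs'} => //= z s' /andP[yz ->].
  by rewrite (lt_trans cy).
move=> z; rewrite inE => /predU1P[->|]; last exact: gs'.
split; last by rewrite (le_trans (ltW cy)).
by have [_ <-] := df c; have [_ ->] := dc.
Qed.

(** Rolle's theorem, applied repeatedly, turns n+1 zeros of F_0 into one zero of
    F_n. *)
Lemma rolle_chain F p q s : deriv_chain F -> sorted <%R s -> s != [::] ->
  (forall y, y \in s -> F 0 y = 0 /\ p <= y <= q) ->
  exists2 y, p <= y <= q & F (size s).-1 y = 0.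
Proof.
case: s => // x s dF /= xs _ F0; have [Fx /andP[px xq]] := F0 x (mem_head _ _).
have {}F0 y : y \in s -> F 0 y = 0 /\ y <= q.
  by move=> ys; have [|-> /andP[]] := F0 y; rewrite ?inE ?ys ?orbT.
elim: {s}(size s) {-2}s (erefl (size s)) F x dF xs Fx px xq F0 => [|n ih] s sn F x dF xs Fx px xq F0.
  by exists x; rewrite ?px// sn.
have [[|z s'] [ss' xs' gs']] := rolle_interlace (dF 0) xs Fx F0.
  by move: ss'; rewrite sn.
move: ss' xs' => /=; rewrite sn => -[ss'] /andP[xz zs'].
have [Fz zq] := gs' z (mem_head _ _).
have := ih s' ss' (fun i => F i.+1) z; rewrite ss'; apply => //.
- by rewrite (le_trans px)// ltW.
- by move=> y ys; apply: gs'; rewrite inE ys orbT.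
Qed.

Lemma derivn_monic (P : {poly R}) d : P \is monic -> size P = d.+1 ->
  P^`(d) = (d`!%:R)%:P.
Proof.
move=> mP sP; apply/polyP => i; rewrite coef_derivn coefC; case: i => [|i].
  by move/monicP: mP; rewrite /lead_coef sP addn0 /= => ->; rewrite ffactnn.
by rewrite nth_default ?mul0rn// sP addnS ltnS leq_addr.
Qed.

Definition node_poly (I : finType) (z : I -> R) (j : I) : {poly R} :=
  \prod_(i <- enum (predC1 j)) ('X - (z i)%:P).

Definition node_gap (I : finType) (z : I -> R) (j : I) : R :=
  \prod_(i | i != j) (z j - z i).

Lemma node_poly_eval (I : finType) (z : I -> R) j x :
  (node_poly z j).[x] = \prod_(i | i != j) (x - z i).
Proof.
rewrite /node_poly big_enum_cond/= horner_prod.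
by apply: eq_big => [i|i _]; rewrite ?andbT// hornerXsubC.
Qed.

(** The top coefficient of the polynomial that interpolates u at d+1 nodes is
    the divided difference of u; the d-th derivatives of u and of this
    polynomial agree somewhere between the nodes. *)
Lemma divided_difference (I : finType) d (z : I -> R) u p q : #|I| = d.+1 ->
  injective z -> deriv_chain u -> (forall i, p <= z i <= q) ->
  exists2 y, p <= y <= q & u d y = d`!%:R * \sum_j u 0 (z j) / node_gap z j.
Proof.
move=> cI zi du zpq.
pose W := \sum_j (u 0 (z j) / node_gap z j) *: node_poly z j.
have gap0 j : node_gap z j != 0.
  by apply/prodf_neq0 => i ij; rewrite subr_eq0; apply: contra ij => /eqP/zi ->.
have Wz k : W.[z k] = u 0 (z k).
  rewrite /W horner_sum (bigD1 k)//= [X in _ + X]big1 ?addr0.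
    by rewrite hornerZ node_poly_eval -mulrA mulVf ?mulr1//; exact: gap0.
  move=> j jk; rewrite hornerZ node_poly_eval (bigD1 k) 1?eq_sym//=.
  by rewrite subrr mul0r mulr0.
pose F i x := u i x - (W^`(i)).[x].
have dF : deriv_chain F.
  move=> i x; rewrite /F derivnS; apply: is_deriveB; exact: du.
pose s := sort <=%R [seq z i | i <- enum I].
have ss : size s = d.+1 by rewrite size_sort size_map -cardE.
have ls : sorted <%R s by rewrite sort_lt_sorted map_inj_uniq// enum_uniq.
have [|y ys|y ypq Fy] := rolle_chain (p := p) (q := q) dF ls.
- by rewrite -size_eq0 ss.
- move: ys; rewrite mem_sort => /mapP[i _ ->].
  by rewrite /F Wz subrr.
exists y => //; move/eqP: Fy; rewrite ss /= /F subr_eq0 => /eqP ->.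
rewrite /W linear_sum /= horner_sum big_distrr /=; apply: eq_bigr => j _.
rewrite derivnZ hornerZ mulrC derivn_monic ?hornerC//.
  exact: monic_prod_XsubC.
by rewrite size_prod_XsubC -cardE cardC1 cI.
Qed.

(** Solving the divided difference over the nodes and one more point x for the
    value at x. *)
Lemma interpolation_bound d (z : 'I_d.+1 -> R) u p q (B sg x : R) :
  injective z -> deriv_chain u -> (forall i, p <= z i <= q) ->
  0 < sg -> sg <= q - p -> (forall i j, i != j -> sg <= `|z i - z j|) ->
  (forall y, p <= y <= q -> `|u d.+1 y| <= B) -> p <= x <= q ->
  `|u 0 x| <= (q - p) ^+ d.+1 / d.+1`!%:R * B +
    ((q - p) / sg) ^+ d * \sum_j `|u 0 (z j)|.
Proof.
move=> zi du zpq sg0 sgpq sep uB xpq.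
set a := q - p; have a0 : 0 < a by exact: lt_le_trans sgpq.
have B0 : 0 <= B by apply: le_trans (uB x xpq).
have as1 : 1 <= a / sg by rewrite ler_pdivlMr// mul1r.
have t1 : 0 <= a ^+ d.+1 / d.+1`!%:R * B by rewrite mulr_ge0// divr_ge0// exprn_ge0// ltW.
have dist w y : p <= w <= q -> p <= y <= q -> `|w - y| <= a.
  by move=> /andP[? ?] /andP[? ?]; rewrite ler_norml /a; apply/andP; split; lra.
have [[j xj]|xz] := pselect (exists j, x = z j).
  rewrite -[leLHS]add0r; apply: lerD => //.
  rewrite xj (bigD1 j)//= mulrDr -[leLHS]addr0; apply: lerD.
    by rewrite ler_peMl// exprn_ege1.
  by rewrite mulr_ge0 ?exprn_ge0 ?(le_trans _ as1)// sumr_ge0.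
pose Z (i : 'I_d.+2) := if unlift ord0 i is Some j then z j else x.
have Z0 : Z ord0 = x by rewrite /Z unlift_none.
have ZS j : Z (lift ord0 j) = z j by rewrite /Z liftK.
have Zi : injective Z.
  move=> i j; case: (unliftP ord0 i) => [k|] ->; case: (unliftP ord0 j) => [l|] ->;
    rewrite ?Z0 ?ZS// => e.
  - by rewrite (zi _ _ e).
  - by case: xz; exists k.
  - by case: xz; exists l.
have Zpq i : p <= Z i <= q by rewrite /Z; case: unlift.
have [|y ypq uy] := divided_difference (d := d.+1) _ Zi du Zpq; first by rewrite card_ord.
pose om := \prod_(i < d.+1) (x - z i).
pose om' j := \prod_(i < d.+1 | i != j) (x - z i).
have omE j : om = (x - z j) * om' j by rewrite /om (bigD1 j).
have xz0 j : x - z j != 0.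
  by rewrite subr_eq0; apply/eqP => e; apply: xz; exists j.
have om0 : om != 0 by apply/prodf_neq0 => i _; exact: xz0.
have g0 : node_gap Z ord0 = om.
  rewrite /node_gap big_mkcond big_ord_recl eqxx /= mul1r; apply: eq_bigr => i _.
  by rewrite Z0 ZS.
have gS j : node_gap Z (lift ord0 j) = (z j - x) * node_gap z j.
  rewrite /node_gap big_mkcond big_ord_recl /= Z0 ZS; congr (_ * _).
  rewrite [RHS]big_mkcond; apply: eq_bigr => i _.
  by rewrite (inj_eq lift_inj) ZS.
have gz0 j : node_gap z j != 0.
  by apply/prodf_neq0 => i ij; rewrite subr_eq0; apply: contra ij => /eqP/zi ->.
have f0 : d.+1`!%:R != 0 :> R by rewrite gt_eqF// ltr0n fact_gt0.
have ux : u 0 x = om * (u d.+1 y / d.+1`!%:R) + \sum_j u 0 (z j) * (om' j / node_gap z j).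
  rewrite uy mulrAC mulfV// mul1r big_ord_recl g0 Z0 mulrDr mulrCA mulfV// mulr1.
  rewrite -addrA big_distrr -big_split /= big1 ?addr0// => j _.
  have zx0 : z j - x != 0 by rewrite -opprB oppr_eq0.
  have F (v w1 w2 g e : R) : g != 0 -> e != 0 -> w1 = - e * w2 ->
    w1 * (v / (e * g)) + v * (w2 / g) = 0 by move=> ? ? ->; field; apply/andP.
  by rewrite ZS gS; apply: F => //; rewrite opprB -omE.
have om'a j : `|om' j| <= a ^+ d.
  rewrite /om' normr_prod; apply: le_trans (_ : \prod_(i < d.+1 | i != j) a <= _).
    by apply: ler_prod => i _; rewrite normr_ge0 dist.
  by rewrite prodr_const cardC1 card_ord.
have gsg j : sg ^+ d <= `|node_gap z j|.
  rewrite /node_gap normr_prod; apply: le_trans (_ : \prod_(i < d.+1 | i != j) sg <= _).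
    by rewrite prodr_const cardC1 card_ord.
  by apply: ler_prod => i ij; rewrite ltW//= sep// eq_sym.
rewrite ux; apply: le_trans (ler_normD _ _) _; apply: lerD.
  rewrite normrM normrM (omE ord0) normrM exprS -!mulrA; apply: ler_pM => //.
    by apply: dist.
  apply: ler_pM => //.
  rewrite mulrC ger0_norm ?invr_ge0// ler_wpM2l ?invr_ge0//; exact: uB.
apply: le_trans (ler_norm_sum _ _ _) _; rewrite big_distrr /=; apply: ler_sum => j _.
rewrite normrM mulrC ler_wpM2r// normrM normfV expr_div_n ler_pM ?invr_ge0//.
by rewrite lef_pV2 ?posrE ?exprn_gt0// normr_gt0.
Qed.

End interpolation.

(** * Sampling on an interval *)

Section derivative_chains.
Context {R : realType}.
Local Notation mu := (@lebesgue_measure R).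
Local Notation mR := (measurableTypeR R).
Implicit Types (a b : R -> R) (T p q x l sg B : R) (d m n : nat) (c : bool).

Definition mulid a : R -> R := fun x => x * a x.

(** The m-th derivative of ct a (c = true) or st a (c = false): up to sign, a
    transform of x^m a. *)
Fixpoint trig_chain c m a : R -> R :=
  match m with
  | 0 => if c then ct a else st a
  | m'.+1 => if c then \- trig_chain false m' (mulid a) else trig_chain true m' (mulid a)
  end.

Lemma trig_chain_deriv T c a : sqint a -> supp T a ->
  deriv_chain (fun m => trig_chain c m a).
Proof.
move=> ha sa m x; elim: m c a ha sa => [|m ih] c a ha sa.
  by case: c; [exact: ct_is_derive ha sa|exact: st_is_derive ha sa].
have hxa := sqint_mulid ha sa; have sxa : supp T (mulid a) by exact: supp_mull.
by case: c; [exact: is_deriveN (ih false _ hxa sxa)|exact: ih true _ hxa sxa].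
Qed.

Lemma trig_chain_energy m a x :
  trig_chain true m a x ^+ 2 + trig_chain false m a x ^+ 2 = energy (iter m mulid a) x.
Proof.
elim: m a => [|m ih] a //; rewrite iterSr -ih /= sqrrN.
exact: addrC.
Qed.

Lemma iter_mulid T m a : sqint a -> supp T a ->
  [/\ sqint (iter m mulid a), supp T (iter m mulid a) &
      sqn (iter m mulid a) <= (T ^+ 2) ^+ m * sqn a].
Proof.
move=> ha sa; elim: m => [|m [h1 h2 h3]]; first by rewrite mul1r.
split=> /=; [exact: sqint_mulid h1 h2|exact: supp_mull|].
apply: le_trans (sqn_mulid_le h1 h2) _.
by rewrite (exprS (T ^+ 2)) -mulrA ler_wpM2l// sqr_ge0.
Qed.

Lemma sqr_sum_le n (v : 'I_n -> R) : (\sum_i v i) ^+ 2 <= n%:R * \sum_i v i ^+ 2.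
Proof.
have E : \sum_(i < n) \sum_(j < n) (v i ^+ 2 + v j ^+ 2) = 2 * (n%:R * \sum_i v i ^+ 2).
  under eq_bigr do rewrite big_split /= sumr_const card_ord.
  by rewrite big_split /= sumr_const card_ord sumrMnl -mulr2n !mulr_natl.
have : 2 * (\sum_i v i) ^+ 2 <= \sum_(i < n) \sum_(j < n) (v i ^+ 2 + v j ^+ 2).
  rewrite expr2 big_distrl /= big_distrr /=; apply: ler_sum => i _.
  rewrite big_distrr big_distrr /=; apply: ler_sum => j _.
  have := sqr_ge0 (v i - v j); move: (v i) (v j) => s t; clear; nra.
by rewrite E; lra.
Qed.

Lemma sqr_add_bound (A G w t S S2 e k : R) : t <= A * w + G * S ->
  0 <= S -> 0 <= A -> 0 <= G -> 0 <= t -> 0 <= w -> w ^+ 2 = 2 * e ->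
  S ^+ 2 <= k * S2 -> t ^+ 2 <= 4 * A ^+ 2 * e + 2 * k * G ^+ 2 * S2.
Proof.
move=> tw S0 A0 G0 t0 w0 wE SS.
have h1 : t ^+ 2 <= (A * w + G * S) ^+ 2.
  by rewrite ler_pXn2r// nnegrE// addr_ge0// mulr_ge0.
apply: (le_trans h1).
have h2 := sqr_ge0 (A * w - G * S).
have h3 : G ^+ 2 * S ^+ 2 <= G ^+ 2 * (k * S2) by rewrite ler_wpM2l// sqr_ge0.
have -> : 4 * A ^+ 2 * e = 2 * (A ^+ 2 * w ^+ 2) by rewrite wE; ring.
move: h2 h3; rewrite !sqrrD mulrN sqrrN !exprMn.
move: (A ^+ 2 * w ^+ 2) (G ^+ 2) (S ^+ 2) (A * w * _) => P V W U; lra.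
Qed.

Lemma chain_sup_le (u : nat -> R -> R) p l d (E : R) y : deriv_chain u -> 1 <= l ->
  (\int[mu]_(y in `[p, (p + l)%R[) (u d y ^+ 2 + u d.+1 y ^+ 2)%:E <= E%:E)%E ->
  p <= y <= p + l -> u d y ^+ 2 <= 2 * E.
Proof.
move=> du l1 uE ypl.
have := sobolev_sqr (du d) (is_derive_continuous (du d.+1)) ypl.
have -> : p + l - p = l by rewrite addrC addKr.
have l0 : 0 <= 1 + l by rewrite addr_ge0// (le_trans _ l1).
move=> /le_trans/(_ (lee_wpmul2l _ uE)); rewrite -EFinM !lee_fin => /(_ l0).
have : 0 <= E.
  by rewrite -lee_fin (le_trans _ uE)// integral_ge0// => z _; rewrite lee_fin addr_ge0 ?sqr_ge0.
move=> E0 h; rewrite -(ler_pM2l (lt_le_trans ltr01 l1)) (le_trans h)//.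
by rewrite mulrA ler_wpM2r//; move: l1; lra.
Qed.

(** Interpolation at d+1 separated nodes of an interval, applied to both
    transforms of a; the remainder is measured by the energies of two moments
    of a. *)
Lemma block_sampling T a d (z : 'I_d.+1 -> R) p l sg (E : R) x : sqint a -> supp T a ->
  injective z -> (forall i, p <= z i <= p + l) -> 1 <= l -> 0 < sg <= l ->
  (forall i j, i != j -> sg <= `|z i - z j|) ->
  (\int[mu]_(y in `[p, (p + l)%R[)
     (energy (iter d.+1 mulid a) y + energy (iter d.+2 mulid a) y)%:E = E%:E)%E ->
  p <= x <= p + l ->
  energy a x <= 4 * (l ^+ d.+1 / d.+1`!%:R) ^+ 2 * E +
    2 * d.+1%:R * ((l / sg) ^+ d) ^+ 2 * \sum_j energy a (z j).
Proof.
move=> ha sa zi zpl l1 /andP[sg0 sgl] sep IE xpl.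
pose I c := (\int[mu]_(y in `[p, (p + l)%R[)
  (trig_chain c d.+1 a y ^+ 2 + trig_chain c d.+2 a y ^+ 2)%:E)%E.
have pos (u v : R -> R) y : (0 <= (u y ^+ 2 + v y ^+ 2)%:E)%E.
  by rewrite lee_fin addr_ge0 ?sqr_ge0.
have mC c : measurable_fun `[p, (p + l)[
    (fun y => (trig_chain c d.+1 a y ^+ 2 + trig_chain c d.+2 a y ^+ 2)%:E).
  have cu m : continuous (trig_chain c m a).
    exact: is_derive_continuous (trig_chain_deriv c ha sa m).
  apply: (@continuous_EFin_measurable R `[p, (p + l)[) => y.
  by apply: cvgD; apply: cvgM; exact: cu.
have I0 c : (0 <= I c)%E by apply: integral_ge0 => y _; exact: pos.
have IS : (I true + I false = E%:E)%E.
  rewrite -IE /I -ge0_integralD; first last.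
  - exact: (mC false).
  - by move=> y _; exact: pos.
  - exact: (mC true).
  - by move=> y _; exact: pos.
  - exact: measurable_itv.
  apply: eq_integral => y _; rewrite -EFinD -!trig_chain_energy; congr EFin.
  by rewrite addrACA.
have [e eI eE] : exists2 e : bool -> R, (forall c, I c = (e c)%:E) & e true + e false = E.
  have f c : I c \is a fin_num.
    rewrite ge0_fin_numE// (le_lt_trans _ (ltry E))// -IS.
    by case: c; [rewrite leeDl|rewrite leeDr].
  exists (fun c => fine (I c)) => [c|]; first by rewrite fineK.
  by apply: EFin_inj; rewrite EFinD !fineK.
set A := l ^+ d.+1 / _; set G := (l / sg) ^+ d.
have A0 : 0 <= A by rewrite divr_ge0// exprn_ge0// (le_trans _ l1).
have G0 : 0 <= G by rewrite exprn_ge0// divr_ge0// ltW// (lt_le_trans ltr01).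
have bnd c : trig_chain c 0 a x ^+ 2 <=
    4 * A ^+ 2 * e c + 2 * d.+1%:R * G ^+ 2 * \sum_j trig_chain c 0 a (z j) ^+ 2.
  have e0 : 0 <= e c by rewrite -lee_fin -eI.
  have dc := trig_chain_deriv c ha sa.
  have uB y : p <= y <= p + l -> `|trig_chain c d.+1 a y| <= Num.sqrt (2 * e c).
    move=> ypl; rewrite -sqrtr_sqr ler_sqrt ?mulr_ge0//.
    apply: (chain_sup_le dc l1 _ ypl); rewrite -eI; exact: lexx.
  have pl : p + l - p = l by rewrite addrC addKr.
  have sgl' : sg <= p + l - p by rewrite pl.
  have := interpolation_bound zi dc zpl sg0 sgl' sep uB xpl.
  rewrite pl -/A -/G => ux.
  have := sqr_sum_le (fun j => `|trig_chain c 0 a (z j)|).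
  under [X in _ <= _ * X]eq_bigr do rewrite real_normK ?num_real//.
  have s0 : 0 <= \sum_j `|trig_chain c 0 a (z j)| by apply: sumr_ge0.
  have := sqr_sqrtr (mulr_ge0 (ler0n R 2) e0).
  have := sqrtr_ge0 (2 * e c).
  rewrite -(real_normK (num_real (trig_chain c 0 a x))).
  move=> w0 wE SS; exact: sqr_add_bound ux s0 A0 G0 (normr_ge0 _) w0 wE SS.
have := lerD (bnd true) (bnd false); rewrite /= -/(energy a x) -eE.
set S1 := \sum_j _ ^+ 2; set S2 := \sum_j _ ^+ 2.
have -> : \sum_j energy a (z j) = S1 + S2 by rewrite -big_split.
by rewrite addrACA -!mulrDr.
Qed.

End derivative_chains.

(** * Selection of separated nodes *)

Section node_selection.
Context {R : realType}.
Implicit Types (s t : seq nat) (v : nat -> R) (n g D : nat).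

Lemma exists_min s v : s != [::] -> exists2 n, n \in s & forall k, k \in s -> v n <= v k.
Proof.
elim: s => // n s ih _; have [->|s0] := eqVneq s [::].
  by exists n; rewrite ?mem_head// => k; rewrite inE => /eqP ->.
have [m ms mP] := ih s0; have [nm|mn] := leP (v n) (v m).
  exists n; first exact: mem_head.
  move=> k; rewrite inE => /predU1P[->//|/mP]; exact: le_trans.
exists m; first by rewrite inE ms orbT.
by move=> k; rewrite inE => /predU1P[->|/mP//]; exact: ltW.
Qed.

(** Cut an increasing list into 2D groups of g elements and keep the smallest
    value in every other group. *)
Lemma select_nodes g D s v : (0 < g)%N -> sorted ltn s -> (2 * D * g <= size s)%N ->
  (forall n, 0 <= v n) ->
  exists t, [/\ size t = D, {subset t <= s}, sorted (fun a b => (a + g < b)%N) t &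
    g%:R * \sum_(n <- t) v n <= \sum_(n <- s) v n].
Proof.
move=> g0 + + v0; elim: D s => [|D ih] s ss sz.
  exists [::]; split => //; rewrite big_nil mulr0; exact: sumr_ge0.
pose s1 := take g s; pose s2 := take g (drop g s); pose s3 := drop g (drop g s).
have es : s = s1 ++ s2 ++ s3 by rewrite /s1 /s2 /s3 !cat_take_drop.
have sz1 : size s1 = g by rewrite size_takel//; nia.
have sz2 : size s2 = g by rewrite size_takel// size_drop; nia.
have sz3 : (2 * D * g <= size s3)%N by rewrite /s3 !size_drop; nia.
have tr : transitive ltn := ltn_trans.
have ss' := ss; rewrite es in ss'.
have [_ {}ss'] := (cat_sorted2 ss'); have ss23 := ss'.
have [_ ss3] := cat_sorted2 ss'.
have [t [st tsub tsort tle]] := ih s3 ss3 sz3.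
have s10 : s1 != [::] by rewrite -size_eq0 sz1 -lt0n.
have [n0 n0s n0P] := exists_min v s10.
have gap b : b \in s3 -> (n0 + g < b)%N.
  move=> bs; have [i [i0 in0]] : exists i, (i < g)%N /\ nth 0%N s i = n0.
    exists (index n0 s1); rewrite -sz1 index_mem n0s; split => //.
    by rewrite es nth_cat index_mem n0s nth_index.
  have [j [j0 jsz jb]] : exists j, [/\ (2 * g <= j)%N, (j < size s)%N & nth 0%N s j = b].
    exists (2 * g + index b s3)%N; split; first exact: leq_addr.
      have : (index b s3 < size s3)%N by rewrite index_mem.
      by rewrite es !size_cat sz1 sz2; move: (index b s3) (size s3) => u w; lia.
    rewrite es catA nth_cat size_cat sz1 sz2 mul2n -addnn ltnNge leq_addr /=.
    by rewrite addKn nth_index.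
  rewrite -in0 -jb.
  have step k l : (k <= l)%N -> (l < size s)%N -> (nth 0%N s k + (l - k) <= nth 0%N s l)%N.
    elim: l => [|l ihl]; first by rewrite leqn0 => /eqP ->; rewrite subnn addn0.
    rewrite leq_eqVlt => /predU1P[->|kl] ls; first by rewrite subnn addn0.
    have := ihl kl (ltnW ls); have := sorted_ltn_nth tr 0%N ss; rewrite subSn//.
    move=> /(_ l l.+1); rewrite !inE => /(_ (ltnW ls) ls (leqnn _)) /=.
    by rewrite addnS => h1 h2; apply: leq_ltn_trans h2 h1.
  have ij : (i <= j)%N by lia.
  have := step i j ij jsz; lia.
exists (n0 :: t); split => /=; first by rewrite st.
- move=> n; rewrite inE es !mem_cat => /predU1P[->|/tsub ->]; first by rewrite n0s.
  by rewrite !orbT.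
- rewrite path_sortedE ?tsort ?andbT.
    by apply/allP => b /tsub; exact: gap.
  by move=> a b c /=; lia.
rewrite big_cons mulrDr es !big_cat /= addrA; apply: lerD => //.
rewrite -[leLHS]addr0; apply: lerD; last exact: sumr_ge0.
have -> : g%:R * v n0 = \sum_(n <- s1) v n0.
  by rewrite big_const_seq count_predT sz1 iter_addr_0 mulr_natl.
by rewrite big_seq [leRHS]big_seq; apply: ler_sum.
Qed.

End node_selection.

Section sampling.
Context {R : realType}.
Local Notation mu := (@lebesgue_measure R).
Local Notation mR := (measurableTypeR R).
Implicit Types (a : R -> R) (q y : nat -> R) (K : set nat) (n k m D : nat).

(** The quantitative form of the density condition. *)
Definition dense_blocks K (delta eta x0 : R) : Prop := forall X, x0 <= X ->
  exists s, [/\ sorted ltn s, (forall n, n \in s -> K n /\ delta * X < n%:R <= X) &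
    eta * X <= (size s)%:R].

Lemma group_size n D : (0 < D)%N -> (4 * D <= n)%N ->
  [/\ (2 * D * (n %/ (2 * D)) <= n)%N, (0 < n %/ (2 * D))%N &
      (n <= 4 * D * (n %/ (2 * D)))%N].
Proof.
move=> D0 Dn; have D2 : (0 < 2 * D)%N by rewrite muln_gt0.
have g0 : (0 < n %/ (2 * D))%N.
  by rewrite divn_gt0//; apply: leq_trans Dn; rewrite leq_mul2r orbT.
split => //; first by rewrite mulnC leq_divM.
have := ltnW (ltn_ceil n D2); move: (n %/ _)%N g0 => g g0 h; apply: (leq_trans h).
rewrite mulnAC -[4%N]/(2 * 2)%N -mulnA [leqRHS]mulnACA leq_mul//.
by rewrite mul2n -addnn -addn1 leq_add2l.
Qed.

Lemma sum_seq_le_series (q : nat -> R) (P : pred nat) (s : seq nat) : uniq s ->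
  (forall n, n \in s -> P n) -> (forall n, P n -> 0 <= q n) ->
  ((\sum_(n <- s) q n)%:E <= \sum_(n <oo | P n) (q n)%:E)%E.
Proof.
move=> us sP q0; pose N := (\max_(n <- s) n).+1.
apply: le_trans (@nneseries_lim_ge R (fun n => (q n)%:E) P 0 N _); last first.
  by move=> n _ Pn; rewrite lee_fin q0.
rewrite sumEFin lee_fin.
have -> : \sum_(n <- s) q n = \sum_(0 <= n < N | n \in s) q n.
  rewrite -[RHS]big_filter; apply: perm_big; apply: uniq_perm => //.
    exact/filter_uniq/iota_uniq.
  move=> n; rewrite mem_filter mem_index_iota /=; case ns : (n \in s) => //=.
  by rewrite ltnS; apply/esym; rewrite (big_rem n ns) /= leq_maxl.
rewrite big_mkcond [leRHS]big_mkcond; apply: ler_sum => n _.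
case: ifP => [/sP ->//|_]; case: ifP => // Pn; exact: q0.
Qed.

(** One block [p, p + l] with p = k m and l = m: its sampling nodes come from
    integers of K below exp(p + l) - 1, and the loss in passing from all the
    integers of the block to the selected ones is a constant. *)
Lemma block_le T K (delta eta : R) (k m d : nat) a q y (E : R) :
  sqint a -> supp T a -> 0 < delta < 1 -> 0 < eta <= 1 -> (0 < m)%N ->
  K `<=` [set n | (0 < n)%N] ->
  (forall n, K n -> [/\ 0 <= q n, ln n%:R <= y n <= ln n.+1%:R &
    energy a (y n) / n%:R <= 2 * q n]) ->
  let X := expR (k.+1%:R * m%:R) - 1 in
  1 + delta <= delta * expR m%:R -> 4 * d.+1%:R <= eta * X ->
  (exists s, [/\ sorted ltn s, (forall n, n \in s -> K n /\ delta * X < n%:R <= X) &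
    eta * X <= (size s)%:R]) ->
  (\int[mu]_(y in `[(k%:R * m%:R)%R, (k%:R * m%:R + m%:R)%R[)
     (energy (iter d.+1 mulid a) y + energy (iter d.+2 mulid a) y)%:E = E%:E)%E ->
  let sg := eta / (4 * d.+1%:R) in
  exists s, [/\ uniq s,
    (forall n, n \in s -> [/\ K n,
      k%:R * m%:R <= ln n%:R :> R & ln n.+1%:R <= k.+1%:R * m%:R :> R]) &
    forall x, k%:R * m%:R <= x <= k%:R * m%:R + m%:R ->
      energy a x <= 4 * (m%:R ^+ d.+1 / d.+1`!%:R) ^+ 2 * E +
      2 * d.+1%:R * ((m%:R / sg) ^+ d) ^+ 2 * (8 * d.+1%:R / eta) * \sum_(n <- s) q n].
Proof.
move=> ha sa /andP[dl0 dl1] /andP[et0 et1] m0 hK hq X dm dX [s [ss sK sX]] IE sg.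
have D0 : (0:R) < d.+1%:R by rewrite ltr0n.
have X0 : 0 < X.
  rewrite -(pmulr_rgt0 _ et0); apply: lt_le_trans dX; rewrite mulr_gt0//.
pose p : R := k%:R * m%:R; have p0 : 0 <= p by rewrite mulr_ge0.
have pm : p + m%:R = k.+1%:R * m%:R by rewrite /p -natr1 mulrDl mul1r.
have pX : expR p <= delta * X.
  have e1 : 1 <= expR p by rewrite -expR0 ler_expR.
  rewrite /X -pm expRD mulrBr mulr1 mulrCA.
  have : expR p * (1 + delta) <= expR p * (delta * expR m%:R) by rewrite ler_wpM2l// expR_ge0.
  have : delta <= expR p * delta by rewrite ler_peMl// ltW.
  by move: (expR p) (expR m%:R) => u v; lra.
have sP n : n \in s -> [/\ K n, (0 < n)%N, p <= ln n%:R,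
    ln n.+1%:R <= k.+1%:R * m%:R :> R & n%:R <= X].
  move=> ns; have [Kn /andP[n1 n2]] := sK n ns; have n0 := hK _ Kn.
  split => //.
    by rewrite -[leLHS]expRK ler_ln ?posrE ?expR_gt0 ?ltr0n// (le_trans pX)// ltW.
  rewrite -[leRHS]expRK ler_ln ?posrE ?expR_gt0 ?ltr0n//.
  by rewrite -natr1; move: n2; rewrite /X; lra.
pose g := (size s %/ (2 * d.+1))%N.
have szD : (4 * d.+1 <= size s)%N.
  by rewrite -(ler_nat R) natrM; exact: le_trans dX sX.
have [gD g0 gD2] : [/\ (2 * d.+1 * g <= size s)%N, (0 < g)%N & (size s <= 4 * d.+1 * g)%N].
  exact: group_size (ltn0Sn d) szD.
have gX : eta * X <= 4 * d.+1%:R * g%:R.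
  by apply: le_trans sX _; rewrite -!natrM ler_nat.
have sg0 : 0 < sg by rewrite divr_gt0// mulr_gt0.
have m1 : (1:R) <= m%:R by rewrite ler1n.
have D1 : (1:R) <= d.+1%:R by rewrite ler1n.
have sgm : sg <= m%:R.
  apply: le_trans m1; rewrite ler_pdivrMr ?mulr_gt0// mul1r.
  by move: et1 D1; lra.
have e0 n : 0 <= energy a (y n) by exact: energy_ge0.
have [t [szt tsub tsort tle]] := select_nodes g0 ss gD e0.
have tn (i : 'I_d.+1) : nth 0%N t i \in s by apply/tsub/mem_nth; rewrite szt.
have tr : transitive (fun b c : nat => (b + g < c)%N).
  by move=> ? ? ? /= h1 h2; exact: ltn_trans (leq_trans h1 (leq_addr g _)) h2.
have gap (i j : 'I_d.+1) : (i < j)%N -> sg <= y (nth 0%N t j) - y (nth 0%N t i).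
  move=> ij; have := sorted_ltn_nth tr 0%N tsort.
  move=> /(_ i j); rewrite !inE szt !ltn_ord => /(_ isT isT ij) /=.
  have [K1 n10 _ _ _] := sP _ (tn i); have [K2 n20 _ _ n2X] := sP _ (tn j).
  have [_ /andP[_ y1] _] := hq _ K1; have [_ /andP[y2 _] _] := hq _ K2.
  move: y1 y2 n10 n20 n2X; move: (nth _ t i) (nth _ t j) => b c y1 y2 b0 c0 cX bgc.
  have c0' : (0:R) < c%:R by rewrite ltr0n.
  have b0' : (0:R) < b.+1%:R by rewrite ltr0n.
  have L : ln (b.+1%:R / c%:R) <= b.+1%:R / c%:R - 1 :> R.
    by rewrite -[X in _ <= X - 1](lnK) ?posrE ?divr_gt0// lerBrDl expR_ge1Dx.
  rewrite ln_div ?posrE// in L.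
  have L2 : sg <= 1 - b.+1%:R / c%:R.
    apply: (@le_trans _ _ (g%:R / c%:R)).
      rewrite ler_pdivrMr ?mulr_gt0// mulrAC ler_pdivlMr//.
      apply: le_trans (_ : eta * X <= _); first by rewrite ler_pM2l.
      by rewrite [leRHS]mulrC.
    rewrite ler_pdivrMr// mulrBl mul1r divfK ?gt_eqF// lerBrDr -natrD ler_nat.
    by rewrite addnS addnC.
  by move: L L2 y1 y2; lra.
have sep (i j : 'I_d.+1) : i != j -> sg <= `|y (nth 0%N t i) - y (nth 0%N t j)|.
  move=> ij; case: (ltngtP i j) => [h|h|/val_inj e]; last by rewrite e eqxx in ij.
    by rewrite distrC; apply: le_trans (gap _ _ h) (ler_norm _).
  exact: le_trans (gap _ _ h) (ler_norm _).
exists s; split.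
- by apply: sorted_uniq ss; [exact: ltn_trans|exact: ltnn].
- by move=> n /sP[? _ ? ? _].
move=> x xp.
have zi : injective (fun i : 'I_d.+1 => y (nth 0%N t i)).
  move=> i j e; apply/eqP; rewrite -[_ == _]negbK; apply/negP => /sep.
  by rewrite e subrr normr0; move: sg0; lra.
have zp (i : 'I_d.+1) : p <= y (nth 0%N t i) <= p + m%:R.
  have [Kn _ h1 h2 _] := sP _ (tn i); have [_ /andP[y1 y2] _] := hq _ Kn.
  by rewrite pm (le_trans h1)//= (le_trans y2).
have sgm' : 0 < sg <= m%:R by rewrite sg0.
apply: le_trans (block_sampling ha sa zi zp m1 sgm' sep IE xp) _.
rewrite lerD2l -[leRHS]mulrA; apply: ler_wpM2l.
  by apply: mulr_ge0; [rewrite mulr_ge0|exact: sqr_ge0].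
have -> : \sum_(j < d.+1) energy a (y (nth 0%N t j)) = \sum_(n <- t) energy a (y n).
  by rewrite (big_nth 0%N) szt big_mkord.
have g0' : (0:R) < g%:R by rewrite ltr0n.
rewrite -(ler_pM2l g0'); apply: (le_trans tle).
have q0 : 0 <= \sum_(n <- s) q n.
  by rewrite big_seq; apply: sumr_ge0 => n /sP[/hq[]].
apply: (@le_trans _ _ (2 * X * \sum_(n <- s) q n)).
  rewrite big_distrr /= big_seq [leRHS]big_seq; apply: ler_sum => n /sP[Kn n0 _ _ nX].
  have [qn _ en] := hq _ Kn; have n0' : (0:R) < n%:R by rewrite ltr0n.
  move: en; rewrite ler_pdivrMr// => /le_trans; apply.
  by rewrite mulrAC ler_wpM2r// ler_pM2l.
rewrite mulrA ler_wpM2r// mulrA ler_pdivlMr//.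
by move: gX; lra.
Qed.

End sampling.

(** * The sampling inequality *)

Section block_sums.
Context {R : realType}.
Local Notation mu := (@lebesgue_measure R).
Local Notation mR := (measurableTypeR R).
Implicit Types (a : R -> R) (q y : nat -> R) (K : set nat) (T l : R) (n k m d : nat).

Lemma exists_nat_ge (B : R) : exists2 m : nat, (0 < m)%N & B <= m%:R.
Proof.
by have [N _ NP] := nbhs_infty_ger B; exists N.+1 => //; exact: NP (leqnSn N).
Qed.

Lemma halfline_blocks l (f : R -> \bar R) : 0 < l -> measurable_fun setT f ->
  (forall x, 0 <= f x)%E ->
  (\int[mu]_(x in halfline) f x =
   \sum_(k <oo) \int[mu]_(x in `[(k%:R * l)%R, (k%:R * l + l)%R[) f x)%E.
Proof.
move=> l0 mf f0; pose J k : set R := [set` `[k%:R * l, k%:R * l + l[].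
have -> : halfline = \bigcup_k J k.
  apply/seteqP; split=> x.
    rewrite /halfline /= in_itv/= andbT => x0.
    have xl : 0 <= x / l by rewrite divr_ge0// ltW.
    have /andP[h1 h2] := truncn_itv xl.
    exists (Num.truncn (x / l)) => //; rewrite /J /= in_itv/=; apply/andP; split.
      by rewrite -ler_pdivlMr.
    by move: h2; rewrite ltr_pdivrMr// -natr1 mulrDl mul1r.
  move=> [k _]; rewrite /J /halfline /= !in_itv/= andbT => /andP[+ _].
  by apply: le_trans; rewrite mulr_ge0// ltW.
rewrite ge0_integral_bigcup//; first by move=> k; exact: measurable_itv.
  exact: measurable_funTS.
apply/trivIsetP => i j _ _ ij; wlog {ij} : i j / (i < j)%N.
  by move=> H; case: (ltngtP i j) ij => // [h|h] _; [|rewrite setIC]; exact: H.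
move=> ij; rewrite -subset0 => x []; rewrite /J /= !in_itv/= => /andP[_ h1] /andP[h2 _].
have : i.+1%:R * l <= j%:R * l by rewrite ler_pM2r// ler_nat.
by rewrite -natr1 mulrDl mul1r; move: h1 h2; lra.
Qed.

(** An integer contributes to at most one interval [k l, (k+1) l]. *)
Lemma series_blocks_le K q l : 0 < l -> K `<=` [set n | (0 < n)%N] ->
  (forall n, K n -> 0 <= q n) ->
  (\sum_(k <oo) \sum_(n <oo | [&& n \in K, (k%:R * l <= ln n%:R)%R & (ln n.+1%:R <= k.+1%:R * l)%R])
     (q n)%:E <= \sum_(n <oo | n \in K) (q n)%:E)%E.
Proof.
move=> l0 hK q0.
pose P k n := [&& n \in K, k%:R * l <= ln n%:R & ln n.+1%:R <= k.+1%:R * l].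
pose f k n : \bar R := (if P k n then q n else 0)%:E.
have f0 k n : (0 <= f k n)%E.
  by rewrite /f lee_fin; case: ifP => // /and3P[nK _ _]; apply: q0; rewrite inE in nK.
have -> : (\sum_(k <oo) \sum_(n <oo | P k n) (q n)%:E = \sum_(k <oo) \sum_(n <oo) f k n)%E.
  apply: eq_eseriesr => k _; rewrite eseries_mkcond; apply: eq_eseriesr => n _.
  by rewrite /f; case: ifP.
rewrite (nneseries_interchange xpredT xpredT f0) [leRHS]eseries_mkcond.
apply: lee_nneseries => [n _ _|n _]; first exact: nneseries_ge0.
case: ifPn => nK; last first.
  by rewrite eseries0// => k _ _; rewrite /f /P (negbTE nK).
have Kn : K n by rewrite inE in nK.
have [[k Pk]|noP] := pselect (exists k, P k n); last first.
  rewrite eseries0 ?lee_fin ?q0// => k _ _; rewrite /f; case: ifP => // Pk.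
  by case: noP; exists k.
rewrite (@nneseriesD1 R (f^~ n) k xpredT)//= eseries0 ?adde0.
  by rewrite /f Pk.
move=> j _ jk; rewrite /f; case: ifP => // Pj; exfalso.
have n0 : (0 < n)%N := hK _ Kn.
have ln_lt : ln n%:R < ln n.+1%:R :> R by rewrite ltr_ln ?posrE ?ltr0n// ltr_nat.
have H i j' : (i < j')%N -> P i n -> P j' n -> False.
  move=> ij /and3P[_ _ h1] /and3P[_ h2 _].
  have : i.+1%:R * l <= j'%:R * l by rewrite ler_pM2r// ler_nat.
  by move: h1 h2 ln_lt; lra.
case: (ltngtP j k) jk => // [h _|h _]; first exact: H h Pj Pk.
exact: H h Pk Pj.
Qed.

(** A factorial beats a geometric sequence whose ratio is proportional to the
    exponent: d^d/d! <= e^d leaves a factor e^(-d). *)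
Lemma pow_fact_le T (N m : nat) : 0 < T -> expR 2 * T <= N%:R -> (0 < N)%N -> (0 < m)%N ->
  (T * m%:R) ^+ (N * m) / (N * m)`!%:R <= expR (- m%:R).
Proof.
move=> T0 TN N0 m0; set D := (N * m)%N.
have D0 : (0 < D)%N by rewrite muln_gt0 N0.
have mD : (m <= D)%N by rewrite leq_pmull.
have f0 : (0:R) < D`!%:R by rewrite ltr0n fact_gt0.
have m0' : (0:R) <= m%:R by [].
have h1 : D%:R ^+ D / D`!%:R <= expR D%:R :> R.
  case: D D0 {mD f0} => // D _; apply: le_trans (expR_ge1Dxn D (ler0n R D.+1)).
  by rewrite lerDr.
have h2 : (expR 2 * T * m%:R) ^+ D <= D%:R ^+ D.
  have h0 : 0 <= expR 2 * T * m%:R by rewrite !mulr_ge0 ?expR_ge0// ltW.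
  rewrite ler_pXn2r ?nnegrE// /D natrM ler_wpM2r//.
have h3 : expR (2 * D%:R) * ((T * m%:R) ^+ D / D`!%:R) <= expR D%:R.
  apply: le_trans h1; rewrite mulrA ler_pM2r ?invr_gt0//.
  by rewrite [2 * _]mulrC expRM_natl -exprMn mulrA.
have h4 : expR D%:R * ((T * m%:R) ^+ D / D`!%:R) <= 1.
  move: h3; set w := _ / D`!%:R; have -> : 2 * D%:R = D%:R + D%:R :> R by ring.
  by rewrite expRD -mulrA -[leRHS]mulr1 ler_pM2l ?expR_gt0.
rewrite expRN; apply: (@le_trans _ _ (expR D%:R)^-1).
  by rewrite -[leRHS]mul1r ler_pdivlMr ?expR_gt0// mulrC.
by rewrite lef_pV2 ?posrE ?expR_gt0// ler_expR ler_nat.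
Qed.

(** The intervals [k m, (k+1) m] have N m nodes each. The interpolation error has
    the factor (T m)^(N m) / (N m)! <= e^(-m) as soon as N >= e^2 T, whereas each
    interval contains at least eta (e^m - 1) integers of K, more than 4 N m for
    large m. Summed over the intervals the error is at most a quarter of the
    square norm of a. *)
Theorem sampling_theorem T K (delta eta x0 : R) : 0 < T -> K `<=` [set n | (0 < n)%N] ->
  0 < delta < 1 -> 0 < eta -> dense_blocks K delta eta x0 ->
  exists2 C : R, 0 < C & forall a q y, sqint a -> supp T a ->
    (forall n, K n -> [/\ 0 <= q n, ln n%:R <= y n <= ln n.+1%:R &
      energy a (y n) / n%:R <= 2 * q n]) ->
    ((sqn a)%:E <= C%:E * \sum_(n <oo | n \in K) (q n)%:E)%E.
Proof.
move=> T0 hK hdelta et0 dens; have /andP[dl0 dl1] := hdelta.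
wlog et1 : eta et0 dens / eta <= 1.
  move=> H; have [|/ltW e1] := leP eta 1; first exact: H et0 dens.
  apply: (H 1 ltr01 _ (lexx _)) => X xX; have [s [ss sK sX]] := dens X xX.
  exists s; split => //; rewrite mul1r.
  have [X0|X0] := leP 0 X; last exact: le_trans (ltW X0) (ler0n _ _).
  by apply: le_trans sX; rewrite ler_peMl.
have [N N0 NT] := exists_nat_ge (expR 2 * T).
have [m m0 mB] := exists_nat_ge
  (delta^-1 + `|x0| + 8 * N%:R / eta + 4 * (1 + T ^+ 2)).
have T2 := sqr_ge0 T.
have dli : 0 < delta^-1 by rewrite invr_gt0.
have N0' : 0 <= 8 * N%:R / eta by rewrite divr_ge0 ?mulr_ge0// ltW.
have x00 := normr_ge0 x0.
have m0' : (0:R) < m%:R by rewrite ltr0n.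
have m1 : (1:R) <= m%:R by rewrite ler1n.
(* The four terms of the bound on m serve F1, F2, F3 and F4 in this order. *)
have F1 : 1 + delta <= delta * expR m%:R.
  apply: (@le_trans _ _ (delta * (1 + m%:R))); last first.
    by rewrite ler_pM2l//; exact: expR_ge1Dx.
  rewrite mulrDr mulr1 addrC lerD2l -ler_pdivrMl// mulr1.
  by move: mB; lra.
have em : 1 + m%:R ^+ 2 / 2 <= expR m%:R :> R by exact: (expR_ge1Dxn 1 (ltW m0')).
pose X k : R := expR (k.+1%:R * m%:R) - 1.
have Xge k : expR m%:R - 1 <= X k by rewrite lerB// ler_expR ler_peMl ?ler1n// ltW.
have F2 k : x0 <= X k.
  apply: le_trans (Xge k); rewrite lerBrDl; apply: le_trans (expR_ge1Dx _).
  by rewrite lerD2l; move: mB (ler_norm x0); lra.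
have [d dE] : exists d, d.+1 = (N * m)%N.
  by exists (N * m).-1; rewrite prednK// muln_gt0 N0.
have F3 k : 4 * d.+1%:R <= eta * X k.
  apply: (@le_trans _ _ (eta * (m%:R ^+ 2 / 2))); last first.
    by rewrite ler_pM2l//; apply: le_trans (Xge k); move: em; lra.
  have : 8 * N%:R <= m%:R * eta by rewrite -ler_pdivrMr//; move: mB; lra.
  rewrite dE natrM -(ler_pM2r m0').
  by move: (eta) (m%:R) (N%:R) => u v w; rewrite expr2; lra.
pose A : R := m%:R ^+ d.+1 / d.+1`!%:R.
have A0 : 0 <= A by rewrite divr_ge0// exprn_ge0.
have F4 : 8 * m%:R * A ^+ 2 * ((T ^+ 2) ^+ d.+1 * (1 + T ^+ 2)) <= 1.
  have TA : T ^+ d.+1 * A <= expR (- m%:R).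
    by rewrite /A mulrA -exprMn dE; exact: pow_fact_le.
  have TA0 : 0 <= T ^+ d.+1 * A by rewrite mulr_ge0// exprn_ge0// ltW.
  have TA2 : (T ^+ d.+1 * A) ^+ 2 <= expR (- m%:R) ^+ 2.
    by rewrite ler_pXn2r// nnegrE ?expR_ge0.
  have -> : 8 * m%:R * A ^+ 2 * ((T ^+ 2) ^+ d.+1 * (1 + T ^+ 2)) =
      8 * m%:R * (1 + T ^+ 2) * (T ^+ d.+1 * A) ^+ 2.
    have -> : (T ^+ 2) ^+ d.+1 = (T ^+ d.+1) ^+ 2 by rewrite -!exprM mulnC.
    have E (u v w r : R) : r * v ^+ 2 * (u ^+ 2 * (1 + w)) = r * (1 + w) * (u * v) ^+ 2 by ring.
    exact: E.
  have c0 : 0 <= 8 * m%:R * (1 + T ^+ 2) by rewrite !mulr_ge0// addr_ge0.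
  apply: le_trans (ler_wpM2l c0 TA2) _.
  rewrite expRN exprVn ler_pdivrMr ?exprn_gt0 ?expR_gt0// mul1r.
  have mT : 4 * (1 + T ^+ 2) <= m%:R by move: mB; lra.
  have h1 : 8 * m%:R * (1 + T ^+ 2) <= 2 * m%:R ^+ 2.
    have E (u w : R) : u * (4 * (1 + w)) <= u * u -> 8 * u * (1 + w) <= 2 * u ^+ 2.
      by rewrite expr2; lra.
    exact: E (ler_wpM2l (ltW m0') mT).
  apply: (le_trans h1); rewrite [leRHS]expr2 -expRD.
  have := expR_ge1Dxn 1 (addr_ge0 (ltW m0') (ltW m0')).
  have E (u : R) : (u + u) ^+ 2 / 2 = 2 * u ^+ 2 by field.
  rewrite (_ : 2`! = 2%N)// E; apply: le_trans; exact: ler_wpDl (ler01) (lexx _).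
have sgE : 0 < eta / (4 * d.+1%:R) by rewrite divr_gt0// mulr_gt0.
pose C1 : R := 2 * d.+1%:R * ((m%:R / (eta / (4 * d.+1%:R))) ^+ d) ^+ 2 * (8 * d.+1%:R / eta).
have C10 : 0 < C1.
  have P0 := divr_gt0 m0' sgE; have D0 : (0:R) < d.+1%:R by rewrite ltr0n.
  apply: mulr_gt0; last by rewrite divr_gt0// mulr_gt0.
  apply: mulr_gt0; first by rewrite mulr_gt0.
  by do 2!apply: exprn_gt0.
exists (4 * (m%:R * C1)) => [|a q y ha sa hq]; first by rewrite mulr_gt0// mulr_gt0.
have [h1 s1 n1] := iter_mulid d.+1 ha sa; have [h2 s2 n2] := iter_mulid d.+2 ha sa.
have ce := energy_continuous ha sa.
have cD := continuousD_fun (energy_continuous h1 s1) (energy_continuous h2 s2).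
have mE := @continuous_EFin_measurable R setT _ ce.
have mD := @continuous_EFin_measurable R setT _ cD.
pose J k : set R := [set` `[k%:R * m%:R, k%:R * m%:R + m%:R[].
pose F x := energy (iter d.+1 mulid a) x + energy (iter d.+2 mulid a) x.
have F0 x : 0 <= F x by rewrite addr_ge0 ?energy_ge0.
have IF : (\int[mu]_(x in halfline) (F x)%:E =
    ((sqn (iter d.+1 mulid a) + sqn (iter d.+2 mulid a)) / 2)%:E)%E.
  rewrite /F; under eq_integral do rewrite EFinD.
  rewrite ge0_integralD; last 5 first.
  - exact: measurable_halfline.
  - by move=> x _; rewrite lee_fin energy_ge0.
  - exact: (@continuous_EFin_measurable R halfline _ (energy_continuous h1 s1)).
  - by move=> x _; rewrite lee_fin energy_ge0.
  - exact: (@continuous_EFin_measurable R halfline _ (energy_continuous h2 s2)).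
  by rewrite (plancherel T0 h1 s1) (plancherel T0 h2 s2) -EFinD mulrDl.
have bl := halfline_blocks m0' mD (fun x => F0 x : (0 <= (F x)%:E)%E).
have Jfin k : exists2 E : R, 0 <= E & (\int[mu]_(x in J k) (F x)%:E = E%:E)%E.
  have J0 : (0 <= \int[mu]_(x in J k) (F x)%:E)%E by apply: integral_ge0 => x _; rewrite lee_fin.
  have Jf : (\int[mu]_(x in J k) (F x)%:E \is a fin_num)%E.
    rewrite ge0_fin_numE//; apply: le_lt_trans (ltry ((sqn (iter d.+1 mulid a) + sqn (iter d.+2 mulid a)) / 2)).
    rewrite -IF; apply: ge0_subset_integral.
    - exact: measurable_itv.
    - exact: measurable_halfline.
    - exact: measurable_funTS.
    - by move=> x _; rewrite lee_fin.
    - move=> x; rewrite /J /halfline /= !in_itv/= andbT => /andP[+ _].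
      by apply: le_trans; rewrite mulr_ge0.
  by exists (fine (\int[mu]_(x in J k) (F x)%:E)%E); rewrite ?fineK// fine_ge0.
pose S k : \bar R := (\sum_(n <oo | [&& n \in K, (k%:R * m%:R <= ln n%:R :> R)%R &
  (ln n.+1%:R <= k.+1%:R * m%:R :> R)%R]) (q n)%:E)%E.
have S0 k : (0 <= S k)%E.
  by apply: nneseries_ge0 => n _ /and3P[nK _ _]; rewrite lee_fin; rewrite inE in nK; have [] := hq n nK.
have Jle k : (\int[mu]_(x in J k) (energy a x)%:E <=
    (4 * m%:R * A ^+ 2)%:E * \int[mu]_(x in J k) (F x)%:E + (m%:R * C1)%:E * S k)%E.
  have [E E0 IE] := Jfin k.
  have [s [us sK sle]] := block_le ha sa hdelta (introT andP (conj et0 et1)) m0 hK hq F1 (F3 k)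
    (dens _ (F2 k)) IE.
  have sS : ((\sum_(n <- s) q n)%:E <= S k)%E.
    apply: (sum_seq_le_series us) => [n /sK[Kn n1' n2']|n /and3P[nK _ _]].
      by rewrite mem_set//= n1' n2'.
    by rewrite inE in nK; have [] := hq n nK.
  rewrite IE; set B := 4 * A ^+ 2 * E + C1 * \sum_(n <- s) q n.
  apply: (@le_trans _ _ (\int[mu]_(x in J k) B%:E)%E).
    apply: ge0_le_integral.
    - exact: measurable_itv.
    - by move=> x _; rewrite lee_fin energy_ge0.
    - exact: measurable_funTS.
    - exact: measurable_cst.
    - move=> x; rewrite /J /= in_itv/= => /andP[x1 x2].
      by rewrite lee_fin; apply: sle; rewrite x1 (ltW x2).
  rewrite integral_cst; last exact: measurable_itv.
  rewrite /= lebesgue_measure_itv/= lte_fin ltrDl m0' -EFinD.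
  have -> : k%:R * m%:R + m%:R - k%:R * m%:R = m%:R :> R by rewrite addrAC subrr add0r.
  rewrite -EFinM /B mulrDl EFinD; apply: leeD.
    rewrite -EFinM lee_fin (_ : 4 * A ^+ 2 * E * m%:R = 4 * m%:R * A ^+ 2 * E)//.
    by move: (A) => u; ring.
  apply: le_trans (lee_wpmul2l _ sS); last by rewrite lee_fin mulr_ge0// ltW.
  by rewrite -EFinM lee_fin mulrC mulrA.
have Q0 n : K n -> 0 <= q n by move=> Kn; have [] := hq n Kn.
have SQ := series_blocks_le m0' hK Q0.
set Q := (\sum_(n <oo | n \in K) (q n)%:E)%E in SQ *.
have H : ((sqn a / 2)%:E <= (4 * m%:R * A ^+ 2)%:E *
    ((sqn (iter d.+1 mulid a) + sqn (iter d.+2 mulid a)) / 2)%:E + (m%:R * C1)%:E * Q)%E.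
  rewrite -(plancherel T0 ha sa) (halfline_blocks m0' mE); last first.
    by move=> x; rewrite lee_fin energy_ge0.
  have IF0 k : (0 <= \int[mu]_(x in J k) (F x)%:E)%E by apply: integral_ge0 => x _; rewrite lee_fin.
  have c0 : 0 <= 4 * m%:R * A ^+ 2 by rewrite !mulr_ge0.
  have c1 : 0 <= m%:R * C1 by rewrite mulr_ge0// ltW.
  have S1 : (\sum_(k <oo) \int[mu]_(x in J k) (energy a x)%:E <=
      \sum_(k <oo) ((4 * m%:R * A ^+ 2)%:E * \int[mu]_(x in J k) (F x)%:E +
        (m%:R * C1)%:E * S k))%E.
    apply: lee_nneseries => [k _ _|k _]; last exact: Jle.
    by apply: integral_ge0 => x _; rewrite lee_fin energy_ge0.
  apply: (le_trans S1).
  rewrite nneseriesD; last 2 first.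
  - by move=> k _ _; rewrite mule_ge0// lee_fin.
  - by move=> k _ _; rewrite mule_ge0// lee_fin.
  rewrite (nneseriesZl _ _ (fun k _ => IF0 k)) (nneseriesZl _ _ (fun k _ => S0 k)) -bl IF.
  by apply: leeD => //; apply: lee_wpmul2l; rewrite ?lee_fin.
have Qle : ((sqn a / 4)%:E <= (m%:R * C1)%:E * Q)%E.
  have err : 4 * m%:R * A ^+ 2 * ((sqn (iter d.+1 mulid a) + sqn (iter d.+2 mulid a)) / 2)
      <= sqn a / 4.
    have c0 : 0 <= 2 * m%:R * A ^+ 2 by rewrite !mulr_ge0// sqr_ge0.
    have := ler_wpM2l c0 (lerD n1 n2); have := ler_wpM2r (sqn_ge0 a) F4.
    rewrite (exprS (T ^+ 2) d.+1); move: ((T ^+ 2) ^+ d.+1) (T ^+ 2) (A ^+ 2) (m%:R).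
    move: (sqn a) (sqn _) (sqn _) => w w1 w2 t1 t2 u v; lra.
  have : ((sqn a / 2)%:E <= (sqn a / 4)%:E + (m%:R * C1)%:E * Q)%E.
    by apply: le_trans H _; apply: leeD2r; rewrite -EFinM lee_fin.
  rewrite -leeBlDl// -EFinB.
  by have -> : sqn a / 2 - sqn a / 4 = sqn a / 4 by field.
have -> : (4 * (m%:R * C1))%:E = (4%:E * (m%:R * C1)%:E)%E by [].
have -> : (sqn a)%:E = (4%:E * (sqn a / 4)%:E)%E.
  by rewrite -EFinM; congr EFin; field.
by rewrite -muleA; apply: lee_wpmul2l.
Qed.

End block_sums.

(** * From the density condition to the forms and back *)

Section density_to_forms.
Context {R : realType}.
Local Notation mu := (@lebesgue_measure R).
Local Notation mR := (measurableTypeR R).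
Implicit Types (a : R -> R) (K : set nat) (T : R).
Variables (K : set nat) (T delta eta x0 : R).
Hypotheses (hK : K `<=` [set n | (0 < n)%N]) (T0 : 0 < T) (hd : 0 < delta < 1)
  (et0 : 0 < eta) (dens : dense_blocks K delta eta x0).

Lemma dense_Zform : form_below T (Zform K).
Proof.
have [C C0 CP] := sampling_theorem T0 hK hd et0 dens.
exists C^-1 => [|a ha sa]; first by rewrite invr_gt0.
have := CP a (fun n => energy a (ln n%:R) / n%:R) (fun n => ln n%:R) ha sa.
move=> /(_ _)/wrap[n Kn|h].
  split; first by rewrite divr_ge0 ?energy_ge0.
    by rewrite lexx /=; exact: ln_nat_le (leqnSn n).
  by rewrite ler_peMl ?divr_ge0 ?energy_ge0// ler1n.
have Ci : (0 <= (C^-1)%:E)%E by rewrite lee_fin invr_ge0 ltW.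
rewrite EFinM; apply: le_trans (lee_wpmul2l Ci h) _.
by rewrite muleA -EFinM mulVf ?mul1e// gt_eqF.
Qed.

(** On each logarithmic block the sampling point is the minimum of the energy. *)
Lemma dense_Lform : form_below T (Lform K).
Proof.
have [C C0 CP] := sampling_theorem T0 hK hd et0 dens.
exists C^-1 => [|a ha sa]; first by rewrite invr_gt0.
have ce := energy_continuous ha sa.
have /choice[y yP] : forall n : nat, exists t, t \in `[ln n%:R, ln n.+1%:R] /\
    forall t', t' \in `[ln n%:R, ln n.+1%:R] -> energy a t <= energy a t'.
  move=> n; have [t tI tP] := EVT_min (@ln_nat_le R _ _ (leqnSn n)) (continuous_subspaceT ce).
  by exists t.
have I0 n : (0 <= \int[mu]_(x in lblock n) (energy a x)%:E)%E.
  by apply: integral_ge0 => x _; rewrite lee_fin energy_ge0.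
have mE := @continuous_EFin_measurable R setT _ ce.
have Ifin n : (\int[mu]_(x in lblock n) (energy a x)%:E \is a fin_num)%E.
  rewrite ge0_fin_numE//; apply: le_lt_trans (ltry (sqn a / 2)).
  rewrite -(plancherel T0 ha sa); apply: ge0_subset_integral.
  - exact: lblock_measurable.
  - exact: measurable_halfline.
  - exact: measurable_funTS.
  - by move=> x _; rewrite lee_fin energy_ge0.
  - exact: lblock_halfline.
pose q n := fine (\int[mu]_(x in lblock n) (energy a x)%:E)%E.
have hq n : K n -> [/\ 0 <= q n, ln n%:R <= y n <= ln n.+1%:R &
    energy a (y n) / n%:R <= 2 * q n].
  move=> Kn; have n0 : (0 < n)%N := hK Kn; have n0' : (0:R) < n%:R by rewrite ltr0n.
  have [yI ymin] := yP n; split; first exact: fine_ge0.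
    by move: yI; rewrite in_itv.
  have : ((ln n.+1%:R - ln n%:R) * energy a (y n) <= q n).
    rewrite -lee_fin fineK//.
    have -> : ((ln n.+1%:R - ln n%:R) * energy a (y n))%:E =
        (\int[mu]_(x in lblock n) (energy a (y n))%:E)%E.
      rewrite integral_cst; last exact: lblock_measurable.
      rewrite /= lebesgue_measure_itv/= lte_fin ltr_ln ?posrE ?ltr0n// ltr_nat leqnn.
      by rewrite -EFinD -EFinM mulrC.
    apply: ge0_le_integral.
    - exact: lblock_measurable.
    - by move=> x _; rewrite lee_fin energy_ge0.
    - exact: measurable_cst.
    - exact: measurable_funTS.
    - move=> x; rewrite /lblock /= in_itv/= => /andP[x1 x2].
      by rewrite lee_fin; apply: ymin; rewrite in_itv/= x1 ltW.
  have := ler_wpM2r (energy_ge0 a (y n)) (@ln_succ_ge R n n0).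
  have -> : energy a (y n) / n%:R = 2 * ((2 * n%:R)^-1 * energy a (y n)).
    by field; rewrite gt_eqF.
  by move=> h1 h2; rewrite ler_pM2l// (le_trans h1).
have h := CP a q y ha sa hq.
have Ci : (0 <= (C^-1)%:E)%E by rewrite lee_fin invr_ge0 ltW.
rewrite EFinM; apply: le_trans (lee_wpmul2l Ci h) _.
rewrite muleA -EFinM mulVf ?mul1e ?gt_eqF// /Lform Lpos_series//; last first.
  by move=> x; rewrite lee_fin energy_ge0.
by apply: lee_nneseries => [n nK _|n _]; rewrite /q ?lee_fin ?fine_ge0// fineK.
Qed.

End density_to_forms.

Section modulation.
Context {R : realType}.
Local Notation mu := (@lebesgue_measure R).
Local Notation mR := (measurableTypeR R).
Implicit Types (a f g phi : R -> R) (K : set nat) (s l T A : R).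

Lemma trigt_combine (phi phi1 phi2 f g : R -> R) (l l1 l2 k : R) : trig_like phi1 ->
  trig_like phi2 -> mu.-integrable setT (EFin \o f) ->
  (forall x, g x * phi (x * l) = 2^-1 * (f x * phi1 (x * l1) + k * (f x * phi2 (x * l2)))) ->
  trigt phi g l = (trigt phi1 f l1 + k * trigt phi2 f l2) / 2.
Proof.
move=> t1 t2 fi e; have i1 := trig_integrable l1 t1 fi; have i2 := trig_integrable l2 t2 fi.
have i2k := integrableZr_fun k i2; have i12 := integrableD_fun i1 i2k.
rewrite /trigt; have -> : (fun x => g x * phi (x * l)) =
    (fun x => 2^-1 * (f x * phi1 (x * l1) + k * (f x * phi2 (x * l2)))) by apply/funext.
rewrite (RintegralZl 2^-1 measurableT i12) (RintegralD measurableT i1 i2k).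
rewrite (RintegralZl k measurableT i2).
have E (p q c : R) : c * (2^-1 * (p + k * q)) = (c * p + k * (c * q)) / 2 by field.
exact: E.
Qed.

(** Modulation moves the energy to the frequencies s and -s. *)
Lemma energy_modulate f s l : mu.-integrable setT (EFin \o f) ->
  energy (fun x => f x * cos (x * s)) l + energy (fun x => f x * sin (x * s)) l =
  (energy f (l - s) + energy f (l + s)) / 2.
Proof.
move=> fi; rewrite /energy /ct /st.
rewrite (@trigt_combine cos cos cos f _ l (l - s) (l + s) 1 trig_cos trig_cos fi); last first.
  by move=> x; rewrite (mulrBr x l s) (mulrDr x l s) cosB cosD; field.
rewrite (@trigt_combine sin sin sin f _ l (l + s) (l - s) 1 trig_sin trig_sin fi); last first.
  by move=> x; rewrite (mulrBr x l s) (mulrDr x l s) sinB sinD; field.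
rewrite (@trigt_combine cos sin sin f _ l (l + s) (l - s) (-1) trig_sin trig_sin fi); last first.
  by move=> x; rewrite (mulrBr x l s) (mulrDr x l s) sinB sinD; field.
rewrite (@trigt_combine sin cos cos f _ l (l - s) (l + s) (-1) trig_cos trig_cos fi); last first.
  by move=> x; rewrite (mulrBr x l s) (mulrDr x l s) cosB cosD; field.
by move: (trigt _ _ _) (trigt _ _ _) (trigt _ _ _) (trigt _ _ _) => p q r u; field.
Qed.

Lemma integral_translate (G : R -> R) s : continuous G -> (forall x, 0 <= G x) ->
  (\int[mu]_x (G (x + s))%:E = \int[mu]_x (G x)%:E)%E.
Proof.
move=> cG G0; pose F (x : R) := x + s.
have dF x : is_derive x (1:R) F 1.
  by apply: is_derive_eq; rewrite addr0.
have F' : F^`()%classic = cst 1 by apply/funext => x; rewrite derive1E; have [_ ->] := dF x.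
rewrite (@increasing_ge0_integration_by_substitutionT R F G)//.
- by apply: eq_integral => x _; rewrite F' /= mulr1.
- by move=> x y xy; rewrite ltrD2r.
- by rewrite F'; exact: cst_continuous.
- by rewrite F'; exact: is_cvg_cst.
- by rewrite F'; exact: is_cvg_cst.
- apply/cvgrNyPle => B; apply: filterS (nbhs_ninfty_le (num_real (B - s))) => x.
  by rewrite /F; lra.
- apply/cvgryPge => B; apply: filterS (nbhs_pinfty_ge (num_real (B - s))) => x.
  by rewrite /F; lra.
Qed.

End modulation.

Section forms_to_density.
Context {R : realType}.
Local Notation mu := (@lebesgue_measure R).
Local Notation mR := (measurableTypeR R).
Implicit Types (a f : R -> R) (s x A : R) (n N : nat).

(** Stands for the indicator of |u| >= A; continuity is what makes translation
    invariance of its integrals an instance of integration by substitution. *)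
Definition far A (u : R) : R := 2 * u ^+ 2 / (A ^+ 2 + u ^+ 2).

Lemma far_den A u : 0 < A -> 0 < A ^+ 2 + u ^+ 2.
Proof. by move=> A0; rewrite ltr_pwDl ?exprn_gt0// sqr_ge0. Qed.

Lemma far_ge0 A u : 0 < A -> 0 <= far A u.
Proof.
move=> A0; apply: divr_ge0; last exact/ltW/far_den.
exact: mulr_ge0 (ler0n _ 2) (sqr_ge0 u).
Qed.

Lemma far_le2 A u : 0 < A -> far A u <= 2.
Proof.
move=> A0; rewrite ler_pdivrMr ?far_den// mulrDr lerDr.
exact: mulr_ge0 (ler0n _ 2) (sqr_ge0 A).
Qed.

Lemma far_ge1 A u : 0 < A -> A <= `|u| -> 1 <= far A u.
Proof.
move=> A0 Au; rewrite ler_pdivlMr ?far_den// mul1r -(real_normK (num_real u)).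
have : A ^+ 2 <= `|u| ^+ 2 by rewrite ler_pXn2r// nnegrE// ltW.
lra.
Qed.

Lemma far_continuous A : 0 < A -> continuous (far A).
Proof.
move=> A0 u; have cs (v : R) : v ^+ 2 @[v --> u] --> u ^+ 2.
  by apply: cvgM; exact: cvg_id.
apply: cvgM; first by apply: cvgM; [exact: cvg_cst|exact: cs].
apply: cvgV; first by rewrite gt_eqF// far_den.
by apply: cvgD; [exact: cvg_cst|exact: cs].
Qed.

Lemma far_cvg u : far n.+1%:R u @[n --> \oo] --> (0:R).
Proof.
have b n : 0 <= far n.+1%:R u <= 2 * u ^+ 2 * n.+1%:R^-1.
  rewrite far_ge0//= ler_wpM2l//; first exact: mulr_ge0 (ler0n _ 2) (sqr_ge0 u).
  rewrite lef_pV2 ?posrE ?far_den//.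
  have n1 : (1:R) <= n.+1%:R by rewrite ler1n.
  by have := sqr_ge0 u; move: n1; move: (n.+1%:R) => m; nra.
apply: (@squeeze_cvgr _ _ _ _ (fun=> 0) (fun n : nat => 2 * u ^+ 2 * n.+1%:R^-1)).
- by apply: nearW => n; exact: b.
- exact: cvg_cst.
rewrite -[X in _ --> X](mulr0 (2 * u ^+ 2)).
by apply: cvgM; [exact: cvg_cst|exact: cvg_harmonic].
Qed.

Variables (K : set nat) (T : R).
Hypotheses (hK : K `<=` [set n | (0 < n)%N]) (T0 : 0 < T).

Let b : R -> R := chi_itv T.
Let xb : R -> R := fun x => x * b x.

(** The integrand of Wform for the indicator of the interval. *)
Definition window_energy (u : R) : R := energy (chi_itv T) u + energy (fun x => x * chi_itv T x) u.
Local Notation W := window_energy.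

Let sb : supp T b. Proof. by move=> x xT; rewrite /b chi_itv0. Qed.
Let hb : sqint b.
Proof.
by apply: (bounded_sqint (M := 1) (chi_itv_meas T) sb) => x;
  case: (chi_itv_cases T x) => e; rewrite /b e ?normr0 ?normr1.
Qed.
Let hxb : sqint xb. Proof. exact: sqint_mulid hb sb. Qed.
Let sxb : supp T xb. Proof. exact: supp_mull. Qed.

Lemma window_continuous : continuous W.
Proof. exact: continuousD_fun (energy_continuous hb sb) (energy_continuous hxb sxb). Qed.

Lemma window_ge0 u : 0 <= W u.
Proof. by rewrite addr_ge0 ?energy_ge0. Qed.

Lemma window_bounded : exists2 M, 0 < M & forall u, W u <= M.
Proof.
have E f u : mu.-integrable setT (EFin \o f) -> energy f u <= 2 * (c0 * \int[mu]_x `|f x|) ^+ 2.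
  move=> fi; have h1 := trigt_bound u trig_cos fi; have h2 := trigt_bound u trig_sin fi.
  have B0 := le_trans (normr_ge0 _) h1.
  rewrite /energy -(real_normK (num_real (ct f u))) -(real_normK (num_real (st f u))).
  have sq (y : R) : `|y| <= c0 * (\int[mu]_x `|f x|) -> `|y| ^+ 2 <= (c0 * \int[mu]_x `|f x|) ^+ 2.
    by move=> yB; rewrite ler_pXn2r// nnegrE.
  by have := sq _ h1; have := sq _ h2; move: (_ ^+ 2) (_ ^+ 2) (_ ^+ 2) => p q r; lra.
have ib := supp_integrable hb sb; have ixb := supp_integrable hxb sxb.
exists (1 + 2 * (c0 * \int[mu]_x `|b x|) ^+ 2 + 2 * (c0 * \int[mu]_x `|xb x|) ^+ 2).
  have p (y : R) : 0 <= 2 * y ^+ 2 by exact: mulr_ge0 (ler0n _ 2) (sqr_ge0 y).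
  by rewrite -addrA ltr_pwDl// addr_ge0.
move=> u; have := E b u ib; have := E xb u ixb; rewrite /W -/b -/xb.
by move: (energy b u) (energy xb u) (2 * _) (2 * _) => p q r s; lra.
Qed.

Lemma window_integrable : mu.-integrable setT (EFin \o W).
Proof.
have mW : measurable_fun setT W by exact: continuous_measurable_fun window_continuous.
apply/integrableP; split; first exact/measurable_EFinP.
under eq_integral do rewrite /= ger0_norm ?window_ge0//.
rewrite ge0_integral_fold//; last exact: window_ge0.
have Ef f u : mu.-integrable setT (EFin \o f) -> energy f (- u) = energy f u.
  by move=> fi; rewrite /energy ctN stN// sqrrN.
have ib := supp_integrable hb sb; have ixb := supp_integrable hxb sxb.
have -> : (\int[mu]_(x in halfline) (W x + W (- x))%:E =
    \int[mu]_(x in halfline) (2%:E * ((energy b x)%:E + (energy xb x)%:E)))%E.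
  apply: eq_integral => x _; rewrite -EFinD -EFinM /W -/b -/xb (Ef b) ?(Ef xb)//; congr EFin; ring.
rewrite ge0_integralZl//; last 2 first.
- have := (@continuous_EFin_measurable R halfline _
    (continuousD_fun (energy_continuous hb sb) (energy_continuous hxb sxb))).
  by apply: eq_measurable_fun => x _; rewrite /= EFinD.
- by move=> x _; rewrite -EFinD lee_fin addr_ge0 ?energy_ge0.
rewrite ge0_integralD; last 5 first.
- exact: measurable_halfline.
- by move=> x _; rewrite lee_fin energy_ge0.
- exact: (@continuous_EFin_measurable R halfline _ (energy_continuous hb sb)).
- by move=> x _; rewrite lee_fin energy_ge0.
- exact: (@continuous_EFin_measurable R halfline _ (energy_continuous hxb sxb)).
by rewrite (plancherel T0 hb sb) (plancherel T0 hxb sxb) -EFinD -EFinM ltry.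
exact: measurable_halfline.
Qed.

Lemma window_far e : 0 < e -> exists2 A, 0 < A &
  (\int[mu]_u (W u * far A u)%:E <= e%:E)%E.
Proof.
move=> e0; have iW := window_integrable.
have mW : measurable_fun setT W by exact: continuous_measurable_fun window_continuous.
have mF n : measurable_fun setT (fun u => W u * far n.+1%:R u).
  by apply: measurable_funM => //; apply: continuous_measurable_fun; exact: far_continuous.
have dom n u : `|W u * far n.+1%:R u| <= 2 * W u.
  rewrite ger0_norm; last by rewrite mulr_ge0 ?window_ge0 ?far_ge0.
  by rewrite mulrC ler_wpM2r ?window_ge0 ?far_le2.
have cF u : W u * far n.+1%:R u @[n --> \oo] --> (0:R).
  rewrite -[X in _ --> X](mulr0 (W u)).
  by apply: cvgM; [exact: cvg_cst|exact: far_cvg].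
have := Rdominated_cvg mF cF (integrableZr_fun 2 iW) dom.
rewrite Rintegral_cst// mul0r => /cvgrPdist_le/(_ _ e0)[n _ /(_ n (leqnn n))/=].
rewrite sub0r normrN => /(le_trans (ler_norm _)) h; exists n.+1%:R => //.
have iF : mu.-integrable setT (EFin \o (fun u => W u * far n.+1%:R u)).
  apply: (le_integrable measurableT _ _ (integrableZr_fun 2 iW)).
    by apply/measurable_EFinP; exact: mF.
  by move=> u _; rewrite /= lee_fin (le_trans (dom n u))// ler_norm.
rewrite -(fineK (integrable_fin_num measurableT iF)) lee_fin; exact: h.
Qed.

Lemma Wform_modulated (c s : R) :
  (forall a, sqint a -> supp T a -> ((c * sqn a)%:E <= Wform K a)%E) -> 0 < c ->
  ((4 * T * c)%:E <= \int[mu]_(l in Lpos K) (W (l - s) + W (l + s))%:E)%E.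
Proof.
move=> cP c0; have ib := supp_integrable hb sb; have ixb := supp_integrable hxb sxb.
pose a1 x := b x * cos (x * s); pose a2 x := b x * sin (x * s).
have tr (phi : R -> R) : trig_like phi -> sqint (fun x => b x * phi (x * s)) /\
    supp T (fun x => b x * phi (x * s)).
  move=> tphi; have sp : supp T (fun x => b x * phi (x * s)).
    by move=> x xT; rewrite sb// mul0r.
  split => //; apply: (bounded_sqint (M := 1) _ sp) => [|x].
    by apply: measurable_funM; [exact: chi_itv_meas|exact: trig_meas].
  rewrite normrM; case: (chi_itv_cases T x) => e; rewrite /b e ?normr0 ?mul0r//.
  by rewrite normr1 mul1r; exact: tphi.2.
have [h1 s1] := tr cos (@trig_cos R); have [h2 s2] := tr sin (@trig_sin R).
have n12 : sqn a1 + sqn a2 = 2 * T.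
  rewrite !sqnER -(RintegralD measurableT h1.2 h2.2) -(chi_itv_int T0).
  apply: eq_Rintegral => x _; rewrite /a1 /a2 !exprMn -mulrDr cos2Dsin2 mulr1 /b.
  by case: (chi_itv_cases T x) => ->; rewrite ?expr0n ?expr1n.
have m1 := energyD_measurable h1 s1; have m2 := energyD_measurable h2 s2.
have := leeD (cP a1 h1 s1) (cP a2 h2 s2).
rewrite -EFinD -mulrDr n12 /Wform -ge0_integralD; first last.
- exact: measurable_funTS.
- by move=> x _; rewrite lee_fin addr_ge0 ?energy_ge0.
- exact: measurable_funTS.
- by move=> x _; rewrite lee_fin addr_ge0 ?energy_ge0.
- exact: measurable_Lpos.
move=> h; have -> : (4 * T * c)%:E = (2%:E * (c * (2 * T))%:E)%E.
  by rewrite -EFinM; congr EFin; ring.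
have z2 : (0 <= 2%:E :> \bar R)%E by rewrite lee_fin.
apply: (le_trans (lee_wpmul2l z2 h)); rewrite -ge0_integralZl; last 4 first.
- exact: measurable_Lpos.
- have := emeasurable_funD m1 m2; exact: measurable_funTS.
- by move=> x _; apply: adde_ge0; rewrite lee_fin addr_ge0 ?energy_ge0.
- by [].
have E l : 2 * ((energy a1 l + energy (fun x => x * a1 x) l) +
    (energy a2 l + energy (fun x => x * a2 x) l)) = W (l - s) + W (l + s).
  have e1 := energy_modulate s l ib; have e2 := energy_modulate s l ixb.
  have -> : (fun x => x * a1 x) = (fun x => xb x * cos (x * s)).
    by apply/funext => x; rewrite /a1 /xb mulrA.
  have -> : (fun x => x * a2 x) = (fun x => xb x * sin (x * s)).
    by apply/funext => x; rewrite /a2 /xb mulrA.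
  rewrite addrACA [X in 2 * (X + _)]e1 [X in 2 * (_ + X)]e2 /W -/b -/xb.
  by move: (energy b _) (energy b _) (energy xb _) (energy xb _) => p q r u; field.
rewrite le_eqVlt; apply/orP; left; apply/eqP; apply: eq_integral => l _.
by rewrite -EFinD -EFinM E.
Qed.

Lemma integral_indicM (D : set R) (f : R -> R) : measurable (D : set mR) ->
  (\int[mu]_(x in D) (f x)%:E = \int[mu]_x (\1_D x * f x)%:E)%E.
Proof.
move=> mD; rewrite [LHS]integral_mkcond; apply: eq_integral => x _.
by rewrite patchE indicE; case: ifP => _; rewrite ?mul1r ?mul0r.
Qed.

Lemma ge0_integral_addr (f g : R -> R) : measurable_fun setT f -> measurable_fun setT g ->
  (forall x, 0 <= f x) -> (forall x, 0 <= g x) ->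
  (\int[mu]_x (f x + g x)%:E = \int[mu]_x (f x)%:E + \int[mu]_x (g x)%:E)%E.
Proof.
move=> mf mg f0 g0; under eq_integral do rewrite EFinD.
rewrite ge0_integralD//.
- by move=> x _; rewrite lee_fin.
- exact/measurable_EFinP.
- by move=> x _; rewrite lee_fin.
- exact/measurable_EFinP.
Qed.

Lemma Lpos_finite (P : pred nat) N (f : R -> R) B : (forall n, P n -> (n < N)%N) ->
  measurable_fun setT f -> (forall x, 0 <= f x) -> 0 <= B ->
  (forall n, P n -> (\int[mu]_(x in lblock n) (f x)%:E <= B%:E)%E) ->
  (\int[mu]_(x in Lpos [set n | P n]) (f x)%:E <=
   (B * (size [seq n <- index_iota 0 N | P n])%:R)%:E)%E.
Proof.
move=> PN mf f0 B0 fB; have mf' : measurable_fun setT (EFin \o f) by exact/measurable_EFinP.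
rewrite (Lpos_series _ mf'); last by move=> x; rewrite lee_fin.
have Pn n : (n \in [set n | P n]) = P n by apply/idP/idP; rewrite inE.
rewrite (eq_eseriesl _ _ Pn) (nneseries_split_cond 0 N); last first.
  by move=> n _; apply: integral_ge0 => x _; rewrite lee_fin.
rewrite [X in (_ + X)%E]eseries0 ?adde0; last first.
  by move=> n; rewrite add0n => Nn /PN; rewrite ltnNge Nn.
rewrite add0n; apply: (@le_trans _ _ (\sum_(0 <= n < N | P n) B%:E)%E).
  by apply: lee_sum.
rewrite sumEFin lee_fin big_const_seq iter_addr_0 size_filter mulr_natr; exact: lexx.
Qed.

(** Test functions whose spectral energy is concentrated near the frequency s
    force the part of the spectrum near s to have measure bounded below. *)
Theorem form_below_dense : form_below T (Wform K) ->
  exists d e x0 : R, [/\ 0 < d < 1, 0 < e & dense_blocks K d e x0].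
Proof.
move=> [c c0 cP]; have [M M0 WM] := window_bounded.
have [A A0 AF] := window_far (mulr_gt0 T0 c0).
(* With x = e^(s + A), blocks of integers outside (d x, x] stay at distance at
   least A from s. *)
pose d : R := expR (- (2 * A)) / 2.
have d0 : 0 < d by rewrite divr_gt0// expR_gt0.
have d1 : d < 1.
  have : expR (- (2 * A)) <= 1 by rewrite expR_le1 oppr_le0 mulr_ge0// ltW.
  by rewrite /d; lra.
exists d, (2 * T * c * d / M), (2 * expR (2 * A)); split; first by rewrite d0.
  by rewrite divr_gt0// mulr_gt0// mulr_gt0// mulr_gt0.
move=> x xA; have eA := expR_gt0 (2 * A).
have x0 : 0 < x by apply: lt_le_trans xA; rewrite mulr_gt0.
have dx1 : 1 <= d * x.
  have -> : 1 = expR (- (2 * A)) / 2 * (2 * expR (2 * A)) :> R.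
    by rewrite mulrA divfK// -expRD addNr expR0.
  by rewrite ler_pM2l.
pose s : R := ln x - A.
have sA : A <= s.
  have : ln (expR (2 * A)) <= ln x.
    by rewrite ler_ln ?posrE//; move: xA eA; lra.
  by rewrite expRK /s; lra.
pose P n := (n \in K) && (d * x < n%:R <= x).
pose N := (Num.truncn x).+1.
have PN n : P n -> (n < N)%N.
  move=> /and3P[_ _ nx]; rewrite -(ltr_nat R); apply: (le_lt_trans nx).
  by have /andP[] := truncn_itv (ltW x0).
exists [seq n <- index_iota 0 N | P n]; split.
- by apply: sorted_filter; [exact: ltn_trans|exact: iota_ltn_sorted].
- by move=> n; rewrite mem_filter => /andP[/andP[nK ->] _]; rewrite inE in nK.
pose G u := W u * far A u.
have cG : continuous G.
  by move=> u; apply: cvgM; [exact: window_continuous|exact: far_continuous].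
have G0 u : 0 <= G u by rewrite mulr_ge0 ?window_ge0 ?far_ge0.
have mT r : measurable_fun setT (fun l : R => l + r) by exact: measurable_funD.
have mG r : measurable_fun setT (fun l : R => G (l + r)).
  exact: (measurableT_comp (continuous_measurable_fun cG) (mT r)).
have mW r : measurable_fun setT (fun l : R => W (l + r)).
  exact: (measurableT_comp (continuous_measurable_fun window_continuous) (mT r)).
have pw (l : R) : Lpos K l -> W (l - s) + W (l + s) <=
    (l \in Lpos [set n | P n])%:R * W (l - s) + (G (l - s) + G (l + s)).
  move=> [n Kn]; rewrite /= in_itv/= => /andP[nl ln1].
  have n0 : (0 < n)%N := hK Kn; have n0' : (0:R) < n%:R by rewrite ltr0n.
  have l0 : 0 <= l by exact: le_trans (@ln_nat_ge0 R n) nl.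
  have Wfar u : A <= `|u| -> W u <= G u.
    by move=> Au; rewrite /G ler_peMr ?window_ge0// far_ge1.
  have far2 : W (l + s) <= G (l + s).
    by apply: Wfar; apply: le_trans (ler_norm _); exact: ler_wpDl l0 sA.
  have [lP|lP] := boolP (l \in Lpos [set n | P n]).
    rewrite mul1r; have := G0 (l - s); move: far2.
    by move: (W (l - s)) (W (l + s)) (G (l - s)) (G (l + s)) => p q r u; lra.
  rewrite mul0r add0r; apply: lerD => //; apply: Wfar.
  have nP : ~~ P n.
    apply: contra lP => Pn; rewrite inE; exists n => //.
    by rewrite /= in_itv/= nl.
  have [xn|nx] := ltP x n%:R.
    have : ln x <= ln n%:R by rewrite ler_ln ?posrE// ltW.
    by move=> h; apply: le_trans (ler_norm _); move: h nl; rewrite /s; lra.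
  have nd : n%:R <= d * x.
    by rewrite leNgt; apply: contra nP => h; rewrite /P mem_set// h nx.
  have : ln n.+1%:R <= ln (expR (- (2 * A)) * x).
    rewrite ler_ln ?posrE ?ltr0n ?mulr_gt0 ?expR_gt0// -natr1.
    by move: nd dx1; rewrite /d; lra.
  rewrite lnM ?posrE ?expR_gt0// expRK => h.
  by rewrite -normrN; apply: le_trans (ler_norm _); move: h ln1; rewrite /s; lra.
have near1 : (\int[mu]_(l in Lpos K) (W (l - s) + W (l + s))%:E <=
    \int[mu]_(l in Lpos [set n | P n]) (W (l - s))%:E +
    (\int[mu]_l (G (l - s))%:E + \int[mu]_l (G (l + s))%:E))%E.
  have mP := @measurable_Lpos R [set n | P n].
  have mI : measurable_fun setT (fun l : R => \1_(Lpos [set n | P n]) l * W (l - s)).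
    by apply: measurable_funM; [exact: measurable_indic|exact: mW].
  have I0 (l : R) : 0 <= \1_(Lpos [set n | P n]) l * W (l - s).
    by rewrite mulr_ge0 ?window_ge0.
  have mGG : measurable_fun setT (fun l : R => G (l - s) + G (l + s)).
    by apply: measurable_funD; exact: mG.
  have GG0 (l : R) : 0 <= G (l - s) + G (l + s) by rewrite addr_ge0.
  rewrite (integral_indicM _ mP) (integral_indicM _ (@measurable_Lpos R K)).
  rewrite -(ge0_integral_addr (mG (- s)) (mG s))// -(ge0_integral_addr mI mGG)//.
  apply: ge0_le_integral => //.
  - by move=> l _; rewrite lee_fin mulr_ge0// addr_ge0 ?window_ge0.
  - apply/measurable_EFinP; apply: measurable_funM.
      exact: measurable_indic (@measurable_Lpos R K).
    by apply: measurable_funD; exact: mW.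
  - by apply/measurable_EFinP; exact: measurable_funD.
  move=> l _; rewrite lee_fin !indicE.
  case: (boolP (l \in Lpos K)) => [|_]; last first.
    by rewrite mul0r addr_ge0// mulr_ge0 ?window_ge0.
  rewrite mul1r.
  by rewrite inE => Kl; exact: pw.
have e1 : (\int[mu]_l (G (l - s))%:E = \int[mu]_l (G l)%:E)%E.
  exact: (integral_translate (- s) cG G0).
have e2 := integral_translate s cG G0.
have B0 : 0 <= M / (d * x) by rewrite divr_ge0// ltW// mulr_gt0.
have blk n : P n -> (\int[mu]_(l in lblock n) (W (l - s))%:E <= (M / (d * x))%:E)%E.
  move=> /and3P[nK nd _]; have n0 : (0 < n)%N by rewrite inE in nK; exact: hK nK.
  have n0' : (0:R) < n%:R by rewrite ltr0n.
  apply: (@le_trans _ _ (\int[mu]_(l in lblock n) M%:E)%E).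
    apply: ge0_le_integral.
    - exact: lblock_measurable.
    - by move=> l _; rewrite lee_fin window_ge0.
    - by apply: measurable_funTS; apply/measurable_EFinP; exact: mW.
    - exact: measurable_cst.
    - by move=> l _; rewrite lee_fin.
  rewrite integral_cst; last exact: lblock_measurable.
  rewrite /= lebesgue_measure_itv/= lte_fin ltr_ln ?posrE ?ltr0n// ltr_nat leqnn.
  rewrite -EFinD -EFinM lee_fin ler_pM2l//; apply: le_trans (ln_succ_le n0) _.
  have dx0 : 0 < d * x by exact: mulr_gt0.
  by rewrite lef_pV2 ?posrE//; exact: ltW.
have fin := Lpos_finite PN (mW (- s)) (fun l => window_ge0 (l - s)) B0 blk.
have := le_trans (Wform_modulated s cP c0) near1; rewrite e1 e2 => h.
have {h} := le_trans h (leeD fin (leeD AF AF)); rewrite -!EFinD lee_fin.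
set z := (size _)%:R => h.
have h' : 2 * T * c <= M / (d * x) * z by move: h; lra.
rewrite mulrAC ler_pdivrMr//; have dx0 : 0 < d * x by rewrite mulr_gt0.
move: h'; rewrite [leRHS]mulrAC ler_pdivlMr// => h'.
by move: h'; rewrite (mulrA _ d) (mulrC M).
Qed.

End forms_to_density.

(** * The density condition as a lower limit *)

Section density_limit.
Context {R : realType}.
Implicit Types (K : set nat) (d u x X : R) (n N : nat).

Lemma counting_funE K u N : (forall n, n%:R <= u -> (n < N)%N) ->
  counting_fun K u = (size [seq n <- index_iota 0 N | (n \in K) && (n%:R <= u)])%:R :> R.
Proof.
move=> uN; rewrite /counting_fun; congr (_%:R); set s := [seq _ <- _ | _].
have us : uniq s by exact/filter_uniq/iota_uniq.
have -> : K `&` [set n | n%:R <= u] = [set` [fset n in s]%fset].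
  apply/seteqP; split=> n /=.
    move=> [Kn nu]; rewrite inE /= mem_filter mem_index_iota /= uN// nu andbT andbT.
    by rewrite mem_set.
  by rewrite inE /= mem_filter => /andP[/andP[nK nu] _]; split => //; rewrite inE in nK.
by rewrite set_fsetK card_fseq undup_id.
Qed.

Definition block_seq K u X : seq nat :=
  [seq n <- index_iota 0 (Num.truncn X).+1 | [&& n \in K, u < n%:R & n%:R <= X]].

Lemma counting_diff K u X : 0 <= X -> u <= X ->
  counting_fun K X - counting_fun K u = (size (block_seq K u X))%:R.
Proof.
move=> X0 uX; set N := (Num.truncn X).+1.
have XN n : n%:R <= X -> (n < N)%N.
  move=> nX; rewrite -(ltr_nat R); apply: (le_lt_trans nX).
  by have /andP[] := truncn_itv X0.
rewrite (counting_funE K XN) (@counting_funE K u N) => [|n nu]; last first.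
  by apply: XN; exact: le_trans uX.
apply/eqP; rewrite subr_eq -natrD; apply/eqP; congr (_%:R).
rewrite /block_seq -/N !size_filter -!sum1_count.
rewrite (bigID (fun n : nat => n%:R <= u)) /= addnC; congr (_ + _)%N; apply: eq_bigl => n.
  by rewrite -ltNge -andbA (andbC (n%:R <= X)).
by rewrite -andbA; case: (n \in K) => //=; case: (leP n%:R u) => [nu|_]; rewrite ?andbF// (le_trans nu).
Qed.

Lemma block_seqP K u X : sorted ltn (block_seq K u X) /\
  forall n, (n \in block_seq K u X) = [&& n \in K, u < n%:R & n%:R <= X].
Proof.
split; first by apply: sorted_filter; [exact: ltn_trans|exact: iota_ltn_sorted].
move=> n; rewrite mem_filter mem_index_iota /= andb_idr// => /and3P[_ _ nX].
have X0 : 0 <= X by apply: le_trans nX.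
rewrite -(ltr_nat R); apply: (le_lt_trans nX).
by have /andP[] := truncn_itv X0.
Qed.

Lemma density_limitP K d : 0 < d < 1 ->
  (0 < limf_einf (fun x : R =>
     ((counting_fun K x - counting_fun K (d * x)) / x)%:E) +oo%R)%E <->
  exists e x0 : R, 0 < e /\ dense_blocks K d e x0.
Proof.
move=> /andP[d0 d1]; rewrite limf_einfE; split.
  move=> /ereal_sup_gt[_ [V [M [_ MV]] <-]] y0.
  have [e e0 eV] : exists2 e : R, 0 < e & (e%:E <= ereal_inf ((fun x : R =>
     ((counting_fun K x - counting_fun K (d * x)) / x)%:E) @` V))%E.
    move: y0; case: (ereal_inf _) => [r| |]//= r0; first by exists r.
    by exists 1; rewrite // leey.
  exists e, (Num.max (M + 1) 1); split => // X; rewrite ge_max => /andP[XM X1].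
  have X0 : 0 < X by exact: lt_le_trans X1.
  have dX : d * X <= X by rewrite ler_piMl// ltW.
  have [ss sP] := block_seqP K (d * X) X.
  exists (block_seq K (d * X) X); split => //.
    by move=> n; rewrite sP => /and3P[nK -> ->]; rewrite inE in nK.
  rewrite -(counting_diff K (ltW X0) dX) -ler_pdivlMr// -lee_fin.
  apply: (le_trans eV); apply: ereal_inf_lbound; exists X => //; apply: MV.
  by move: XM; lra.
move=> [e [x0 [e0 dens]]].
apply: (@lt_le_trans _ _ e%:E); first by rewrite lte_fin.
pose V : set R := [set x | Num.max x0 1 < x].
apply: le_ereal_sup_tmp; exists (ereal_inf ((fun x : R =>
     ((counting_fun K x - counting_fun K (d * x)) / x)%:E) @` V)).
  by exists V => //; exists (Num.max x0 1); split; [exact: num_real|].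
apply: le_ereal_inf_tmp => _ [X XV <-]; rewrite /V /= gt_max in XV.
have /andP[Xx X1] := XV; have X0 : 0 < X by exact: lt_trans X1.
have dX : d * X <= X by rewrite ler_piMl// ltW.
rewrite lee_fin ler_pdivlMr// (counting_diff K (ltW X0) dX).
have [s [ss sK se]] := dens X (ltW Xx); apply: (le_trans se); rewrite ler_nat.
apply: uniq_leq_size; first by apply: sorted_uniq ss; [exact: ltn_trans|exact: ltnn].
by move=> n /sK[Kn /andP[n1 n2]]; rewrite (block_seqP K (d * X) X).2 mem_set// n1 n2.
Qed.

End density_limit.

Theorem theorem2 (R : realType) (K : set nat) (T : R)
    (hK : K `<=` [set n | (0 < n)%N]) (hT : 0 < T) :
  let I : set R := [set` `]- T, T[] in
  let a := bounded_below I (Zop K I) in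
  let b := bounded_below I
             (fun g => chi I (inv_fourier (chi (Lset K) (fourier g)))) in
  let c := exists delta : R, 0 < delta < 1 /\
    (0 < limf_einf
           (fun x : R =>
              ((counting_fun K x - counting_fun K (delta * x)) / x)%:E)
           +oo%R)%E in
  (a <-> b) /\ (b <-> c).
Proof.
move=> I a b c.
have aE : a <-> form_below T (Zform K) by exact: Zeta_form.
have bE : b <-> form_below T (Lform K) by exact: Fourier_form.
have WcP : form_below T (Wform K) -> c.
  move=> /(form_below_dense hK hT)[d [e [x0 [hd e0 dens]]]].
  by exists d; split => //; apply/density_limitP => //; exists e, x0.
have cD : c -> form_below T (Zform K) /\ form_below T (Lform K).
  move=> [d [hd /density_limitP]] => /(_ hd)[e [x0 [e0 dens]]].
  by split; [exact: dense_Zform dens|exact: dense_Lform dens].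
have ZW : form_below T (Zform K) -> form_below T (Wform K).
  move=> [k k0 kP]; exists (k / 4) => [|f hf sf]; first by rewrite divr_gt0.
  have := le_trans (kP f hf sf) (Zform_le hK hf sf).
  have i4 : (0 <= (4^-1)%:E :> \bar R)%E by rewrite lee_fin.
  move=> /(lee_wpmul2l i4); rewrite muleA -!EFinM mulVf// mul1e.
  by rewrite mulrA (mulrC _ k).
have LW : form_below T (Lform K) -> form_below T (Wform K).
  move=> [k k0 kP]; exists k => // f hf sf; apply: (le_trans (kP f hf sf)).
  have ce := energy_continuous hf sf.
  apply: ge0_le_integral.
  - exact: measurable_Lpos.
  - by move=> x _; rewrite lee_fin energy_ge0.
  - exact: (@continuous_EFin_measurable R (Lpos K) _ ce).
  - by apply: measurable_funTS; exact: energyD_measurable hf sf.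
  - by move=> x _; rewrite lee_fin lerDl energy_ge0.
rewrite aE bE; split; split.
- by move=> /ZW/WcP/cD[].
- by move=> /LW/WcP/cD[].
- by move=> /LW/WcP.
- by move=> /cD[].
Qed.
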